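(* Let $\mathcal{G}$ be an ultragraph that satisfies Condition (RFUM2), let $X$ be its boundary ultrapath space, and let $\alpha$ be the partial action of the free group $\mathbb{F}$ on $\mathcal{G}^1$ on $C_0(X)$ described in the context. Then there exists a $*$-isomorphism $\Phi:C^*(\mathcal{G})\rightarrow C_0(X)\rtimes_\alpha\mathbb{F}$ such that $\Phi(s_e)=1_e\delta_e$ for each $e\in\mathcal{G}^1$, and $\Phi(p_A)=1_A\delta_0$ for each $A\in\mathcal{G}^0$.
   Context: An ultragraph $\mathcal{G}=(G^0,\mathcal{G}^1,r,s)$ consists of countable sets $G^0$ (vertices) and $\mathcal{G}^1$ (edges) and maps $s:\mathcal{G}^1\to G^0$, $r:\mathcal{G}^1\to P(G^0)\setminus\{\emptyset\}$. $\mathcal{G}^0$ (generalized vertices) is the smallest subset of $P(G^0)$ containing $\{v\}$ for all $v\in G^0$ and $r(e)$ for all $e\in\mathcal{G}^1$, and closed under finite unions and nonempty finite intersections. For $A\in\mathcal{G}^0$, $\varepsilon(A)=\{e\in\mathcal{G}^1:s(e)\in A\}$; $A$ is an infinite emitter if $|\varepsilon(A)|=\infty$ and a finite emitter otherwise. A vertex $v$ is a sink if $s^{-1}(v)=\emptyset$ and regular if $0<|s^{-1}(v)|<\infty$; $G^0_s$ is the set of sinks. $A\in\mathcal{G}^0$ is a minimal infinite emitter if it is an infinite emitter and no proper subset $B\in\mathcal{G}^0$ of $A$ is an infinite emitter or a finite emitter with $|B|=\infty$. $A\in\mathcal{G}^0$ is a minimal sink if $|A|=\infty$, $|\varepsilon(A)|<\infty$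 and no proper subset $B\in\mathcal{G}^0$ of $A$ is infinite. Condition (RFUM2): for each $e\in\mathcal{G}^1$, $r(e)=\bigcup_{n=1}^kA_n$ for finitely many $A_n$, each of which is a minimal infinite emitter, or a minimal sink, or a singleton formed by a sink or a regular vertex. $C^*(\mathcal{G})$ is the universal C*-algebra generated by partial isometries with orthogonal ranges $\{s_e:e\in\mathcal{G}^1\}$ and projections $\{p_A:A\in\mathcal{G}^0\}$ satisfying: (1) $p_\emptyset=0$, $p_Ap_B=p_{A\cap B}$, $p_{A\cup B}=p_A+p_B-p_{A\cap B}$; (2) $s_e^*s_e=p_{r(e)}$ and $s_es_e^*\leq p_{s(e)}$; (3) $p_v=\sum_{s(e)=v}s_es_e^*$ whenever $0<|s^{-1}(v)|<\infty$ (here $p_v=p_{\{v\}}$). A finite path of length $n\ge1$ is $\alpha=e_1\ldots e_n$ with $e_i\in\mathcal{G}^1$, $s(e_{i+1})\in r(e_i)$; $s(\alpha)=s(e_1)$, $r(\alpha)=r(e_n)$. An ultrapath of length $n\ge 1$ is a pair $(\alpha,A)$ with $\alpha$ a finite path of length $n$, $A\in\mathcal{G}^0$, $A\subseteq r(\alpha)$; an ultrapath of length $0$ is an $A\in\mathcal{G}^0$, also written $(A,A)$, with $s(A)=r(A)=A$. $\mathfrak{p}$ is the set of all ultrapaths; $\mathfrak{p}^\infty$ the set of infinite paths $e_1e_2\ldots$ with $s(e_{i+1})\in r(e_i)$. $X_{fin}$ is the set of ultrapaths $(\alpha,A)$ of length $\geq 0$ (meaning $(A,A)$ for length $0$) such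 that $A$ is a minimal infinite emitter, or a minimal sink, or $A=\{v\}$ with $v$ a sink; $X_{sin}\subseteq X_{fin}$ consists of those for which $A$ is a minimal sink or $A=\{v\}$, $v$ a sink. $X=\mathfrak{p}^\infty\sqcup X_{fin}$. Topology on $X$: the basis consists of $D_{(\beta,B)}=\{y\in X: y=\beta\gamma,\ s(\gamma)\in B\}$ for $(\beta,B)\in\mathfrak{p}$, $|\beta|\ge1$ (for $\gamma=(C,C)$ of length $0$, $y=(\beta,C)$ and the condition reads $C\subseteq B$), and $D_{(\beta,B),F,S}=\{(\beta,B)\}\cup\{y\in X:y=\beta\gamma',|\gamma'|\ge1,\gamma'_1\in\varepsilon(B)\setminus F\}\cup\{(\beta,\{v\})\in X_{sin}:v\in B\setminus S\}$ for $(\beta,B)\in X_{fin}$, $F\subseteq\varepsilon(B)$, $S\subseteq B\cap G^0_s$ finite (for $|\beta|=0$: $\beta\gamma'=\gamma'$, $(\beta,\{v\})$ means $(\{v\},\{v\})$). $X$ is locally compact Hausdorff. Partial action: $\mathbb{F}$ is the free group generated by $\mathcal{G}^1$, with neutral element $0$; $P=\{e_1\ldots e_n\in\mathbb{F}:e_i\in\mathcal{G}^1,n\ge1\}$. Put $X_0=X$. For a finite path $a\in P$: $X_a$ is the set of $x\in X$ whose first $|a|$ edges are $a$; $X_{a^{-1}}=\{x\in X: s(x)\in r(a)\}$ (for $x=(A,A)$ of length $0$: $A\subseteq r(a)$). For finite paths $a,b\in P$ with $ab^{-1}$ reduced: $X_{ab^{-1}}$ is the set of $x=ax'\in X_a$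 with $s(x')\in r(a)\cap r(b)$ (for $x=(a,A)$: $A\subseteq r(a)\cap r(b)$). All other $X_c$, $c\in\mathbb{F}$, are empty. $\theta_0=\mathrm{id}$; $\theta_a:X_{a^{-1}}\to X_a$, $x\mapsto ax$ (with $(A,A)\mapsto(a,A)$); $\theta_{a^{-1}}=\theta_a^{-1}$; $\theta_{ab^{-1}}:X_{ba^{-1}}\to X_{ab^{-1}}$, $bx\mapsto ax$ (with $(b,A)\mapsto(a,A)$). Set $\alpha_t:C_0(X_{t^{-1}})\to C_0(X_t)$, $\alpha_t(f)=f\circ\theta_{t^{-1}}$; this is a C*-algebraic partial action of $\mathbb{F}$ on $C_0(X)$, and $C_0(X)\rtimes_\alpha\mathbb{F}$ is the partial crossed product, densely spanned by the elements $f\delta_t$, $f\in C_0(X_t)$. $1_c$ denotes the characteristic function of $X_c$ ($c\in\mathbb{F}\setminus\{0\}$) and $1_A$ the characteristic function of $X_A=\{x\in X:s(x)\subseteq A\}$ for $A\in\mathcal{G}^0$ (for $|x|\geq1$, $s(x)$ is a vertex and the condition means $s(x)\in A$). *)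

(* Defs.v *)
From HB Require Import structures.
From mathcomp Require Import all_boot all_order all_algebra.
From mathcomp Require Import complex.
From mathcomp Require Import all_classical all_reals all_analysis.

Set Implicit Arguments.
Unset Strict Implicit.
Unset Printing Implicit Defensive.

Import Order.TTheory GRing.Theory Num.Theory.
Import numFieldNormedType.Exports.
Local Open Scope classical_set_scope.
Local Open Scope ring_scope.
Local Open Scope complex_scope.

(* C*-algebras over the complex numbers R[i], R : realType.  The product cmul
   need not have a unit, hence it is not the product of a pzRingType.  Norms
   are (nonnegative real) elements of R[i], as usual for normedModType R[i]. *)

HB.mixin Record CompleteNormedModule_isCStarAlgebra (R : realType) A
    of CompleteNormedModule R[i] A := {
  cmul : A -> A -> A;
  cstar : A -> A;
  cmulA : associative cmul;
  cmulDl : left_distributive cmul +%R;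
  cmulDr : right_distributive cmul +%R;
  cmulZl : forall (c : R[i]) (x y : A), cmul (c *: x) y = c *: cmul x y;
  cmulZr : forall (c : R[i]) (x y : A), cmul x (c *: y) = c *: cmul x y;
  cstarK : involutive cstar;
  cstarD : {morph cstar : x y / x + y};
  cstarZ : forall (c : R[i]) (x : A), cstar (c *: x) = c^* *: cstar x;
  cstarM : forall x y : A, cstar (cmul x y) = cmul (cstar y) (cstar x);
  cnormM : forall x y : A, `|cmul x y| <= `|x| * `|y|;
  cnorm_cstar : forall x : A, `|cmul (cstar x) x| = `|x| ^+ 2
}.

#[short(type="cstarAlgType")]
HB.structure Definition CStarAlgebra (R : realType) :=
  {A of CompleteNormedModule_isCStarAlgebra R A & CompleteNormedModule R[i] A}.

Section CStarTheory.
Variable R : realType.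

Record star_hom (A B : cstarAlgType R) (phi : A -> B) : Prop := StarHom {
  star_homD : forall x y, phi (x + y) = phi x + phi y;
  star_homZ : forall (c : R[i]) x, phi (c *: x) = c *: phi x;
  star_homM : forall x y, phi (cmul x y) = cmul (phi x) (phi y);
  star_hom_star : forall x, phi (cstar x) = cstar (phi x)
}.

Definition star_iso (A B : cstarAlgType R) (phi : A -> B) : Prop :=
  star_hom phi /\ bijective phi.

Record star_subalg (A : cstarAlgType R) (S : set A) : Prop := StarSubalg {
  star_subalg0 : S 0;
  star_subalgD : forall x y, S x -> S y -> S (x + y);
  star_subalgZ : forall (c : R[i]) x, S x -> S (c *: x);
  star_subalgM : forall x y, S x -> S y -> S (cmul x y);
  star_subalg_star : forall x, S x -> S (cstar x)
}.

Definition projection (A : cstarAlgType R) (q : A) : Prop :=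
  cstar q = q /\ cmul q q = q.

Definition partial_isometry (A : cstarAlgType R) (x : A) : Prop :=
  cmul (cmul x (cstar x)) x = x.

(* the order q <= p of projections *)
Definition proj_le (A : cstarAlgType R) (q p : A) : Prop :=
  cmul p q = q /\ cmul q p = q.

End CStarTheory.

(* The free group on E, as reduced words in the letters (e, true), standing
   for e, and (e, false), standing for the inverse of e. *)

Section FreeGroup.
Variable E : choiceType.
Implicit Types (l : E * bool) (w u v : seq (E * bool)).

Definition linv l : E * bool := (l.1, ~~ l.2).

Definition reduced w : bool := sorted (fun l m => m != linv l) w.

Definition rcancel l w : seq (E * bool) :=
  if w is m :: w' then if m == linv l then w' else l :: w else [:: l].

Definition wmul u v : seq (E * bool) := foldr rcancel v u.
Definition winv w : seq (E * bool) := rev [seq linv l | l <- w].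

Lemma linvK : involutive linv.
Proof. by case=> e b; rewrite /linv negbK. Qed.

Lemma reduced_cons l w : reduced (l :: w) -> reduced w.
Proof. by case: w => //= m w /andP[]. Qed.

Lemma reduced_rcancel l w : reduced w -> reduced (rcancel l w).
Proof.
case: w => //= m w rw; case: ifP => [_|/negbT ml]; first exact: reduced_cons rw.
by rewrite /= ml.
Qed.

Lemma reduced_wmul u v : reduced v -> reduced (wmul u v).
Proof. by move=> rv; elim: u => //= l u IH; exact: reduced_rcancel. Qed.

Lemma reduced_winv w : reduced w -> reduced (winv w).
Proof.
rewrite /reduced /winv rev_sorted sorted_map; apply: sub_sorted => l m /=.
by apply: contraNneq => ->; rewrite !linvK.
Qed.

Lemma rcancelK l w : reduced w -> rcancel l (rcancel (linv l) w) = w.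
Proof.
case: w => [|m w] /=; first by rewrite eqxx.
rewrite linvK; have [-> |ml rw] := eqVneq m l; last by rewrite /= eqxx.
by case: w => //= k w /andP[/negbTE ->].
Qed.

Lemma wmul_rcancel l u v : reduced u -> reduced v ->
  wmul (rcancel l u) v = rcancel l (wmul u v).
Proof.
case: u => //= m u ru rv; case: ifP => // /eqP ->.
by rewrite rcancelK //; exact: reduced_wmul.
Qed.

Lemma wmulA u v w : reduced u -> reduced v -> reduced w ->
  wmul u (wmul v w) = wmul (wmul u v) w.
Proof.
move=> _ rv rw; elim: u => //= l u ->.
by rewrite wmul_rcancel //; exact: reduced_wmul.
Qed.

Lemma wmulw1 u : reduced u -> wmul u [::] = u.
Proof.
elim: u => //= l u IH ru; rewrite IH ?(reduced_cons ru)//.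
by case: u ru {IH} => //= m u /andP[/negbTE ->].
Qed.

Lemma wmul_cat u1 u2 v : wmul (u1 ++ u2) v = wmul u1 (wmul u2 v).
Proof. exact: foldr_cat. Qed.

Lemma wmulVr w u : reduced u -> wmul (winv w) (wmul w u) = u.
Proof.
move=> ru; elim: w => //= l w IH; rewrite /winv /= rev_cons -cats1 wmul_cat /=.
by rewrite -[X in rcancel _ (rcancel X _)]linvK rcancelK ?reduced_wmul.
Qed.

Lemma wmulrV w u : reduced u -> wmul w (wmul (winv w) u) = u.
Proof.
elim: w u => //= l w IH u ru; rewrite /winv /= rev_cons -cats1 wmul_cat /=.
by rewrite IH ?rcancelK ?reduced_rcancel.
Qed.

Record freegroup := FreeGroup { fgword :> seq (E * bool); _ : reduced fgword }.

HB.instance Definition _ := [isSub for fgword].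
HB.instance Definition _ := [Choice of freegroup by <:].

Lemma fgwordP (c : freegroup) : reduced c. Proof. exact: valP. Qed.

Definition fgone : freegroup := @FreeGroup [::] isT.
Definition fgmul (c d : freegroup) : freegroup :=
  FreeGroup (reduced_wmul c (fgwordP d)).
Definition fginv (c : freegroup) : freegroup :=
  FreeGroup (reduced_winv (fgwordP c)).
Definition fggen (e : E) : freegroup := @FreeGroup [:: (e, true)] isT.

Lemma fgmulA : associative fgmul.
Proof. by move=> c d f; apply: val_inj; rewrite /= wmulA ?fgwordP. Qed.
Lemma fgmul1 : left_id fgone fgmul.
Proof. by move=> c; apply: val_inj. Qed.
Lemma fgmulr1 : right_id fgone fgmul.
Proof. by move=> c; apply: val_inj; rewrite /= wmulw1 ?fgwordP. Qed.
Lemma fgmulV : left_inverse fgone fginv fgmul.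
Proof.
move=> c; apply: val_inj => /=.
by rewrite -[X in wmul _ X](wmulw1 (fgwordP c)) wmulVr.
Qed.
Lemma fgmulrV : right_inverse fgone fginv fgmul.
Proof.
move=> c; apply: val_inj => /=.
by rewrite -[X in wmul _ X]wmulw1 ?wmulrV //; exact: reduced_winv (fgwordP c).
Qed.

HB.instance Definition _ :=
  isGroup.Build freegroup fgmulA fgmul1 fgmulr1 fgmulV fgmulrV.

End FreeGroup.

(* Partial crossed products.  A partial action of the group H on the space T is
   given by domains D t and maps theta t, of which only the restriction
   D (t^-1) -> D t matters.  C_0(D t) is viewed inside the functions on T. *)

Section CrossedProduct.
Variables (R : realType) (T : topologicalType) (H : groupType).
Variables (D : H -> set T) (theta : H -> T -> T).

Definition C0 (U : set T) : set (T -> R[i]) :=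
  [set f | [/\ continuous (f : T -> R[i]^o),
               forall eps : R[i], 0 < eps -> compact [set x | eps <= `|f x|]
             & forall x, ~ U x -> f x = 0]].

Definition pact (t : H) (f : T -> R[i]) : T -> R[i] :=
  fun x => if x \in D t then f (theta t^-1%g x) else 0.

(* finite sums of terms a_t delta_t, as functions t |-> a_t *)
Definition alg_crossed_product : set (H -> T -> R[i]) :=
  [set a | finite_set [set t | a t <> 0] /\ forall t, C0 (D t) (a t)].

Definition delta (t : H) (f : T -> R[i]) : H -> T -> R[i] :=
  fun u => if u == t then f else 0.

(* (f delta_s)(g delta_t) = alpha_s(alpha_{s^-1}(f) g) delta_{st} *)
Definition cp_mul (a b : H -> T -> R[i]) : H -> T -> R[i] :=
  fun t x => \sum_(s \in [set: H])
    pact s (fun y => pact s^-1%g (a s) y * b (s^-1 * t)%g y) x.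

(* the adjoint of f delta_t is alpha_{t^-1}(g) delta_{t^-1}, g the conjugate of f *)
Definition cp_star (a : H -> T -> R[i]) : H -> T -> R[i] :=
  fun t => pact t (fun y => (a t^-1%g y)^*).

Record cp_cstar_seminorm (rho : (H -> T -> R[i]) -> R) : Prop := {
  cp_seminorm_ge0 : forall a, alg_crossed_product a -> 0 <= rho a;
  cp_seminormD : forall a b, alg_crossed_product a -> alg_crossed_product b ->
    rho (a + b) <= rho a + rho b;
  cp_seminormZ : forall (c : R[i]) a, alg_crossed_product a ->
    (rho (c *: a))%:C = `|c| * (rho a)%:C;
  cp_seminormM : forall a b, alg_crossed_product a -> alg_crossed_product b ->
    rho (cp_mul a b) <= rho a * rho b;
  cp_seminorm_star : forall a, alg_crossed_product a ->
    rho (cp_star a) = rho a;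
  cp_seminorm_cstar : forall a, alg_crossed_product a ->
    rho (cp_mul (cp_star a) a) = rho a ^+ 2
}.

(* (B, iota) is the enveloping C*-algebra of alg_crossed_product, that is, its
   Hausdorff completion for the largest C*-seminorm. *)
Record is_crossed_product (B : cstarAlgType R) (iota : (H -> T -> R[i]) -> B)
    : Prop := {
  cp_iotaD : forall a b, alg_crossed_product a -> alg_crossed_product b ->
    iota (a + b) = iota a + iota b;
  cp_iotaZ : forall (c : R[i]) a, alg_crossed_product a ->
    iota (c *: a) = c *: iota a;
  cp_iotaM : forall a b, alg_crossed_product a -> alg_crossed_product b ->
    iota (cp_mul a b) = cmul (iota a) (iota b);
  cp_iota_star : forall a, alg_crossed_product a ->
    iota (cp_star a) = cstar (iota a);
  cp_iota_dense : closure (iota @` alg_crossed_product) = setT;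
  cp_iota_max : forall rho, cp_cstar_seminorm rho ->
    forall a, alg_crossed_product a -> (rho a)%:C <= `|iota a|
}.

End CrossedProduct.

Record ultragraph := Ultragraph {
  vert : countType;
  edge : countType;
  src : edge -> vert;
  rng : edge -> set vert;
  rng_neq0 : forall e, rng e !=set0
}.

Section Ultragraph.
Variable G : ultragraph.
Local Notation V := (vert G).
Local Notation E := (edge G).
Implicit Types (A B : set V) (a b : seq E).

(* The closure under finite unions includes the empty union. *)
Definition gvert : set (set V) :=
  smallest [set M | [/\ M set0, setU_closed M & setI_closed M]]
    ([set [set v] | v in [set: V]] `|` range (@rng G)).

Definition emitted A : set E := [set e | A (src e)].

Definition infinite_emitter A : Prop := infinite_set (emitted A).

Definition sink : set V := [set v | emitted [set v] = set0].

Definition regular : set V :=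
  [set v | emitted [set v] !=set0 /\ finite_set (emitted [set v])].

Definition min_infinite_emitter A : Prop :=
  [/\ gvert A, infinite_emitter A &
      forall B, gvert B -> B `<` A ->
        ~ (infinite_emitter B \/ (~ infinite_emitter B /\ infinite_set B))].

Definition min_sink A : Prop :=
  [/\ gvert A, infinite_set A, finite_set (emitted A) &
      forall B, gvert B -> B `<` A -> ~ infinite_set B].

Definition RFUM2 : Prop :=
  forall e : E, exists (k : nat) (A : nat -> set V),
    rng e = \bigcup_(n < k) A n /\
    forall n, (n < k)%N ->
      [\/ min_infinite_emitter (A n), min_sink (A n) |
          exists2 v, sink v \/ regular v & A n = [set v]].

(* finite paths, including the empty word *)
Definition is_path a : bool := sorted (fun e f => src f \in rng e) a.

(* r(a), with the convention that r([::]) is the set of all vertices *)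
Definition prng a : set V := if a is e :: a' then rng (last e a') else setT.

(* [::], A stands for the ultrapath (A, A) of length 0. *)
Definition ultrapath a A : Prop := [/\ is_path a, gvert A & A `<=` prng a].

Definition Xfin a A : Prop :=
  ultrapath a A /\
  [\/ min_infinite_emitter A, min_sink A | exists2 v, sink v & A = [set v]].

Definition Xsin a A : Prop :=
  ultrapath a A /\ (min_sink A \/ exists2 v, sink v & A = [set v]).

Definition infinite_path (x : nat -> E) : Prop :=
  forall n, rng (x n) (src (x n.+1)).

(* Fin a A is the pair (a, A); Inf x is the word x 0, x 1, ... *)
Inductive uword : Type := Fin of seq E & set V | Inf of (nat -> E).

Definition boundary (y : uword) : Prop :=
  match y with Fin a A => Xfin a A | Inf x => infinite_path x end.

Definition usrc (y : uword) : set V :=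
  match y with
  | Fin [::] A => A
  | Fin (e :: _) _ => [set src e]
  | Inf x => [set src (x 0%N)]
  end.

(* the first edge; None for words of length 0 *)
Definition ufirst (y : uword) : option E :=
  match y with
  | Fin a _ => ohead a
  | Inf x => Some (x 0%N)
  end.

(* concatenation a y, and removal of the first k edges *)
Definition ucat a (y : uword) : uword :=
  match y with
  | Fin b A => Fin (a ++ b) A
  | Inf x => Inf (fun n => nth (x (n - size a)%N) a n)
  end.

Definition udrop (k : nat) (y : uword) : uword :=
  match y with
  | Fin b A => Fin (drop k b) A
  | Inf x => Inf (fun n => x (n + k)%N)
  end.

Definition bspace : Type := {y : uword | boundary y}.

HB.instance Definition _ := gen_eqMixin bspace.
HB.instance Definition _ := gen_choiceMixin bspace.

(* D_(b,B); "s(c) in B" is usrc c `<=` B, also for c of length 0 *)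
Definition cylinder b B : set bspace :=
  [set y | exists2 c, sval y = ucat b c & usrc c `<=` B].

(* D_((b,B),F,S) *)
Definition cylinder_at b B (F : set E) (S : set V) : set bspace :=
  [set y | sval y = Fin b B]
  `|` [set y | exists c e, [/\ sval y = ucat b c, ufirst c = Some e
                             & (emitted B `\` F) e]]
  `|` [set y | exists2 v, (B `\` S) v
                        & sval y = Fin b [set v] /\ Xsin b [set v]].

Definition bspace_basis : set (set bspace) :=
  [set cylinder bB.1 bB.2 | bB in
     [set bB : seq E * set V | ultrapath bB.1 bB.2 /\ (0 < size bB.1)%N]]
  `|` [set U | exists b B F S,
         [/\ Xfin b B,
             F `<=` emitted B /\ finite_set F,
             S `<=` B `&` sink /\ finite_set S
           & U = cylinder_at b B F S]].

(* the topology generated by bspace_basis *)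
HB.instance Definition _ :=
  @isSubBaseTopological.Build bspace (set bspace) bspace_basis id.

(* Every reduced word whose positive letters precede its negative ones is of
   the form a b^-1; then a = wpos and b = wneg. *)
Definition wpos (c : freegroup E) : seq E := [seq l.1 | l <- fgword c & l.2].
Definition wneg (c : freegroup E) : seq E :=
  rev [seq l.1 | l <- fgword c & ~~ l.2].
Definition pos_word a : seq (E * bool) := [seq (e, true) | e <- a].
Definition is_posneg (c : freegroup E) : Prop :=
  fgword c = pos_word (wpos c) ++ winv (pos_word (wneg c)).

(* X_c.  Thanks to the convention on prng, the cases c = 0, c = a and
   c = b^-1 are those where a or b is empty. *)
Definition bdom (c : freegroup E) : set bspace :=
  [set y | [/\ is_posneg c, is_path (wpos c), is_path (wneg c) &
     exists2 z, sval y = ucat (wpos c) z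
              & usrc z `<=` prng (wpos c) `&` prng (wneg c)]].

(* theta_(a b^-1) (b z) = a z; the value outside of X_(b a^-1) is irrelevant *)
Definition bact (c : freegroup E) (y : bspace) : bspace :=
  let z := ucat (wpos c) (udrop (size (wneg c)) (sval y)) in
  if pselect (boundary z) is left bz then exist _ z bz else y.

(* X_A *)
Definition bsrc A : set bspace := [set y | usrc (sval y) `<=` A].

End Ultragraph.

Section UltragraphAlgebra.
Variables (R : realType) (G : ultragraph).

(* The p A with A not a generalized vertex play no role. *)
Record ck_family (A : cstarAlgType R) (s : edge G -> A) (p : set (vert G) -> A)
    : Prop := {
  ck_pisom : forall e, partial_isometry (s e);
  ck_orth : forall e f, e <> f ->
    cmul (cmul (s e) (cstar (s e))) (cmul (s f) (cstar (s f))) = 0;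
  ck_proj : forall B, gvert B -> projection (p B);
  ck_p0 : p set0 = 0;
  ck_pI : forall B C, gvert B -> gvert C -> cmul (p B) (p C) = p (B `&` C);
  ck_pU : forall B C, gvert B -> gvert C ->
    p (B `|` C) = p B + p C - p (B `&` C);
  ck_range : forall e, cmul (cstar (s e)) (s e) = p (rng e);
  ck_source : forall e, proj_le (cmul (s e) (cstar (s e))) (p [set src e]);
  ck_regular : forall v, regular v ->
    p [set v] = \sum_(e \in emitted [set v]) cmul (s e) (cstar (s e))
}.

(* A, together with s and p, is the universal C*-algebra C*(G). *)
Record is_ultragraph_cstar (A : cstarAlgType R) (s : edge G -> A)
    (p : set (vert G) -> A) : Prop := {
  ugc_family : ck_family s p;
  ugc_generated : forall S : set A, closed S -> star_subalg S ->
    (forall e, S (s e)) -> (forall B, gvert B -> S (p B)) -> S = setT;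
  ugc_universal : forall (A' : cstarAlgType R) (s' : edge G -> A')
      (p' : set (vert G) -> A'), ck_family s' p' ->
    exists phi : A -> A', [/\ star_hom phi, forall e, phi (s e) = s' e
                            & forall B, gvert B -> phi (p B) = p' B]
}.

End UltragraphAlgebra.

(* Main.v *)
(* The elements 1_e delta_e and 1_B delta_0 of the crossed product form a
   Cuntz-Krieger family, whence Phi.

   Conversely, for a Cuntz-Krieger family (s, p) the projections
   s_b p_B s_b^* multiply like the characteristic functions of the cylinders
   (b, B), and q (1 - q_1) ... (1 - q_n) vanishes as soon as the cylinder of q
   is covered by those of q_1, ..., q_n: descending along regular vertices, where
   p_v is the sum of the s_e s_e^*, one ends at a minimal infinite emitter, a
   minimal sink or a sink B, and the boundary path (b, B) itself has to lie in
   one of the covering cylinders.  So 1_(b, B) |-> s_b p_B s_b^* extends to a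
   contractive *-homomorphism pi on the span of the characteristic functions of
   the cylinders, which is dense in C_0(X) since cylinders are compact and open.
   Then Psi (f delta_t) = pi(f) s_t is a *-homomorphism on the algebraic crossed
   product, and a |-> |Psi a| is a C*-seminorm, so |Psi a| <= |iota a|.  As
   Phi (Psi a) = iota a and Psi has dense range, |x| <= |Phi x| for all x: Phi is
   injective with closed, hence full, range.

   The continuity of Phi needs no spectral theory: a self-adjoint h with
   |h| <= 1/2 is the real part of the unitary h + i sqrt(1 - h^2) of the
   unitization, whose image is again unitary, so |Phi h| <= 2. *)

Require Import Defs.
From mathcomp Require Import all_boot all_order all_algebra.
From mathcomp Require Import complex.
From mathcomp Require Import all_classical all_reals all_analysis.
From mathcomp Require Import finmap ring lra.

Set Implicit Arguments.
Unset Strict Implicit.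
Unset Printing Implicit Defensive.

Import Order.TTheory GRing.Theory Num.Theory.
Import numFieldNormedType.Exports.
Local Open Scope classical_set_scope.
Local Open Scope ring_scope.
Local Open Scope complex_scope.

(** Neither A nor the crossed product is assumed to have a unit, so 1 - q and s_w occur only as
    operators applied to an element, [coproj] and [rmulw].

    Linear extension is done by relations. [span_pair] relates a function to an element formed with
    the same coefficients; a function has many such expressions, and only the estimate
    [span_pair_nrm] shows that they give the same element. That estimate needs no spectrum: an
    element commuting with a projection q splits into orthogonal parts below q and below 1 - q, and
    the norm of the sum is at most the larger of the two norms.

    The partial action is semi-saturated: theta_t is the composite of the actions of the letters of
    t. Hence covariance, adjoints and the multiplicativity of Psi are checked one letter at a time.
    In A, s_u s_v and s_(uv) may differ; they agree after left multiplication by pi(f) with f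
    supported in X_u.

    Condition (RFUM2) enters through the decomposition of every generalized vertex into finitely
    many pieces, each of which a given generalized vertex either contains or meets in a finite
    set. *)

Local Notation "x ** y" := (cmul x y) (at level 40, left associativity).

(** * C*-algebras *)

Section RealNorm.
Variables (R : realType) (V : normedZmodType R[i]).
Implicit Types x y : V.

(** Norms take values in [R[i]]; their real parts live in the ordered field [R], where [lra] and
    [nra] apply. *)
Definition nrm x : R := complex.Re `|x|.

Lemma nrmE x : `|x| = (nrm x)%:C.
Proof. by rewrite RRe_real// normr_real. Qed.

Lemma nrm_ge0 x : 0 <= nrm x.
Proof. by rewrite -ler0c -nrmE. Qed.

Lemma nrm0 : nrm 0 = 0. Proof. by rewrite /nrm normr0. Qed.

Lemma nrm_eq0 x : nrm x = 0 -> x = 0.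
Proof. by move=> x0; apply/normr0_eq0; rewrite nrmE x0. Qed.

Lemma nrmN x : nrm (- x) = nrm x. Proof. by rewrite /nrm normrN. Qed.

Lemma nrmD x y : nrm (x + y) <= nrm x + nrm y.
Proof. by rewrite -lecR rmorphD/= -!nrmE ler_normD. Qed.

Lemma nrmB x y : nrm (x - y) <= nrm x + nrm y.
Proof. by rewrite -(nrmN y) nrmD. Qed.

Lemma nrm_distC x y : nrm (x - y) = nrm (y - x).
Proof. by rewrite -nrmN opprB. Qed.

Lemma nrm_dist x y z : nrm (x - z) <= nrm (x - y) + nrm (y - z).
Proof. by rewrite -(subrKA y) nrmD. Qed.

Lemma nrm_le_dist x y : nrm x <= nrm y + nrm (x - y).
Proof. by rewrite addrC -{1}(subrK y x) nrmD. Qed.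

Lemma nrm_small x : (forall e : R, 0 < e -> nrm x <= e) -> x = 0.
Proof.
move=> H; apply: nrm_eq0; apply/eqP; rewrite eq_le nrm_ge0 andbT.
by apply/ler_addgt0Pr => e e0; rewrite add0r; exact: H.
Qed.

End RealNorm.

Section ComplexNorm.
Variable R : realType.
Implicit Types c d : R[i].

Lemma nrmCM c d : nrm (c * d) = nrm c * nrm d.
Proof. by apply: complexI; rewrite rmorphM/= -!nrmE normrM. Qed.

Lemma nrmC_conj c : nrm (Num.conj c) = nrm c.
Proof. by apply: complexI; rewrite -!nrmE normcJ. Qed.

Lemma nrmC_real (r : R) : nrm (r%:C : R[i]) = `|r|.
Proof. by rewrite /nrm normc_def /= expr0n addr0 sqrtr_sqr. Qed.

Lemma nrmCi : nrm ('i : R[i]) = 1.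
Proof. by rewrite /nrm normc_def /= expr0n add0r expr1n sqrtr1. Qed.

End ComplexNorm.

Section ModNorm.
Variables (R : realType) (V : normedModType R[i]).
Implicit Types x y : V.

Lemma nrmZ (c : R[i]) x : nrm (c *: x) = nrm c * nrm x.
Proof. by apply: complexI; rewrite rmorphM/= -!nrmE normrZ. Qed.

Lemma closure_nrmP (S : set V) x :
  closure S x <-> forall e : R, 0 < e -> exists2 y, S y & nrm (x - y) < e.
Proof.
split=> [cx e e0|H B].
  have e0' : (0 : R[i]) < e%:C by rewrite ltcR.
  have [y [Sy]] := cx _ (nbhsx_ballx x e%:C e0').
  by rewrite -ball_normE /= nrmE ltcR; exists y.
rewrite -nbhs_ballE => -[e /= e0 sB].
have eE : e = (complex.Re e)%:C by rewrite RRe_real// gtr0_real.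
have [|y Sy xy] := H (complex.Re e); first by rewrite -ltcR -eE.
by exists y; split => //; apply: sB; rewrite -ball_normE /= nrmE eE ltcR.
Qed.

Lemma closed_nrmP (S : set V) :
  closed S <-> forall x, (forall e : R, 0 < e -> exists2 y, S y & nrm (x - y) < e) -> S x.
Proof.
by split=> [cS x /closure_nrmP|H]; [exact: cS|move=> x /closure_nrmP; exact: H].
Qed.

End ModNorm.

Lemma half_exp_small (R : realType) (C e : R) : 0 < e ->
  exists n, C * (2^-1) ^+ n < e.
Proof.
move=> e0; pose n := Num.bound (C / e); exists n.
rewrite exprVn ltr_pdivrMr ?exprn_gt0// mulrC -ltr_pdivrMr//.
have /le_lt_trans : C / e <= `|C / e| by rewrite ler_norm.
apply; apply: lt_trans (archi_boundP (normr_ge0 _)) _.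
have -> : Num.bound `|C / e| = n by rewrite /n /Num.bound normr_id.
by rewrite -natrX ltr_nat ltn_expl.
Qed.

Section Complete.
Variables (R : realType) (V : completeNormedModType R[i]).

(** Limits of elements are taken along geometric sequences: the rate is part of the conclusion, and
    identities pass to the limit by [half_small]. *)
Lemma complete_half (u : nat -> V) (C : R) :
  (forall n, nrm (u n.+1 - u n) <= C * 2^-1 ^+ n) ->
  exists l, forall n, nrm (l - u n) <= C * 2 * 2^-1 ^+ n.
Proof.
move=> uC.
have C0 : 0 <= C.
  by have := le_trans (nrm_ge0 _) (uC 0%N); rewrite expr0 mulr1.
have half0 n : 0 <= (2^-1 : R) ^+ n by rewrite exprn_ge0// invr_ge0.
(* The factor 1 - 2^-m comes from the partial geometric sum and makes the induction on [m] close
   exactly. *)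
have dist n m : nrm (u (n + m)%N - u n) <= C * 2 * 2^-1 ^+ n * (1 - 2^-1 ^+ m).
  elim: m => [|m IH]; first by rewrite addn0 subrr nrm0 expr0 subrr mulr0.
  apply: le_trans (nrm_dist _ (u (n + m)%N) _) _; rewrite addnS.
  apply: le_trans (lerD (uC _) IH) _.
  rewrite exprD exprS; set a := _ ^+ n; set b := _ ^+ m; lra.
have dist2 n m : (n <= m)%N -> nrm (u m - u n) <= C * 2 * 2^-1 ^+ n.
  move=> nm; rewrite -(subnKC nm); apply: le_trans (dist _ _) _.
  by rewrite ler_piMr ?mulr_ge0// lerBlDr lerDl.
have cul : exists l : V, u n @[n --> \oo] --> l.
  suff cu : cvg (u n @[n --> \oo]) by exists (lim (u n @[n --> \oo])).
  apply: cauchy_cvg; apply/cauchy_ballP => e e0.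
  have eE : e = (complex.Re e)%:C by rewrite RRe_real// gtr0_real.
  have e1 : 0 < complex.Re e / 2 by rewrite divr_gt0// -ltcR -eE.
  have [N HN] := half_exp_small (C * 2) e1.
  exists (u @` [set n | (N <= n)%N], u @` [set n | (N <= n)%N]).
    by split; exists N => // n /= Nn; exists n.
  move=> _ [/= [n Nn <-] [m Nm <-]]; rewrite -ball_normE /= nrmE eE ltcR.
  apply: le_lt_trans (nrm_dist _ (u N) _) _.
  rewrite (nrm_distC (u N)).
  apply: le_lt_trans (lerD (dist2 _ _ Nn) (dist2 _ _ Nm)) _.
  by rewrite (splitr (complex.Re e)) ltrD.
case: cul => l ul; exists l => n; apply/ler_addgt0Pr => e e0.
have e0' : (0 : R[i]) < e%:C by rewrite ltcR.
move/cvgrPdist_lt: ul => /(_ _ e0')[N _ HN].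
have := HN (maxn n N) (leq_maxr _ _); rewrite /= nrmE ltcR => lN.
apply: le_trans (nrm_dist _ (u (maxn n N)) _) _.
by rewrite addrC; apply: lerD; [exact/dist2/leq_maxl|exact: ltW].
Qed.

End Complete.


Section CStar.
Variables (R : realType) (A : cstarAlgType R).
Implicit Types x y z h q : A.

Lemma cmul0x x : 0 ** x = 0.
Proof. by apply: (addIr (0 ** x)); rewrite -cmulDl !add0r. Qed.
Lemma cmulx0 x : x ** 0 = 0.
Proof. by apply: (addIr (x ** 0)); rewrite -cmulDr !add0r. Qed.
Lemma cmulNx x y : - x ** y = - (x ** y).
Proof. by apply/eqP; rewrite -addr_eq0 -cmulDl addNr cmul0x. Qed.
Lemma cmulxN x y : x ** - y = - (x ** y).
Proof. by apply/eqP; rewrite -addr_eq0 -cmulDr addNr cmulx0. Qed.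
Lemma cmulBl x y z : (x - y) ** z = x ** z - y ** z.
Proof. by rewrite cmulDl cmulNx. Qed.
Lemma cmulBr x y z : x ** (y - z) = x ** y - x ** z.
Proof. by rewrite cmulDr cmulxN. Qed.
Lemma cstar0 : cstar (0 : A) = 0.
Proof. by apply: (addIr (cstar 0)); rewrite -cstarD !add0r. Qed.
Lemma cstarN x : cstar (- x) = - cstar x.
Proof. by apply/eqP; rewrite -addr_eq0 -cstarD addNr cstar0. Qed.
Lemma cstarB x y : cstar (x - y) = cstar x - cstar y.
Proof. by rewrite cstarD cstarN. Qed.

Lemma nrmM x y : nrm (x ** y) <= nrm x * nrm y.
Proof. by rewrite -lecR rmorphM/= -!nrmE cnormM. Qed.

Lemma nrm_cstar_mul x : nrm (cstar x ** x) = nrm x ^+ 2.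
Proof. by apply: complexI; rewrite rmorphXn/= -!nrmE cnorm_cstar. Qed.

Lemma nrm_cstar x : nrm (cstar x) = nrm x.
Proof.
suff H y : nrm y <= nrm (cstar y).
  by apply/eqP; rewrite eq_le H -{2}(cstarK x) H.
have [->|y0] := eqVneq (nrm y) 0; first exact: nrm_ge0.
have y1 : 0 < nrm y by rewrite lt_neqAle eq_sym y0 nrm_ge0.
by rewrite -(ler_pM2r y1) -expr2 -nrm_cstar_mul nrmM.
Qed.

Lemma nrm_sqr_sa h : cstar h = h -> nrm (h ** h) = nrm h ^+ 2.
Proof. by move=> hh; rewrite -nrm_cstar_mul hh. Qed.

Lemma nrm_proj q : cstar q = q -> q ** q = q -> nrm q <= 1.
Proof.
move=> q1 q2; have := nrm_sqr_sa q1; rewrite q2 => E.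
by have := nrm_ge0 q; nra.
Qed.

(** If M < c, Bernoulli's inequality makes (c / M)^(2^n) exceed 2 for large n: a constant factor is
    lost under 2^n-th roots. *)
Lemma le_of_pow2 (c M : R) : 0 <= c -> 0 <= M ->
  (forall n, c ^+ (2 ^ n) <= 2 * M ^+ (2 ^ n)) -> c <= M.
Proof.
move=> c0 M0 H; rewrite leNgt; apply/negP => Mc.
have cp : 0 < c by exact: le_lt_trans Mc.
have [M00|Mn0] := eqVneq M 0.
  by have := H 0%N; rewrite M00 !expr1 mulr0 leNgt cp.
have Mp : 0 < M by rewrite lt_neqAle eq_sym Mn0.
pose d := c / M - 1.
have d0 : 0 < d by rewrite subr_gt0 ltr_pdivlMr// mul1r.
have bern k : 1 + d *+ k <= (c / M) ^+ k.
  elim: k => [|k IH]; first by rewrite mulr0n addr0 expr0.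
  rewrite exprS; have -> : c / M = 1 + d by rewrite /d; ring.
  have <- : c / M = 1 + d by rewrite /d; ring.
  have E : c / M = 1 + d by rewrite /d; ring.
  rewrite mulrS {1}E; apply: le_trans (_ : (1 + d) * (1 + d *+ k) <= _).
    by rewrite -mulr_natr; have := ler0n R k; nra.
  by rewrite ler_pM2l// addr_gt0.
(* Then d n > 1, and 1 + d 2^n > 2. *)
pose n := Num.bound (1 / d).
have : 1 / d < n%:R by rewrite archi_boundP// divr_ge0// ltW.
rewrite ltr_pdivrMr// mulrC => dn.
have := bern (2 ^ n)%N; have := H n.
rewrite expr_div_n -ler_pdivrMr ?exprn_gt0// => H1 H2.
have H3 := le_trans H2 H1.
have : d *+ n <= d *+ (2 ^ n) by rewrite ler_wpMn2l ?(ltW d0)// ltnW// ltn_expl.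
by rewrite -(mulr_natr d n); lra.
Qed.

(** The square of h + k is h^2 + k^2, again a sum of orthogonal self-adjoint elements. Iterating, |h
    + k|^(2^n) is at most 2 M^(2^n), and [le_of_pow2] removes the factor 2. *)
Lemma nrmD_orth_sa h k : cstar h = h -> cstar k = k -> h ** k = 0 ->
  forall M, nrm h <= M -> nrm k <= M -> nrm (h + k) <= M.
Proof.
move=> h1 k1 hk M hM kM; have M0 : 0 <= M := le_trans (nrm_ge0 _) hM.
apply: le_of_pow2 => // [|n]; first exact: nrm_ge0.
elim: n h k M h1 k1 hk hM kM M0 => [|n IH] h k M h1 k1 hk hM kM M0.
  by rewrite !expn0 !expr1; have := nrmD h k; lra.
have kh : k ** h = 0 by rewrite -[LHS]cstarK cstarM h1 k1 hk cstar0.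
have E : (h + k) ** (h + k) = h ** h + k ** k.
  by rewrite cmulDl !cmulDr hk kh addr0 add0r.
rewrite expnS !exprM -nrm_sqr_sa ?cstarD ?h1 ?k1// E.
apply: IH; rewrite ?cstarM ?h1 ?k1 ?nrm_sqr_sa ?exprn_ge0//.
- by rewrite -cmulA (cmulA h k) hk cmul0x cmulx0.
- by rewrite lerXn2r ?nnegrE ?nrm_ge0.
- by rewrite lerXn2r ?nnegrE ?nrm_ge0.
Qed.

(** By the C*-identity this is the self-adjoint case for x^* x and y^* y, which are orthogonal
    because x y^* = 0. *)
Lemma nrmD_orth x y (M : R) : cstar x ** y = 0 -> x ** cstar y = 0 ->
  nrm x <= M -> nrm y <= M -> nrm (x + y) <= M.
Proof.
move=> xy xy' xM yM; have M0 : 0 <= M := le_trans (nrm_ge0 _) xM.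
have yx : cstar y ** x = 0 by rewrite -[LHS]cstarK cstarM cstarK xy cstar0.
rewrite -(@ler_pXn2r _ 2) ?nnegrE ?nrm_ge0// -nrm_cstar_mul.
have -> : cstar (x + y) ** (x + y) = cstar x ** x + cstar y ** y.
  by rewrite cstarD cmulDl !cmulDr xy yx addr0 add0r.
apply: nrmD_orth_sa; rewrite ?cstarM ?cstarK ?nrm_cstar_mul//.
- by rewrite -cmulA (cmulA x) xy' cmul0x cmulx0.
- by rewrite lerXn2r ?nnegrE ?nrm_ge0.
- by rewrite lerXn2r ?nnegrE ?nrm_ge0.
Qed.

End CStar.

Lemma half_small (R : realType) (V : normedZmodType R[i]) (x : V) (C : R) :
  (forall n, nrm x <= C * 2^-1 ^+ n) -> x = 0.
Proof.
move=> H; apply: nrm_small => e e0; have [n Hn] := half_exp_small C e0.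
exact: le_trans (H n) (ltW Hn).
Qed.

(** * Automatic boundedness of *-homomorphisms *)

Section StarHom.
Variable R : realType.

Lemma conj_i : Num.conj ('i%C : R[i]) = - 'i%C.
Proof. by rewrite complexiE conjCi. Qed.

(* [i + v] is unitary in the unitization. *)
Lemma nrm_unitary_shift (B : cstarAlgType R) (v : B) :
  cstar v ** v = 'i%C *: (v - cstar v) -> nrm v <= 2.
Proof.
move=> E; have := nrm_cstar_mul v; rewrite E nrmZ nrmCi mul1r => H.
by have := nrmB v (cstar v); rewrite nrm_cstar H; have := nrm_ge0 v; nra.
Qed.

Lemma nrm_half (B : cstarAlgType R) (x : B) : nrm (2^-1 *: x) = 2^-1 * nrm x.
Proof.
have -> : (2^-1 : R[i]) = (2^-1)%:C by rewrite fmorphV/= rmorph_nat.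
by rewrite nrmZ nrmC_real ger0_norm// invr_ge0.
Qed.

(* [w = 1 - sqrt (1 - h^2)] *)
Lemma sqrt_shift (A : cstarAlgType R) (h : A) :
  cstar h = h -> nrm h <= 2^-1 ->
  exists w, [/\ cstar w = w, w ** h = h ** w & w + w - w ** w = h ** h].
Proof.
move=> hh h1.
(* A fixed point w of [T] satisfies 2 w - w^2 = h^2. As |h^2| <= 1/4, the ball of radius 1/2 is
   stable under [T], and there [T] halves distances because |x^2 - y^2| <= (|x| + |y|) |x - y|. *)
pose T (w : A) := 2^-1 *: (h ** h + w ** w); pose u n := iter n T 0.
have half2 (x : A) : 2^-1 *: x + 2^-1 *: x = x.
  rewrite -scalerDl -[RHS]scale1r; congr (_ *: _).
  by rewrite -[X in X + _]mulr1 -[X in _ + X]mulr1 -mulrDr mulVf// pnatr_eq0.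
have conj_half : Num.conj (2^-1 : R[i]) = 2^-1 by rewrite fmorphV rmorph_nat.
have uS n : u n.+1 = 2^-1 *: (h ** h + u n ** u n) by [].
have u0 : u 0%N = 0 by [].
have usa n : cstar (u n) = u n.
  elim: n => [|n IH]; first exact: cstar0.
  by rewrite uS cstarZ cstarD !cstarM hh IH conj_half.
have ucomm n : u n ** h = h ** u n.
  elim: n => [|n IH]; first by rewrite cmul0x cmulx0.
  rewrite uS cmulZl cmulZr cmulDl cmulDr cmulA; congr (_ *: (_ + _)).
  by rewrite -cmulA -/(u n) IH cmulA IH -cmulA.
have hh4 : nrm (h ** h) <= 4^-1 by have := nrmM h h; have := nrm_ge0 h; nra.
have u1 n : nrm (u n) <= 2^-1.
  elim: n => [|n IH]; first by rewrite nrm0 invr_ge0.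
  rewrite uS nrm_half; have := nrmD (h ** h) (u n ** u n).
  by have := nrmM (u n) (u n); have := nrm_ge0 (u n); nra.
have sqB (x y : A) : x ** x - y ** y = (x - y) ** x + y ** (x - y).
  by rewrite cmulBl cmulBr addrA subrK.
have udiff n : nrm (u n.+1 - u n) <= 1 * 2^-1 ^+ n.
  elim: n => [|n IH].
    by rewrite uS u0 cmul0x addr0 subr0 nrm_half expr0; lra.
  have -> : u n.+2 - u n.+1 = 2^-1 *: (u n.+1 ** u n.+1 - u n ** u n).
    by rewrite !uS -scalerBr opprD addrACA subrr add0r.
  rewrite nrm_half sqB exprS.
  have := nrmD ((u n.+1 - u n) ** u n.+1) (u n ** (u n.+1 - u n)).
  have := nrmM (u n.+1 - u n) (u n.+1); have := nrmM (u n) (u n.+1 - u n).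
  have := u1 n; have := u1 n.+1; have := nrm_ge0 (u n.+1 - u n).
  set a := nrm (u n.+1 - u n) in IH *; set b := nrm (u n.+1); set c := nrm (u n).
  by set d := 2^-1 ^+ n in IH *; nra.
have [l ul] := complete_half udiff.
exists l; split.
- apply/eqP; rewrite -subr_eq0; apply/eqP; apply: (@half_small _ _ _ 4) => n.
  rewrite -[X in X - _](subrK (cstar (u n))) -cstarB usa -addrA.
  apply: le_trans (nrmD _ _) _; rewrite nrm_cstar (nrm_distC (u n)).
  by have := ul n; lra.
- apply/eqP; rewrite -subr_eq0; apply/eqP; apply: (@half_small _ _ _ 2) => n.
  have -> : l ** h - h ** l = (l - u n) ** h - h ** (l - u n).
    by rewrite cmulBl cmulBr ucomm opprB addrA subrK.
  apply: le_trans (nrmB _ _) _; have := nrmM (l - u n) h.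
  have := nrmM h (l - u n); have := ul n; have := nrm_ge0 (l - u n).
  set a := nrm (l - u n); set d := 2^-1 ^+ n; set b := nrm h in h1 *; nra.
(* Here |l| <= 2 and |u n| <= 1/2, so the error is at most 7 times 2^-n; 12 leaves room. *)
- apply/eqP; rewrite -subr_eq0; apply/eqP; apply: (@half_small _ _ _ 12) => n.
  have -> : l + l - l ** l - h ** h =
      (l - u n.+1) + (l - u n.+1) - (l ** l - u n ** u n).
    rewrite addrACA -opprD [u n.+1 + _]half2 opprB opprD.
    by rewrite !addrA subrK addrAC.
  apply: le_trans (nrmB _ _) _; rewrite sqB.
  have := nrmD ((l - u n) ** l) (u n ** (l - u n)).
  have := nrmM (l - u n) l; have := nrmM (u n) (l - u n).
  have := nrmD (l - u n.+1) (l - u n.+1).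
  have := nrm_le_dist l (u 0%N); have := ul 0%N; have := ul n; have := ul n.+1.
  have := u1 n; have := nrm_ge0 (l - u n); have := nrm_ge0 (u n).
  rewrite exprS u0 subr0 nrm0 expr0.
  set a := nrm (l - u n); set d := 2^-1 ^+ n; set b := nrm l; set c := nrm (u n).
  set e := nrm (l - u n.+1).
  by nra.
Qed.

(** With v = h - i w, the element i + v is h + i (1 - w), and its unitarity amounts to h^2 + (1 -
    w)^2 = 1. The hypotheses are algebraic identities, so they hold for the images of h and w as
    soon as they hold for h and w. *)
Lemma nrm_of_sqrt_shift (B : cstarAlgType R) (h w : B) :
  cstar h = h -> cstar w = w -> h ** w = w ** h -> w + w - w ** w = h ** h ->
  nrm h <= 2.
Proof.
move=> hh ww hw E; pose v := h - 'i%C *: w.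
have vs : cstar v = h + 'i%C *: w by rewrite cstarB cstarZ hh ww conj_i scaleNr opprK.
have /nrm_unitary_shift v2 : cstar v ** v = 'i%C *: (v - cstar v).
  rewrite vs /v cmulDl !cmulBr !cmulZl !cmulZr hw addrA subrK scalerA.
  rewrite -expr2 sqr_i scaleN1r opprK -E subrK.
  rewrite opprD addrACA subrr add0r -opprD scalerN scalerDr scalerA.
  by rewrite -expr2 sqr_i scaleN1r opprD !opprK.
have -> : h = 2^-1 *: (v + cstar v).
  rewrite vs addrACA addNr addr0.
  by rewrite -mulr2n -[h *+ 2]scaler_nat scalerA mulVf ?scale1r// pnatr_eq0.
by rewrite nrm_half; have := nrmD v (cstar v); rewrite nrm_cstar; lra.
Qed.

Lemma conj_real (r : R) : Num.conj (r%:C : R[i]) = r%:C.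
Proof. by apply/CrealP; rewrite complex_real. Qed.

(** Rescaling to norm 1/2 turns the bound 2 into the factor 4 on self-adjoint elements; applied to
    x^* x, this bounds |phi x|^2 by 4 |x|^2, whence C = 2. *)
Lemma star_hom_bounded (A B : cstarAlgType R) (phi : A -> B) : star_hom phi ->
  exists2 C : R, 0 <= C & forall x, nrm (phi x) <= C * nrm x.
Proof.
move=> H.
have phi0 : phi 0 = 0 by rewrite -[X in phi X](scale0r 0) (star_homZ H) scale0r.
have phiB x y : phi (x - y) = phi x - phi y.
  by rewrite (star_homD H) -[in LHS]scaleN1r (star_homZ H) scaleN1r.
have sa2 h : cstar h = h -> nrm h <= 2^-1 -> nrm (phi h) <= 2.
  move=> hh /(sqrt_shift hh)[w [ww wh E]].
  apply: (@nrm_of_sqrt_shift _ _ (phi w)).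
  - by rewrite -(star_hom_star H) hh.
  - by rewrite -(star_hom_star H) ww.
  - by rewrite -!(star_homM H) wh.
  - by rewrite -!(star_homM H) -E phiB (star_homD H).
have sa4 h : cstar h = h -> nrm (phi h) <= 4 * nrm h.
  move=> hh; have [/nrm_eq0 ->|h0] := eqVneq (nrm h) 0.
    by rewrite phi0 !nrm0 mulr0.
  have hp : 0 < nrm h by rewrite lt_neqAle eq_sym h0 nrm_ge0.
  pose c := (2 * nrm h)^-1; have c0 : 0 < c by rewrite invr_gt0 mulr_gt0.
  have ch : c * nrm h = 2^-1 by rewrite /c; field; rewrite h0.
  have := @sa2 (c%:C *: h); rewrite cstarZ hh nrmZ nrmC_real ger0_norm ?(ltW c0)//.
  rewrite ch lexx (star_homZ H) nrmZ nrmC_real ger0_norm ?(ltW c0)//.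
  rewrite conj_real.
  move=> /(_ erefl isT) => H1; have H2 : c * (4 * nrm h) = 2 by rewrite mulrCA ch; lra.
  by rewrite -(ler_pM2l c0) H2.
exists 2 => // x; rewrite -(@ler_pXn2r _ 2) ?nnegrE ?nrm_ge0 ?mulr_ge0 ?nrm_ge0//.
rewrite -nrm_cstar_mul -(star_hom_star H) -(star_homM H).
apply: le_trans (sa4 _ _) _; first by rewrite cstarM cstarK.
by rewrite nrm_cstar_mul exprMn; lra.
Qed.

End StarHom.

(** * The free group acting on the boundary space *)

Section Words.
Variable G : ultragraph.
Local Notation V := (vert G).
Local Notation E := (edge G).
Local Notation X := (bspace G).
Implicit Types (a b : seq E) (y z : uword G) (e f : E) (l : E * bool).

Lemma ucat_cat a b z : ucat (a ++ b) z = ucat a (ucat b z).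
Proof.
case: z => [c A|x] /=; first by rewrite catA.
congr Inf; apply/funext => n; rewrite nth_cat size_cat subnDA.
by case: ltnP => na; [exact: set_nth_default|rewrite [RHS]nth_default].
Qed.

Lemma ucat0 z : ucat [::] z = z.
Proof. by case: z => //= x; congr Inf; apply/funext => n; rewrite subn0 nth_nil. Qed.

Lemma udrop_ucat a z : udrop (size a) (ucat a z) = z.
Proof.
case: z => [c A|x] /=; first by rewrite drop_size_cat.
by congr Inf; apply/funext => n; rewrite addnK nth_default// leq_addl.
Qed.

Lemma ucat_inj a : injective (ucat a).
Proof. by move=> y z /(congr1 (udrop (size a))); rewrite !udrop_ucat. Qed.

Lemma udrop0 z : udrop 0 z = z.
Proof. by rewrite -[in LHS](ucat0 z) -[0%N]/(size ([::] : seq E)) udrop_ucat. Qed.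

Lemma ucat1_udrop e z : ufirst z = Some e -> z = ucat [:: e] (udrop 1 z).
Proof.
case: z => [[|f c] A|x] //= [<-]; first by rewrite drop0.
by congr Inf; apply/funext => -[|n] //=; rewrite subn1/= addn1 nth_nil.
Qed.

Lemma ufirst_ucat e a z : ufirst (ucat (e :: a) z) = Some e.
Proof. by case: z. Qed.

Lemma usrc_ucat e a z : usrc (ucat (e :: a) z) = [set src e].
Proof. by case: z. Qed.

Lemma ufirstP z : (exists e, ufirst z = Some e) \/ exists A, z = Fin [::] A.
Proof.
by case: z => [[|e a] A|x]; [right; exists A|left; exists e|left; exists (x 0%N)].
Qed.

Lemma is_path_cons e f a : is_path (e :: f :: a) <-> rng e (src f) /\ is_path (f :: a).
Proof.
rewrite /is_path /=; split=> [/andP[/set_mem]|[r1 ->]] //.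
by rewrite andbT; exact: mem_set.
Qed.

Lemma Xfin_nonempty a A : Xfin a A -> A !=set0.
Proof.
move=> [_ [[_ iA _]|[_ iA _ _]|[v _ ->]]]; last by exists v.
  have [e Ae] := infinite_setN0 iA.
  by exists (src e).
exact: infinite_setN0.
Qed.

Lemma boundary_cat1 e z :
  boundary (ucat [:: e] z) <-> boundary z /\ usrc z `<=` rng e.
Proof.
case: z => [a A|x] /=; last first.
  split=> [H|[Hx H] [|n]] /=.
  - split; first by move=> n; have := H n.+1; rewrite /= !subn1 /= !nth_nil.
    by move=> _ ->; have := H 0%N.
  - exact: H.
  - by have := Hx n; rewrite !subn1 /= !nth_nil.
rewrite /Xfin /ultrapath; case: a => [|f a].
  by split=> [[[_ ? ?] ?]|[[[_ ? _] ?] ?]].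
rewrite (propext (is_path_cons e f a)); split=> [[[[ef pa] gA Ap] H]|[[[pa gA Ap] H] ef]].
  by split; [split|move=> _ ->].
by do !split => //; exact: ef.
Qed.

Lemma boundary_cat a z :
  boundary (ucat a z) <-> [/\ boundary z, is_path a & usrc z `<=` prng a].
Proof.
elim: a z => [|e a IH] z; first by rewrite ucat0; split=> [?|[]].
rewrite -cat1s ucat_cat (propext (boundary_cat1 _ _)) (propext (IH _)); case: a {IH} => [|f a].
  by rewrite ucat0; split=> [[[]]|[]].
rewrite usrc_ucat cat1s (propext (is_path_cons _ _ _)); split=> [[[bz pa zp] ef]|[bz [ef pa] zp]].
  by split => //; split => //; exact: ef.
by split=> // _ ->.
Qed.

Definition fglet l : freegroup E := @FreeGroup _ [:: l] isT.

Lemma wposnegE (c : freegroup E) a b : fgword c = pos_word a ++ winv (pos_word b) ->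
  wpos c = a /\ wneg c = b.
Proof.
have -> : winv (pos_word b) = rev [seq (e, false) | e <- b].
  by rewrite /winv /pos_word -map_comp.
have F1 d : [seq l <- pos_word d | l.2] = pos_word d by elim: d => //= e d ->.
have F2 d : [seq l <- pos_word d | ~~ l.2] = [::] by elim: d => //= e d ->.
have F3 d : [seq l <- [seq (e, false) | e <- d] | l.2] = [::] :> seq (E * bool).
  by elim: d => //= e d ->.
have F4 d : [seq l <- [seq (e, false) | e <- d] | ~~ l.2] = [seq (e, false) | e <- d].
  by elim: d => //= e d ->.
move=> cE; rewrite /wpos /wneg cE !filter_cat !filter_rev F1 F2 F3 F4.
by rewrite cats0 cat0s map_rev revK -!map_comp !map_id.
Qed.

(** The conditions of [bdom] on the positive part a are automatic, since a z is already a boundary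
    path. *)
Lemma bdomE (c : freegroup E) (y : X) : bdom c y <->
  exists a b, [/\ fgword c = pos_word a ++ winv (pos_word b), is_path b &
    exists2 z, sval y = ucat a z & usrc z `<=` prng b].
Proof.
have E1 a b := @wposnegE c a b.
split=> [[cE pa pb [z yz zab]]|[a [b [cE pb [z yz zb]]]]].
  exists (wpos c), (wneg c); split => //.
  by exists z => // v /zab[].
have [aE bE] := E1 _ _ cE.
have /boundary_cat[_ pa za] : boundary (ucat a z) by rewrite -yz; exact: (svalP y).
rewrite /bdom /= /is_posneg aE bE; split => //.
by exists z => // v zv; split; [exact: za|exact: zb].
Qed.


Lemma bspace_inj (y z : X) : sval y = sval z -> y = z.
Proof.
case: y z => [y hy] [z hz] /= E; case: _ / E in hz *.
by congr exist; exact: Prop_irrelevance.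
Qed.

Lemma winv_pos b : winv (pos_word b) = [seq (e, false) | e <- rev b].
Proof. by rewrite /winv /pos_word -map_comp map_rev. Qed.

Lemma bact_val (c : freegroup E) (y : X) :
  boundary (ucat (wpos c) (udrop (size (wneg c)) (sval y))) ->
  sval (bact c y) = ucat (wpos c) (udrop (size (wneg c)) (sval y)).
Proof. by move=> bz; rewrite /bact; case: pselect. Qed.

Lemma ldom_pos e (y : X) : bdom (fglet (e, true)) y <-> ufirst (sval y) = Some e.
Proof.
split=> [/bdomE[[|f a] [b [/= cE _ [z yz _]]]]|/ucat1_udrop yE].
- have : true \in [seq l.2 | l <- winv (pos_word b)] by rewrite -cE.
  by rewrite winv_pos -map_comp => /mapP[].
- by rewrite yz ufirst_ucat; case: cE => ->.
- by apply/bdomE; exists [:: e], [::]; split => //; exists (udrop 1 (sval y)).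
Qed.

Lemma ldom_neg e (y : X) : bdom (fglet (e, false)) y <-> usrc (sval y) `<=` rng e.
Proof.
split=> [/bdomE[[|f a] [b [//= cE _ [z yz zb]]]]|yE].
- rewrite yz ucat0; suff <- : prng b = rng e by [].
  have := congr1 rev (congr1 (map fst) cE).
  rewrite winv_pos -map_comp map_id revK /= => <- //.
- apply/bdomE; exists [::], [:: e]; split => //.
  by exists (sval y) => //; rewrite ucat0.
Qed.

Lemma lact_neg e (y : X) z : sval y = ucat [:: e] z ->
  sval (bact (fglet (e, false)) y) = z.
Proof.
move=> yz; have E1 : udrop 1 (sval y) = z by rewrite yz (udrop_ucat [:: e]).
rewrite bact_val /= ucat0 E1//.
by have /= := svalP y; rewrite yz => /boundary_cat1[].
Qed.

Lemma lact_pos e (y : X) : usrc (sval y) `<=` rng e ->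
  sval (bact (fglet (e, true)) y) = ucat [:: e] (sval y).
Proof.
move=> ye; have E1 : udrop 0 (sval y) = sval y by rewrite udrop0.
by rewrite bact_val /= E1//; apply/boundary_cat1; split => //; exact: (svalP y).
Qed.

Lemma lactK l (y : X) : bdom (fglet l) y ->
  bdom (fglet (linv l)) (bact (fglet (linv l)) y) /\
  bact (fglet l) (bact (fglet (linv l)) y) = y.
Proof.
case: l => e [] /=; rewrite /linv /=.
  move=> /ldom_pos/ucat1_udrop yE; have E1 := lact_neg yE.
  have /boundary_cat1[_ se] : boundary (ucat [:: e] (udrop 1 (sval y))).
    by rewrite -yE; exact: (svalP y).
  split; first by apply/ldom_neg; rewrite E1.
  by apply/bspace_inj; rewrite lact_pos E1.
move=> /ldom_neg yE; have E1 := lact_pos yE.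
split; first by apply/ldom_pos; rewrite E1 ufirst_ucat.
by apply/bspace_inj; rewrite (lact_neg E1).
Qed.

(** The action letter by letter: for w = l_1 ... l_n, [wact w] applies the inverse of l_1, then that
    of l_2, and so on, hence acts as the inverse of w; [wdom w] is the domain of this composite. *)
Fixpoint wdom w (y : X) : Prop :=
  if w is l :: w' then
    bdom (fglet l) y /\ wdom w' (bact (fglet (linv l)) y) else True.

Fixpoint wact w (y : X) : X :=
  if w is l :: w' then wact w' (bact (fglet (linv l)) y) else y.

Lemma wdom_neg b (y : X) : wdom (winv (pos_word b)) y <->
  is_path b /\ usrc (sval y) `<=` prng b.
Proof.
elim/last_ind: b y => [|b e IH] y //.
rewrite winv_pos rev_rcons map_cons -winv_pos /=.
have -> : prng (rcons b e) = rng e by case: b {IH} => //= f b; rewrite last_rcons.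
have pE : is_path (rcons b e) <-> is_path b /\ prng b (src e).
  case: b {IH} => [|f b]; first by [].
  rewrite /is_path /= rcons_path; split=> [/andP[-> /set_mem]|[-> /mem_set]] //.
rewrite (propext (ldom_neg _ _)) (propext (IH _)) (propext pE); split.
  move=> [ye [pb]]; rewrite lact_pos// usrc_ucat => H; split => //; split => //.
  exact: H.
by move=> [[pb H] ye]; split => //; split => //; rewrite lact_pos// usrc_ucat => _ ->.
Qed.

Lemma wdom_pos a w (y : X) : wdom (pos_word a ++ w) y <->
  exists2 z : X, sval y = ucat a (sval z) & wdom w z.
Proof.
elim: a y => [|e a IH] y /=.
  split=> [wy|[z yz wz]]; first by exists y; rewrite ?ucat0.
  by have -> : y = z by apply: bspace_inj; rewrite yz ucat0.
rewrite (propext (ldom_pos _ _)) (propext (IH _)); split.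
  move=> [/ucat1_udrop yE [z yz wz]]; exists z => //.
  by rewrite -cat1s ucat_cat -yz (lact_neg yE).
move=> [z yz wz]; split; first by rewrite yz ufirst_ucat.
exists z => //; apply: lact_neg.
by rewrite yz -ucat_cat.
Qed.

(** Stripping a negative letter of edge e puts e in front of the path, so a positive letter of edge
    f coming next requires f = e, which reducedness forbids. *)
Lemma wdom_posneg w (y : X) : reduced w -> wdom w y ->
  exists a b, w = pos_word a ++ winv (pos_word b).
Proof.
elim: w y => [|[e s] w IH] y; first by exists [::], [::].
move=> rw /= [ey wy]; have [a [b wE]] := IH _ (reduced_cons rw) wy.
case: s ey rw wy => ey rw wy; first by exists (e :: a), b; rewrite wE.
case: a wE => [wE|f a wE].
  by exists [::], (rcons b e); rewrite wE !winv_pos rev_rcons.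
move: wy rw; rewrite wE /= => -[/ldom_pos ef _].
move: ey => /ldom_neg ye; move: ef; rewrite lact_pos// ufirst_ucat => -[->].
by rewrite /linv /= eqxx.
Qed.

(** Semi-saturation: for a reduced word, the explicit domain is the domain of the composite of the
    letters. [bact_word] is the counterpart for the maps. *)
Lemma bdom_word (t : freegroup E) (y : X) : bdom t y <-> wdom (fgword t) y.
Proof.
split=> [/bdomE[a [b [-> pb [z yz zb]]]]|wy].
  have /boundary_cat[bz _ _] : boundary (ucat a z) by rewrite -yz; exact: (svalP y).
  apply/wdom_pos; exists (exist _ z bz) => //; exact/wdom_neg.
apply/bdomE; have [a [b wE]] := wdom_posneg (fgwordP t) wy.
exists a, b; move: wy; rewrite wE => /wdom_pos[z yz /wdom_neg[pb zb]]; split => //.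
by exists (sval z).
Qed.

Lemma bactV_val (t : freegroup E) (y : X) a b z :
  fgword t = pos_word a ++ winv (pos_word b) -> is_path b ->
  sval y = ucat a z -> usrc z `<=` prng b -> sval (bact t^-1%g y) = ucat b z.
Proof.
move=> tE pb yz zb.
have tVE : fgword t^-1%g = pos_word b ++ winv (pos_word a).
  have -> : fgword t^-1%g = winv (fgword t) by [].
  rewrite tE /winv map_cat rev_cat -!/(winv _); congr (_ ++ _).
  rewrite winv_pos /winv -map_comp map_rev revK.
  by rewrite (eq_map (g := fun e => (e, true))).
have [bE aE] := wposnegE tVE.
have /boundary_cat[bz _ _] : boundary (ucat a z) by rewrite -yz; exact: (svalP y).
by rewrite bact_val bE aE yz udrop_ucat//; apply/boundary_cat.
Qed.

Lemma bactK (t : freegroup E) (y : X) : bdom t y ->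
  bdom t^-1%g (bact t^-1%g y) /\ bact t (bact t^-1%g y) = y.
Proof.
move=> /bdomE[a [b [tE pb [z yz zb]]]].
have yV := bactV_val tE pb yz zb.
have /boundary_cat[bz pa za] : boundary (ucat a z) by rewrite -yz; exact: (svalP y).
have tVE : fgword t^-1%g = pos_word b ++ winv (pos_word a).
  have -> : fgword t^-1%g = winv (fgword t) by [].
  rewrite tE /winv map_cat rev_cat -!/(winv _); congr (_ ++ _).
  rewrite winv_pos /winv -map_comp map_rev revK.
  by rewrite (eq_map (g := fun e => (e, true))).
split.
  by apply/bdomE; exists b, a; split => //; exists z.
apply: bspace_inj; rewrite yz -{1}(invgK t).
exact: (bactV_val tVE pa yV za).
Qed.

Lemma wact_neg b (y : X) : is_path b -> usrc (sval y) `<=` prng b ->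
  sval (wact (winv (pos_word b)) y) = ucat b (sval y).
Proof.
move=> pb yb; have /wdom_neg : is_path b /\ usrc (sval y) `<=` prng b by [].
elim/last_ind: b y {pb yb} => [|b e IH] y; first by rewrite ucat0.
rewrite winv_pos rev_rcons map_cons -winv_pos /= => -[/ldom_neg ye wy].
by rewrite IH// lact_pos// -ucat_cat cats1.
Qed.

Lemma wact_pos a w (y z : X) : sval y = ucat a (sval z) ->
  wact (pos_word a ++ w) y = wact w z.
Proof.
elim: a y => [|e a IH] y /= yz; first by congr wact; apply: bspace_inj; rewrite yz ucat0.
by apply: IH; apply: lact_neg; rewrite yz -ucat_cat.
Qed.

Lemma bact_word (t : freegroup E) (y : X) : bdom t y ->
  bact t^-1%g y = wact (fgword t) y.
Proof.
move=> /bdomE[a [b [tE pb [z yz zb]]]].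
have /boundary_cat[bz _ _] : boundary (ucat a z) by rewrite -yz; exact: (svalP y).
apply: bspace_inj; rewrite (bactV_val tE pb yz zb) tE.
by rewrite (@wact_pos _ _ y (exist _ z bz))// wact_neg.
Qed.

End Words.

(** * The induced action on functions *)

Section Pact.
Variables (R : realType) (T : topologicalType) (H : groupType).
Variables (D : H -> set T) (theta : H -> T -> T).
Implicit Types (f g : T -> R[i]) (t : H).

Lemma pactE t f x : D t x -> pact D theta t f x = f (theta t^-1%g x).
Proof. by move=> /mem_set Dx; rewrite /pact Dx. Qed.

Lemma pact_out t f x : ~ D t x -> pact D theta t f x = 0.
Proof. by move=> Dx; rewrite /pact memNset. Qed.

Lemma pact_le t f (M : R) : 0 <= M -> (forall x, nrm (f x) <= M) ->
  forall x, nrm (pact D theta t f x) <= M.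
Proof. by move=> M0 fM x; rewrite /pact; case: ifP; rewrite ?nrm0. Qed.

Lemma pact0 t : pact D theta t (0 : T -> R[i]) = 0.
Proof. by apply/funext => x; rewrite /pact; case: ifP. Qed.

Lemma pactD t f g : pact D theta t (f + g) = pact D theta t f + pact D theta t g.
Proof.
by apply/funext => x; rewrite /pact !fctE; case: ifP; rewrite ?addr0.
Qed.

Lemma pactZ t (c : R[i]) f : pact D theta t (c *: f) = c *: pact D theta t f.
Proof.
by apply/funext => x; rewrite /pact !fctE; case: ifP; rewrite ?scaler0.
Qed.

Lemma pactB t f g : pact D theta t (f - g) = pact D theta t f - pact D theta t g.
Proof.
by apply/funext => x; rewrite /pact !fctE; case: ifP; rewrite ?subr0.
Qed.

Lemma pactM t f g : pact D theta t (f * g) = pact D theta t f * pact D theta t g.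
Proof.
by apply/funext => x; rewrite /pact !fctE; case: ifP; rewrite ?mulr0.
Qed.

End Pact.

Section LetterPact.
Variables (R : realType) (G : ultragraph).
Local Notation E := (edge G).
Local Notation X := (bspace G).
Implicit Types (f g : X -> R[i]) (l : E * bool) (t : freegroup E).

Local Notation pact := (pact (@bdom G) (@bact G)).

Lemma fgletV l : (fglet l)^-1%g = fglet (linv l).
Proof. exact: val_inj. Qed.

Definition pactw w f : X -> R[i] := foldr (fun l => pact (fglet l)) f w.

Lemma pactwE w f y :
  pactw w f y = if y \in [set y | wdom w y] then f (wact w y) else 0.
Proof.
elim: w y => [|l w IH] y /=; first by rewrite mem_set.
have [ly|ly] := pselect (bdom (fglet l) y); last first.
  by rewrite pact_out// memNset//= => -[].
rewrite pactE// fgletV IH /=.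
have [wy|wy] := pselect (wdom w (bact (fglet (linv l)) y)).
  by rewrite !mem_set.
by rewrite !memNset// => -[].
Qed.

(** Reduces statements about alpha_t to statements about a single letter. *)
Lemma pact_word t f : pact t f = pactw (fgword t) f.
Proof.
apply/funext => y; rewrite pactwE.
have [ty|ty] := pselect (bdom t y).
  by rewrite pactE// bact_word// mem_set//; apply/bdom_word.
by rewrite pact_out// memNset// => /bdom_word.
Qed.

Lemma pactK t f : (forall x, ~ bdom t x -> f x = 0) -> pact t (pact t^-1%g f) = f.
Proof.
move=> f0; apply/funext => y; have [ty|ty] := pselect (bdom t y); last first.
  by rewrite pact_out// f0.
by have [ty' tK] := bactK ty; rewrite pactE// pactE// invgK tK.
Qed.

End LetterPact.

(** * Generalized vertices and the topology of the boundary space *)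

Section GeneralizedVertices.
Variable G : ultragraph.
Local Notation V := (vert G).
Implicit Types (A B C : set V) (v : V).

Lemma gvert0 : gvert (set0 : set V).
Proof. by move=> M [[]]. Qed.
Lemma gvertU A B : gvert A -> gvert B -> gvert (A `|` B).
Proof. by move=> gA gB M MM; have [[_ U _] _] := MM; apply: U; [apply: gA|apply: gB]. Qed.
Lemma gvertI A B : gvert A -> gvert B -> gvert (A `&` B).
Proof. by move=> gA gB M MM; have [[_ _ U] _] := MM; apply: U; [apply: gA|apply: gB]. Qed.
Lemma gvert1 v : gvert [set v].
Proof. by move=> M [_ sM]; apply: sM; left; exists v. Qed.
Lemma gvert_rng (e : edge G) : gvert (rng e).
Proof. by move=> M [_ sM]; apply: sM; right; exists e. Qed.

Lemma gvert_ind (P : set V -> Prop) :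
  P set0 -> (forall v, P [set v]) -> (forall e : edge G, P (rng e)) ->
  (forall A B, P A -> P B -> P (A `|` B)) ->
  (forall A B, P A -> P B -> P (A `&` B)) -> forall A, gvert A -> P A.
Proof.
move=> P0 P1 Pr PU PI A; apply; split; first by split.
by move=> _ [[v _ <-]|[e _ <-]].
Qed.

(* The ranges of the ultrapaths in [Xfin]. *)
Definition bvert A : Prop :=
  [\/ min_infinite_emitter A, min_sink A | exists2 v, sink v & A = [set v]].

Definition piece A : Prop := bvert A \/ exists2 v, regular v & A = [set v].

Inductive pieces : set V -> Prop :=
| pieces0 : pieces set0
| piecesU A B : piece A -> pieces B -> pieces (A `|` B).

Lemma bvert_gvert A : bvert A -> gvert A.
Proof. by case=> [[]|[]|[v _ ->]] //; exact: gvert1. Qed.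

Lemma piece_gvert A : piece A -> gvert A.
Proof. by case=> [/bvert_gvert|[v _ ->]] //; exact: gvert1. Qed.

Lemma pieces_gvert A : pieces A -> gvert A.
Proof.
by elim=> [|B C pB _ gC]; [exact: gvert0|apply: gvertU => //; exact: piece_gvert].
Qed.

Lemma pieces1 A : piece A -> pieces A.
Proof. by move=> pA; rewrite -(setU0 A); apply: piecesU => //; exact: pieces0. Qed.

Lemma pieces_setU A B : pieces A -> pieces B -> pieces (A `|` B).
Proof.
by move=> pA pB; elim: pA => [|C D ? _ ?]; rewrite ?set0U// -setUA; exact: piecesU.
Qed.

Lemma emittedU A B : emitted (A `|` B) = emitted A `|` emitted B.
Proof. by []. Qed.

(** A vertex that is neither a sink nor regular emits infinitely many edges, and a singleton
    infinite emitter is minimal because its only proper subset is empty. *)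
Lemma piece_set1 v : piece [set v].
Proof.
have [v0|/set0P v0] := eqVneq (emitted [set v]) set0.
  by left; apply: Or33; exists v.
have [fv|iv] := pselect (finite_set (emitted [set v])); first by right; exists v.
left; apply: Or31; split => //; first exact: gvert1.
move=> B _ Bv; have -> : B = set0.
  apply: contrapT => /eqP/set0P[w Bw]; case: Bv => sB; apply => u ->.
  by rewrite -(sB w Bw).
by case; [apply|case=> _; apply]; exact: finite_set0.
Qed.

Lemma pieces_finite A : finite_set A -> pieces A.
Proof.
move=> /finite_seqP[s ->]; elim: s => [|v s IH].
  have -> : [set` [::]] = set0 :> set V by apply/seteqP; split.
  exact: pieces0.
have -> : [set` v :: s] = [set v] `|` [set` s].
  apply/seteqP; split=> w /=; rewrite inE; first by case/orP => [/eqP|]; [left|right].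
  by case=> [->|->]; rewrite ?eqxx ?orbT.
by apply: piecesU => //; exact: piece_set1.
Qed.

(** This is what minimality provides. If B does not contain A, then A [&] B is a generalized vertex
    properly inside A, and minimality leaves only finite sets for it; inside a singleton it is
    empty. *)
Lemma piece_cap A B : piece A -> gvert B ->
  A `<=` B \/ (finite_set (A `&` B) /\ (bvert A -> finite_set (emitted (A `&` B)))).
Proof.
move=> pA gB; have [AB|nAB] := pselect (A `<=` B); [by left|right].
have pAB : A `&` B `<` A.
  by split; [exact: subIsetl|move=> H; apply: nAB => v /H[]].
have single v : A = [set v] -> A `&` B = set0.
  move=> Av; apply: contrapT => /eqP/set0P[w []]; rewrite Av => -> Bv.
  by apply: nAB => u; rewrite Av => ->.
case: pA => [|[v rv Av]]; last first.
  rewrite (single _ Av); split=> [|_]; first exact: finite_set0.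
  exact: finite_set0.
case=> [[gA iA mA]|[gA iA fA mA]|[v sv Av]].
- have /not_orP[H1 H2] := mA _ (gvertI gA gB) pAB.
  have fe : finite_set (emitted (A `&` B)) by exact: contrapT.
  by split => //; apply: contrapT => iAB; apply: H2.
- have fe : finite_set (emitted (A `&` B)) by apply: sub_finite_set fA => e [].
  by split => //; apply: contrapT; apply: mA => //; exact: gvertI.
- by rewrite (single _ Av); split=> [|_]; exact: finite_set0.
Qed.

(** Such an A is prime for unions: if neither B nor C contains it, [piece_cap] makes A finite and
    finitely emitting, hence a sink, which lies in B or in C. This gives X_(B [|] C) as a union also
    on paths of length 0. *)
Lemma bvert_setU A B C : bvert A -> gvert B -> gvert C -> A `<=` B `|` C ->
  A `<=` B \/ A `<=` C.
Proof.
move=> bA gB gC ABC; have pA : piece A by left.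
have [|[f1 e1]] := piece_cap pA gB; first by left.
have [|[f2 e2]] := piece_cap pA gC; first by right.
have AE : A = (A `&` B) `|` (A `&` C) by rewrite -setIUr; apply/esym/setIidl.
have fA : finite_set A by rewrite AE finite_setU.
have eA : finite_set (emitted A).
  by rewrite AE emittedU finite_setU; split; [exact: e1|exact: e2].
case: bA {pA e1 e2} => [[]|[]|[v _ Av]] //.
have /ABC[Bv|Cv] : A v by rewrite Av.
  by left; rewrite Av => _ ->.
by right; rewrite Av => _ ->.
Qed.

(** A proper B is finite and finitely emitting by [piece_cap], which leaves only the third kind. *)
Lemma bvert_maximal A B : bvert A -> bvert B -> B `<=` A ->
  B = A \/ exists2 v, sink v & B = [set v].
Proof.
move=> bA bB BA.
have [AB|[f1 /(_ bA) e1]] : A `<=` B \/ _ := piece_cap (or_introl bA) (bvert_gvert bB).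
  by left; apply/seteqP.
rewrite (setIidr BA) in f1 e1.
by case: bB => [[]|[]|] //; right.
Qed.

Section RFUM2.
Hypothesis hG : RFUM2 G.

(** (RFUM2) speaks of ranges only. Singletons are pieces in any case, unions are immediate, and
    under an intersection each piece either survives whole or leaves a finite set, again a union of
    pieces. *)
Lemma gvert_pieces A : gvert A -> pieces A.
Proof.
apply: gvert_ind => [|v|e|B C pB pC|B C pB pC].
- exact: pieces0.
- exact/pieces1/piece_set1.
- have [k [B [-> BP]]] := hG e.
  elim: k BP => [|k IH] BP; first by rewrite bigcup_mkord big_ord0; exact: pieces0.
  rewrite bigcup_mkord big_ord_recr/= -bigcup_mkord.
  apply: pieces_setU; first by apply: IH => n nk; apply: BP; exact: ltnW.
  apply: pieces1; case: (BP _ (ltnSn k)) => [m|m|[v [sv|rv] ->]].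
  + by left; exact: Or31.
  + by left; exact: Or32.
  + by left; apply: Or33; exists v.
  + by right; exists v.
- exact: pieces_setU.
- elim: pB => [|D F pD _ IH]; first by rewrite set0I; exact: pieces0.
  rewrite setIUl; apply: pieces_setU => //.
  have [DC|[fDC _]] := piece_cap pD (pieces_gvert pC).
    by rewrite (setIidl DC); exact: pieces1.
  exact: pieces_finite.
Qed.

End RFUM2.
End GeneralizedVertices.

(** * Cylinders and neighbourhoods in the boundary space *)

Section BoundarySpace.
Variable G : ultragraph.
Local Notation V := (vert G).
Local Notation E := (edge G).
Local Notation X := (bspace G).
Implicit Types (A B C : set V) (v : V) (a b : seq E) (e : E) (y z : X).

Lemma usrcP y : (exists v, usrc (sval y) = [set v]) \/
  exists2 A, sval y = Fin [::] A & bvert A.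
Proof.
case: y => -[[|e a] A|x] yP /=; last by left; eexists.
  by right; exists A => //; case: yP.
by left; exists (src e).
Qed.

Lemma bsrcU A B : gvert A -> gvert B -> bsrc (A `|` B) = bsrc A `|` bsrc B.
Proof.
move=> gA gB; apply/seteqP; split=> y; last first.
  by rewrite /bsrc /= => -[] H; apply: subset_trans H _; [exact: subsetUl|exact: subsetUr].
rewrite /bsrc /= => yAB; case: (usrcP y) => [[v yv]|[C yC bC]].
  have /yAB[Av|Bv] : usrc (sval y) v by rewrite yv.
    by left; rewrite yv => _ ->.
  by right; rewrite yv => _ ->.
by move: yAB; rewrite yC /=; exact: bvert_setU.
Qed.

Lemma bsrcI A B : bsrc (A `&` B) = bsrc A `&` bsrc B :> set X.
Proof. by apply/seteqP; split=> y; rewrite /bsrc /= subsetI. Qed.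

Lemma bsrc0 : bsrc set0 = set0 :> set X.
Proof.
apply/seteqP; split=> // y; rewrite /bsrc /=; case: (usrcP y) => [[v ->]|].
  by move=> /(_ v erefl).
move=> [A -> [[_ iA _]|[_ iA _ _]|[v _ ->]]] /=.
- by have [e Ae] := infinite_setN0 iA; move=> /(_ (src e) Ae).
- by have [v Av] := infinite_setN0 iA; move=> /(_ v Av).
- by move=> /(_ v erefl).
Qed.

Lemma cylinder_nil B : cylinder [::] B = bsrc B :> set X.
Proof.
apply/seteqP; split=> y; first by move=> [c yc cB]; rewrite /bsrc /= yc ucat0.
by move=> yB; exists (sval y) => //; rewrite ucat0.
Qed.

Lemma cylinder_cons e b B y : cylinder (e :: b) B y <->
  bdom (fglet (e, true)) y /\ cylinder b B (bact (fglet (e, false)) y).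
Proof.
rewrite (propext (ldom_pos _ _)); split.
  move=> [c yc cB]; rewrite yc ufirst_ucat; split => //.
  exists c => //; apply: lact_neg; rewrite yc -ucat_cat//.
move=> [/ucat1_udrop yE [c cE cB]]; exists c => //.
by rewrite -cat1s ucat_cat -cE (lact_neg yE).
Qed.

Lemma cylinder_sub b B C : B `<=` C -> cylinder b B `<=` (cylinder b C : set X).
Proof. by move=> BC y [c yc cB]; exists c => //; exact: subset_trans BC. Qed.

Lemma cylinderI b B C : cylinder b (B `&` C) = cylinder b B `&` cylinder b C :> set X.
Proof.
apply/seteqP; split=> y; first by move=> [c yc]; rewrite subsetI => -[]; split; exists c.
by move=> [[c yc cB] [d yd dC]]; exists c => //; rewrite subsetI; split => //;
  rewrite (ucat_inj (etrans (esym yc) yd)).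
Qed.

Lemma cylinderU b B C : gvert B -> gvert C ->
  cylinder b (B `|` C) = cylinder b B `|` cylinder b C :> set X.
Proof.
move=> gB gC; apply/seteqP; split=> y; last first.
  by case; apply: cylinder_sub; [exact: subsetUl|exact: subsetUr].
move=> [c yc cBC]; have /boundary_cat[bc _ _] : boundary (ucat b c).
  by rewrite -yc; exact: (svalP y).
have : bsrc (B `|` C) (exist _ c bc) by [].
by rewrite bsrcU// => -[]; [left|right]; exists c.
Qed.

Lemma cylinder_prng b : cylinder b (prng b) = cylinder b setT :> set X.
Proof.
apply/seteqP; split=> y; first by apply: cylinder_sub.
move=> [c yc _]; exists c => //.
by have /boundary_cat[] : boundary (ucat b c) by rewrite -yc; exact: (svalP y).
Qed.

Lemma bdom_let (l : E * bool) :
  bdom (fglet l) = cylinder (if l.2 then [:: l.1] else [::]) (rng l.1) :> set X.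
Proof.
case: l => e [] /=; last by rewrite cylinder_nil; apply/seteqP; split=> y /ldom_neg.
rewrite -[rng e]/(prng [:: e]) cylinder_prng; apply/seteqP; split=> y.
  by move=> /ldom_pos/ucat1_udrop yE; exists (udrop 1 (sval y)).
by move=> [c yc _]; apply/ldom_pos; rewrite yc ufirst_ucat.
Qed.

Definition utake n (y : uword G) : seq E :=
  match y with Fin a _ => take n a | Inf x => mkseq x n end.

Lemma utakeP b (y : uword G) : utake (size b) y = b <-> exists c, y = ucat b c.
Proof.
split=> [|[c ->]].
  case: y => [a A|x] /= E1.
    by exists (Fin (drop (size b) a) A); rewrite /= -{1}E1 cat_take_drop.
  exists (Inf (fun n => x (n + size b)%N)); rewrite /=; congr Inf; apply/funext => n.
  have [nb|bn] := ltnP n (size b); last by rewrite nth_default// subnK.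
  by rewrite -E1 nth_mkseq.
case: c => [a A|x] /=; first by rewrite take_size_cat.
apply: (@eq_from_nth _ (x 0%N)); first by rewrite size_mkseq.
move=> i; rewrite size_mkseq => ib; rewrite nth_mkseq//.
exact: set_nth_default.
Qed.

Lemma cylinderP b B y : cylinder b B y <->
  utake (size b) (sval y) = b /\ usrc (udrop (size b) (sval y)) `<=` B.
Proof.
rewrite (propext (utakeP _ _)); split=> [[c -> cB]|[[c yc]]].
  by split; [exists c|rewrite udrop_ucat].
by rewrite yc udrop_ucat => cB; exists c.
Qed.

Lemma cylinderT b y : cylinder b setT y <-> utake (size b) (sval y) = b.
Proof. by rewrite (propext (cylinderP _ _ _)); split=> [[]|]. Qed.

Lemma open_basis (U : set X) : bspace_basis U -> open U.
Proof.
move=> bU; exists [set U]; last by rewrite bigcup_set1.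
move=> _ ->; exists (fset1 U); last by rewrite set_fset1 bigcap_set1.
by move=> i /fset1P ->; exact: mem_set.
Qed.

(** [bspace_basis] serves as a subbase, hence finite intersections, the empty one included. *)
Lemma nbhs_basis y (W : set X) : nbhs y W ->
  exists F : {fset (set X)}, [/\ forall U, U \in F -> bspace_basis U,
    forall U, U \in F -> U y & \bigcap_(U in [set` F]) U `<=` W].
Proof.
case=> ? [[I Irp] <-] [?] /[dup] /(Irp _) [F rayF <-] IF Fix IU.
exists F; split => [U UF|U UF|z zF].
- exact/set_mem/rayF.
- exact: Fix.
- by apply: IU; eexists; [exact: IF|].
Qed.

End BoundarySpace.

Section Cylinders.
Variable G : ultragraph.
Local Notation V := (vert G).
Local Notation E := (edge G).
Local Notation X := (bspace G).
Implicit Types (A B C : set V) (v : V) (a b : seq E) (e : E) (y w : X).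

Lemma utake_ucat n a (c : uword G) : (n <= size a)%N -> utake n (ucat a c) = take n a.
Proof.
move=> na; case: c => [d A|x] /=; first by rewrite takel_cat.
case: a na => [|e a]; first by case: n.
move=> na; apply: (@eq_from_nth _ e); rewrite size_mkseq ?size_takel//.
move=> i ni; rewrite nth_mkseq// nth_take//.
by apply: set_nth_default; exact: leq_trans na.
Qed.

Lemma ucat_prefix a b (c d : uword G) : ucat a c = ucat b d -> (size b <= size a)%N ->
  a = b ++ drop (size b) a /\ d = ucat (drop (size b) a) c.
Proof.
move=> E1 ba; have bE : b = take (size b) a.
  by rewrite -(utake_ucat c ba) E1; apply/esym/utakeP; exists d.
have aE : a = b ++ drop (size b) a by rewrite {1}bE cat_take_drop.
split => //; apply: (@ucat_inj _ b); rewrite -E1 -ucat_cat -aE//.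
Qed.

(** Membership in the cylinder of (b, B) is decided by the first |b| + 1 edges: those of b and the
    one whose source is compared with B. *)
Lemma cylinder_agree a b B y w : (size b < size a)%N -> cylinder a setT y ->
  cylinder a setT w -> cylinder b B y -> cylinder b B w.
Proof.
move=> ba [c yc _] [d wd _] [z yz zB].
have [aE zE] := ucat_prefix (etrans (esym yc) yz) (ltnW ba).
exists (ucat (drop (size b) a) d); first by rewrite -ucat_cat -aE.
move: ba zB; rewrite zE; rewrite {1}aE size_cat.
by case: (drop _ a) => [|e a']; rewrite ?addn0 ?ltnn// !usrc_ucat.
Qed.

Lemma basis_cylinder b B : is_path b -> (0 < size b)%N -> gvert B ->
  bspace_basis (cylinder b (B `&` prng b) : set X).
Proof.
move=> pb b0 gB; left; exists (b, B `&` prng b) => //=; split => //; split => //.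
by case: b b0 {pb} => // e b _; apply: gvertI => //; exact: gvert_rng.
Qed.

Lemma cylinder_path b B y : cylinder b B y -> is_path b.
Proof.
by move=> [c yc _]; have /boundary_cat[] : boundary (ucat b c) by rewrite -yc; exact: (svalP y).
Qed.

Lemma cylinder_Iprng b B : cylinder b (B `&` prng b) = cylinder b B :> set X.
Proof. by rewrite cylinderI cylinder_prng -cylinderI setIT. Qed.

(** For b empty the set X_B need not be basic. Around a path with first edge e it contains X_e;
    around (A, A) it contains the basic set with no edges and no sinks removed. *)
Lemma cylinder_open b B : gvert B -> open (cylinder b B : set X).
Proof.
move=> gB; case: b => [|e b]; last first.
  have [pb|pb] := boolP (is_path (e :: b)).
    by rewrite -cylinder_Iprng; exact/open_basis/basis_cylinder.
  rewrite (_ : cylinder _ _ = set0); first exact: open0.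
  by apply/seteqP; split=> // y /cylinder_path pe; rewrite pe in pb.
rewrite cylinder_nil openE => y yB; case: (ufirstP (sval y)) => [[e ye]|[A yA]].
  have oU : open (cylinder [:: e] (rng e) : set X).
    rewrite -[X in cylinder _ X]setIid.
    exact: (open_basis (basis_cylinder (b:=[:: e]) isT isT (gvert_rng e))).
  have sub : cylinder [:: e] (rng e) `<=` (bsrc B : set X).
    move=> w [c wc _]; rewrite /bsrc /= wc usrc_ucat.
    by move: yB; rewrite /bsrc /= (ucat1_udrop ye) usrc_ucat.
  apply: (filterS sub); apply: open_nbhs_nbhs; split => //.
  rewrite -[rng e]/(prng [:: e]) cylinder_prng; exists (udrop 1 (sval y)) => //.
  exact: ucat1_udrop.
have XA : Xfin [::] A by have := svalP y; rewrite yA.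
have bU : bspace_basis (cylinder_at [::] A set0 set0 : set X).
  by right; exists [::], A, set0, set0; split => //; split => //; exact: finite_set0.
move: yB; rewrite /bsrc /= yA /= => AB.
have sub : cylinder_at [::] A set0 set0 `<=` (bsrc B : set X).
  move=> w wA; rewrite /bsrc /=; case: wA => [[->//|[c [e [-> ce [Ae _]]]]]|[v [Av _] [-> _]]] u /=.
    by rewrite ucat0 (ucat1_udrop ce) usrc_ucat => ->; exact: AB.
  by move=> ->; exact: AB.
by apply: (filterS sub); apply: open_nbhs_nbhs; split; [exact: open_basis|left; left].
Qed.

Lemma min_sink_set1 v : ~ min_sink [set v].
Proof. by case=> _ + _ _; apply; exact: finite_set1. Qed.

Lemma bvert_regular A v : bvert A -> A `<=` [set v] -> ~ regular v.
Proof.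
move=> bA Av [v0 fv]; have AE : A = [set v].
  apply/seteqP; split=> // _ ->.
  have [w Aw] : A !=set0.
    case: bA => [[_ iA _]|[_ iA _ _]|[u _ ->]]; last by exists u.
      by have [e Ae] := infinite_setN0 iA; exists (src e).
    exact: infinite_setN0.
  by rewrite -(Av w Aw).
move: bA; rewrite AE => -[[_ iA _]|/min_sink_set1|[u su uv]] //.
have : u = v by have : [set u] v by rewrite -uv.
by move=> uE; rewrite -uE su in v0; case: v0.
Qed.

Lemma Xfin_bvert a A : Xfin a A -> bvert A.
Proof. by case. Qed.

Lemma cylinder_closed b B : gvert B -> closed (cylinder b B : set X).
Proof.
move=> gB; rewrite -[cylinder b B]setCK; apply: open_closedC.
rewrite openE => y yB.
(* A path with more than |b| edges is separated from (b, B) by the cylinder of its first |b| + 1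
   edges; the others end at some (a, A) with |a| <= |b|. *)
have [[a [c [yc ab]]]|] := pselect (exists a c, sval y = ucat a c /\ size a = (size b).+1).
  have ya : cylinder a setT y by exists c.
  have pa := cylinder_path ya.
  have oU : open (cylinder a setT : set X).
    rewrite -cylinder_prng; apply: cylinder_open.
    by case: a ab {yc ya pa} => // e a _; exact: gvert_rng.
  have sub : cylinder a setT `<=` (~` cylinder b B : set X).
    by move=> w wa wb; apply: yB; apply: (cylinder_agree _ wa ya wb); rewrite ab.
  by apply: (filterS sub); apply: open_nbhs_nbhs.
move=> short; have [a [A [yA ab]]] : exists a A, sval y = Fin a A /\ (size a <= size b)%N.
  case E1 : (sval y) => [a A|x]; last first.
    case: short; exists (mkseq x (size b).+1), (Inf (fun n => x (n + (size b).+1)%N)).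
    split; last exact: size_mkseq.
    rewrite E1 /=; congr Inf; apply/funext => n.
    rewrite size_map size_iota; have [nb|bn] := ltnP n (size b).+1; first by rewrite nth_mkseq.
    by rewrite nth_default ?size_mkseq// subnK.
  exists a, A; split => //; rewrite leqNgt; apply/negP => ba; apply: short.
  exists (take (size b).+1 a), (Fin (drop (size b).+1 a) A).
  by rewrite size_takel//= cat_take_drop.
have XA : Xfin a A by have := svalP y; rewrite yA.
have bas F S : F `<=` emitted A -> finite_set F -> S `<=` A `&` @sink G -> finite_set S ->
    (cylinder_at a A F S `<=` (~` cylinder b B : set X)) -> nbhs y (~` cylinder b B : set X).
  move=> sF fF sS fS sub; apply: (filterS sub); apply: open_nbhs_nbhs; split; last by left; left.
  by apply: open_basis; right; exists a, A, F, S.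
move: ab; rewrite leq_eqVlt => /orP[/eqP ab|ab].
  have [aE|nab] := eqVneq a b; last first.
    apply: (bas set0 set0) => //; try exact: finite_set0.
    move=> w wA [d wd _]; have wa : utake (size a) (sval w) = a.
      apply/utakeP; case: wA => [[->|[c [e [-> _ _]]]]|[v _ [-> _]]]; last 2 first.
      - by exists c.
      - by exists (Fin [::] [set v]); rewrite /= cats0.
      - by exists (Fin [::] A); rewrite /= cats0.
    have : utake (size b) (sval w) = b by apply/utakeP; exists d.
    by rewrite -ab wa => ab'; rewrite ab' eqxx in nab.
  rewrite {}aE in XA yA bas *.
  have nAB : ~ A `<=` B.
    by move=> AB; apply: yB; exists (Fin [::] A) => //; rewrite yA /= cats0.
  have [//|[f1 /(_ (Xfin_bvert XA)) e1]] := piece_cap (or_introl (Xfin_bvert XA)) gB.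
  (* By [piece_cap], A meets B in finitely many vertices, emitting finitely many edges; removing
     these edges and sinks leaves a neighbourhood that misses the cylinder. *)
  apply: (bas (emitted (A `&` B)) (A `&` B `&` @sink G)) => //.
  - by move=> e [].
  - by move=> v [[]].
  - exact: finite_setIl.
  - move=> w wA [d wd dB].
    case: wA => [[wE|[c [e [wE ce [eA eF]]]]]|[v [Av vS] [wE [_ vs]]]].
    + apply: nAB; have : d = Fin [::] A by apply: (@ucat_inj _ b); rewrite -wd wE /= cats0.
      by move=> dE; move: dB; rewrite dE.
    + apply: eF; split => //; apply: dB.
      by rewrite (ucat_inj (etrans (esym wd) wE)) (ucat1_udrop ce) usrc_ucat.
    + have dE : d = Fin [::] [set v] by apply: (@ucat_inj _ b); rewrite -wd wE /= cats0.
      apply: vS; split; first by split => //; apply: dB; rewrite dE.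
      case: vs => [/min_sink_set1//|[u su uv]].
      by have -> : v = u by have : [set u] v by rewrite -uv.
have [e [b' bE]] : exists e b', b = take (size a) b ++ e :: b'.
  case E1 : (drop (size a) b) => [|e b'].
    by have := size_drop (size a) b; rewrite E1 /= => /esym/eqP; rewrite subn_eq0 leqNgt ab.
  by exists e, b'; rewrite -E1 cat_take_drop.
(* [e] is the edge of b that follows a; without it no path near (a, A) enters the cylinder. *)
apply: (bas ([set e] `&` emitted A) set0) => //; try exact: finite_set0.
- exact: finite_setIl.
move=> w wA [d wd _].
have abs A' : sval w <> Fin a A'.
  rewrite wd; case: d {wd} => //= d A'' [+ _] => /(congr1 size).
  by rewrite size_cat => /eqP; rewrite gtn_eqF// ltn_addr.
case: wA => [[/abs//|[c [f [wE cf [fA fF]]]]]|[v _ [/abs]]] //.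
have [_ cE] := ucat_prefix (etrans (esym wd) wE) (ltnW ab).
apply: fF; split => //; move: cf; rewrite cE.
have -> : drop (size a) b = e :: b' by rewrite {1}bE drop_size_cat// size_takel// ltnW.
by rewrite ufirst_ucat => -[->].
Qed.


Definition cyls (N : seq (seq E * set V)) : set X :=
  [set y | exists2 n, n \in N & cylinder n.1 n.2 y].

Definition wf_cyls (N : seq (seq E * set V)) : Prop :=
  forall n, n \in N -> gvert n.2.

(** Expresses neighbourhoods by cylinders alone, the only sets that have counterparts in A. In
    general the removed cylinders are those of b e for e in F and of (b, {v}) for v in S. *)
Lemma std_nbhd (U : set X) y : bspace_basis U -> U y ->
  exists a A N, [/\ gvert A, wf_cyls N, cylinder a A y, ~ cyls N y &
    cylinder a A `\` cyls N `<=` U].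
Proof.
case=> [[[b B] /= [[pb gB Bb] _] <-] yU|[b [B [F [S [XB [sF fF] [sS fS] ->]]]]] yU].
  by exists b, B, [::]; split; [| | |case|move=> w []].
have gB : gvert B by case: XB => -[].
have bB := Xfin_bvert XB.
(* If B is a single sink v, S may contain v, and removing the cylinder of (b, {v}) would remove y
   itself; that cylinder is just one point, so nothing has to be removed. *)
have [[v [vs Bv]]|ns] := pselect (exists v, sink v /\ B `<=` [set v]).
  have BE : B = [set v].
    by apply/seteqP; split => // _ ->; have [w Bw] := Xfin_nonempty XB; rewrite -(Bv w Bw).
  have sub (w : X) : cylinder b [set v] w -> sval w = Fin b [set v].
    move=> [c wc cv]; have /boundary_cat[bc _ _] : boundary (ucat b c).
      by rewrite -wc; exact: (svalP w).
    case: (ufirstP c) => [[e ce]|[C cE]].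
      move: cv; rewrite (ucat1_udrop ce) usrc_ucat => /(_ (src e) erefl) sv.
      by have : emitted [set v] e by []; rewrite vs.
    move: bc cv; rewrite cE /= => XC Cv.
    rewrite wc cE /= cats0; congr Fin; apply/seteqP; split => // _ ->.
    by have [u Cu] := Xfin_nonempty XC; rewrite -(Cv u Cu).
  have yE : sval y = Fin b B.
    case: yU => [[//|[c [e [_ _ [eB _]]]]]|[u [Bu _] [yE _]]].
      by move: eB; rewrite BE vs.
    by rewrite yE BE (_ : u = v)//; move: Bu; rewrite BE.
  exists b, B, [::]; split; [by []|by []| |by case|].
    by exists (Fin [::] B) => //; rewrite yE /= cats0.
  by move=> w [+ _]; rewrite BE => /sub wE; left; left.
have /finite_seqP[s sE] := fF; have /finite_seqP[s' s'E] := fS.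
exists b, B, ([seq (rcons b e, rng e) | e <- s] ++ [seq (b, [set v]) | v <- s']).
have NP (w : X) : cyls ([seq (rcons b e, rng e) | e <- s] ++ [seq (b, [set v]) | v <- s']) w <->
    (exists2 e, F e & cylinder (rcons b e) (rng e) w) \/
    (exists2 v, S v & cylinder b [set v] w).
  split.
    move=> [n]; rewrite mem_cat => /orP[/mapP[e es ->]|/mapP[v vs ->]] /= wn.
      by left; exists e => //; rewrite sE.
    by right; exists v => //; rewrite s'E.
  case=> [[e eF we]|[v vS wv]].
    exists (rcons b e, rng e) => //; rewrite mem_cat; apply/orP; left.
    by apply/mapP; exists e => //; move: eF; rewrite sE.
  exists (b, [set v]) => //; rewrite mem_cat; apply/orP; right.
  by apply/mapP; exists v => //; move: vS; rewrite s'E.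
have ucb (c : uword G) C : ucat b c = Fin b C -> c = Fin [::] C.
  by move=> cC; apply: (@ucat_inj _ b); rewrite cC /= cats0.
split => //.
- move=> n; rewrite mem_cat => /orP[/mapP[e _ ->]|/mapP[v _ ->]]; first exact: gvert_rng.
  exact: gvert1.
- case: yU => [[yE|[c [e [yE ce [eB _]]]]]|[v [Bv _] [yE _]]].
  + by exists (Fin [::] B) => //; rewrite yE /= cats0.
  + by exists c => //; rewrite (ucat1_udrop ce) usrc_ucat => _ ->.
  + by exists (Fin [::] [set v]); [rewrite yE /= cats0|move=> _ ->].
- move=> /NP[[e eF [c]]|[v vS [c yc cv]]].
    rewrite -cats1 ucat_cat => yc _.
    case: yU => [[yE|[d [f [yE df [_ fF']]]]]|[v _ [yE _]]].
    + by move: (ucb _ _ (etrans (esym yc) yE)); case: c {yc}.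
    + apply: fF'; move: df; rewrite -(ucat_inj (etrans (esym yc) yE)) ufirst_ucat.
      by case=> <-.
    + by move: (ucb _ _ (etrans (esym yc) yE)); case: c {yc}.
  have [_ sv] := sS _ vS.
  case: yU => [[yE|[d [f [yE df [_ fF']]]]]|[u [_ uS] [yE _]]].
  + apply: ns; exists v; split => //.
    by move: cv; rewrite (ucb _ _ (etrans (esym yc) yE)).
  + move: cv; rewrite (ucat_inj (etrans (esym yc) yE)) (ucat1_udrop df) usrc_ucat.
    by move=> /(_ _ erefl) fv; have : emitted [set v] f by []; rewrite sv.
  + move: cv; rewrite (ucb _ _ (etrans (esym yc) yE)) => /(_ u erefl) uv.
    by apply: uS; rewrite uv.
- move=> w [[c wc cB] /NP nN].
  have /boundary_cat[bc pb cb] : boundary (ucat b c) by rewrite -wc; exact: (svalP w).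
  case: (ufirstP c) => [[e ce]|[C cE]].
    left; right; exists c, e; split => //; split.
      by move: cB; rewrite (ucat1_udrop ce) usrc_ucat => /(_ _ erefl).
    move=> eF; apply: nN; left; exists e => //.
    have -> : rng e = prng (rcons b e) by case: (b) => //= f b'; rewrite last_rcons.
    rewrite cylinder_prng; exists (udrop 1 c) => //.
    by rewrite -cats1 ucat_cat -(ucat1_udrop ce).
  move: bc cB; rewrite cE /= => XC CB.
  (* The paths (b, C) with C inside B have C = B or C a sink, exactly those that the basic set takes
     into account. *)
  have [CE|[v sv vE]] := bvert_maximal bB (Xfin_bvert XC) CB.
    by left; left; rewrite /= wc cE CE /= cats0.
  have wE : sval w = Fin b [set v] by rewrite wc cE vE /= cats0.
  right; exists v; last first.
    split => //; split; last by right; exists v.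
    split => //; first exact: gvert1.
    by rewrite -vE; move: cb; rewrite cE.
  split; first by apply: CB; rewrite vE.
  move=> Sv; apply: nN; right; exists v => //.
  by exists (Fin [::] [set v]); rewrite // wE /= cats0.
Qed.

Lemma ultra_setU (T : Type) (F : set_system T) (P Q : set T) :
  UltraFilter F -> F (P `|` Q) -> F P \/ F Q.
Proof.
move=> FU FPQ; have [|FP] := in_ultra_setVsetC P FU; [by left|right].
by apply: filterS (filterI FPQ FP) => x [[]].
Qed.

(** By [std_nbhd], every neighbourhood of y contains a finite intersection of cylinders through y
    and complements of cylinders missing y, and an ultrafilter contains the complement of each set
    that it omits. *)
Lemma ultra_cvg (F : set_system X) y : UltraFilter F ->
  (forall b B, gvert B -> cylinder b B y -> F (cylinder b B)) ->
  (forall b B, gvert B -> ~ cylinder b B y -> ~ F (cylinder b B)) ->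
  F --> y.
Proof.
move=> FU H1 H2 W /nbhs_basis[I [bI yI IW]].
apply: (filterS IW); apply: filter_bigI => U UI.
have [a [A [N [gA wN ya yN NU]]]] := std_nbhd (bI _ UI) (yI _ UI).
apply: (filterS NU); apply: filterI; first exact: H1.
have [FN|//] := in_ultra_setVsetC (cyls N) FU; exfalso.
clear NU; elim: N wN yN FN => [|n N IH] wN yN FN.
  have : F set0 by apply: filterS FN => w [].
  exact: filter_not_empty.
have [||] := @ultra_setU _ F (cylinder n.1 n.2) (cyls N) FU.
- apply: filterS FN => w [m]; rewrite inE => /orP[/eqP ->|mN wm]; first by left.
  by right; exists m.
- apply: H2; first by apply: wN; rewrite mem_head.
  by move=> yn; apply: yN; exists n => //; rewrite mem_head.
- apply: IH.
  + by move=> m mN; apply: wN; rewrite inE mN orbT.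
  + by move=> [m mN ym]; apply: yN; exists m => //; rewrite inE mN orbT.
Qed.

End Cylinders.

(** * Compactness of the cylinders *)

Section Compactness.
Variable G : ultragraph.
Hypothesis hG : RFUM2 G.
Local Notation V := (vert G).
Local Notation E := (edge G).
Local Notation X := (bspace G).
Implicit Types (A B C : set V) (v : V) (a b : seq E) (e : E) (y w : X).

Lemma ultra_bigcup (T I : Type) (F : set_system T) (D : set I) (P : I -> set T) :
  UltraFilter F -> finite_set D -> F (\bigcup_(i in D) P i) ->
  exists2 i, D i & F (P i).
Proof.
move=> FU /finite_setP[n]; elim: n D => [|n IH] D.
  by rewrite II0 card_eq0 => /eqP ->; rewrite bigcup_set0 => /filter_not_empty.
move=> /eq_cardSP[i Di /IH{}IH]; rewrite -(setD1K Di) bigcup_setU1.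
move=> /(ultra_setU FU)[Fi|/IH[j [Dj Dij] Fj]]; first by exists i; [left|].
by exists j; [right; split|].
Qed.

Lemma ultra_pieces (F : set_system X) a B : UltraFilter F -> gvert B ->
  F (cylinder a B) -> exists C, [/\ piece C, C `<=` B & F (cylinder a C)].
Proof.
move=> FU /(gvert_pieces hG); elim=> [|C D pC pD IH].
  have -> : cylinder a set0 = set0 :> set X.
    apply/seteqP; split=> // y [c yc c0].
    have /boundary_cat[bc _ _] : boundary (ucat a c) by rewrite -yc; exact: (svalP y).
    by have : bsrc set0 (exist _ c bc) by []; rewrite bsrc0.
  by move=> /filter_not_empty.
rewrite cylinderU; [|exact: piece_gvert|exact: pieces_gvert].
move=> /(ultra_setU FU)[FC|/IH[C' [? C'D ?]]].
  by exists C; split => //; exact: subsetUl.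
by exists C'; split => //; apply: subset_trans C'D _; exact: subsetUr.
Qed.

Section Limit.
Variables (F : set_system X) (FU : UltraFilter F).
(** The words with which almost all paths begin, in the sense of [F]; by [good_prefix] they form a
    chain of prefixes. *)
Local Notation good a := (F (cylinder a [set: V])).

Lemma good_point a B : F (cylinder a B) -> exists y, cylinder a B y.
Proof. by move=> /filter_ex. Qed.

Lemma good_sub a B : F (cylinder a B) -> good a.
Proof. by apply: filterS; exact: cylinder_sub. Qed.

Lemma good_prefix a b : good a -> good b -> (size b <= size a)%N -> b = take (size b) a.
Proof.
move=> ga gb ba; have [y [/cylinderT ya /cylinderT yb]] := filter_ex (filterI ga gb).
have /utakeP[c yc] := ya; rewrite -[LHS]yb yc utake_ucat//.
Qed.

Lemma good_take a n : good a -> good (take n a).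
Proof.
apply: filterS => y /cylinderT /utakeP[c yc]; apply/cylinderT/utakeP.
by exists (ucat (drop n a) c); rewrite -ucat_cat cat_take_drop.
Qed.

Lemma good_agree a b B y : good a -> cylinder a setT y -> (size b < size a)%N ->
  (cylinder b B y -> F (cylinder b B)) /\ (~ cylinder b B y -> ~ F (cylinder b B)).
Proof.
move=> ga ya ba; split=> yb; first by apply: filterS ga => w wa; exact: (cylinder_agree ba ya wa yb).
move=> Fb; have [w [wa wb]] := filter_ex (filterI ga Fb); apply: yb.
exact: (cylinder_agree ba wa ya wb).
Qed.

Lemma ultra_limit b0 B0 : gvert B0 -> F (cylinder b0 B0) -> exists y, F --> y.
Proof.
move=> gB0 F0; have g0 : good [::].
  by apply: filterS filterT => y _; rewrite cylinder_nil.
(* Good words of every length are the initial segments of one infinite path, the limit. Otherwise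
   there is a longest good word a, and the limit is some (a, C). *)
have [inf|] := pselect (forall n, exists2 a, size a = n & good a).
  have /choice[a_ a_P] : forall n, exists a, size a = n /\ good a.
    by move=> n; have [a] := inf n; exists a.
  have [e0 _] : exists e : E, True.
    by have [+ _] := a_P 1%N; case: (a_ 1%N) => // e a _; exists e.
  pose x n := nth e0 (a_ n.+1) n.
  have x_nth i n : (i < n)%N -> x i = nth e0 (a_ n) i.
    move=> ni; have [s1 g1] := a_P i.+1; have [s2 g2] := a_P n.
    by rewrite /x (good_prefix g2 g1) ?s1 ?s2// nth_take.
  have ux n : utake n (Inf x) = a_ n.
    have [s1 g1] := a_P n; apply: (@eq_from_nth _ e0); rewrite size_mkseq ?s1// => i ni.
    by rewrite nth_mkseq// (x_nth _ n).
  have px : infinite_path x.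
    move=> n; have [s1 g1] := a_P n.+2; have [y /cylinder_path] := good_point g1.
    rewrite /is_path => /(sortedP e0)/(_ n); rewrite s1 ltnS leqnn -!x_nth//.
    by move=> /(_ isT)/set_mem.
  pose y : X := exist _ (Inf x) px.
  have agree b B : (cylinder b B y -> F (cylinder b B)) /\
      (~ cylinder b B y -> ~ F (cylinder b B)).
    have [s1 g1] := a_P (size b).+1.
    have y1 : cylinder (a_ (size b).+1) setT y by apply/cylinderT; rewrite s1 ux.
    have sb : (size b < size (a_ (size b).+1))%N by rewrite s1.
    split; first exact: (good_agree B g1 y1 sb).1.
    exact: (good_agree B g1 y1 sb).2.
  by exists y; apply: ultra_cvg => b B _; [exact: (agree b B).1|exact: (agree b B).2].
move=> ninf; have [a ga nga] : exists2 a, good a & forall e, ~ good (rcons a e).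
  apply: contrapT => H; apply: ninf; elim=> [|n [a an ga]]; first by exists [::].
  have [e ge] : exists e, good (rcons a e).
    by apply: contrapT => H'; apply: H; exists a => // e ge; apply: H'; exists e.
  by exists (rcons a e) => //; rewrite size_rcons an.
have ngb b : (size a < size b)%N -> ~ good b.
  move=> ab gb; have gt := good_take (size a).+1 gb.
  have st : size (take (size a).+1 b) = (size a).+1 by rewrite size_takel.
  move: gt st; case/lastP: (take _ b) => // c e gc; rewrite size_rcons => -[sc].
  have aE : a = c.
    by rewrite (good_prefix gc ga) ?size_rcons ?sc// -cats1 take_size_cat.
  by apply: (nga e); rewrite aE.
(* At a regular vertex every boundary path has one of finitely many first edges; [F] would choose
   one of them and extend a. *)
have nreg v : regular v -> ~ F (cylinder a [set v]).
  move=> rv Fv; have [_ fv] := rv.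
  have [|e ve ge] := @ultra_bigcup _ _ F (emitted [set v]) (fun e => cylinder (rcons a e) setT) FU fv.
    apply: filterS Fv => y [c yc cv].
    have /boundary_cat[bc _ _] : boundary (ucat a c) by rewrite -yc; exact: (svalP y).
    case: (ufirstP c) => [[e ce]|[C cE]].
      exists e; first by apply: cv; rewrite (ucat1_udrop ce) usrc_ucat.
      by exists (udrop 1 c) => //; rewrite yc -cats1 ucat_cat -(ucat1_udrop ce).
    by move: bc cv; rewrite cE /= => /Xfin_bvert /bvert_regular H /H /(_ rv).
  exact: nga ge.
(* For a empty, [prng a] is the set of all vertices, which need not be a generalized vertex; then b0
   is empty too and B0 takes its place. *)
have [B [gB Ba FB]] : exists B, [/\ gvert B, B `<=` prng a & F (cylinder a B)].
  case: (posnP (size a)) => [/size0nil aE|a0].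
    case: b0 F0 => [|e b] F0; first by exists B0; rewrite aE.
    exfalso; apply: (nga e); rewrite aE.
    by have := good_take 1 (good_sub F0); rewrite /= take0.
  exists (prng a); split => //; last by rewrite cylinder_prng.
  by case: (a) a0 => // e a' _; exact: gvert_rng.
(* If [F] sits on one sink, the limit ends there and not at a larger set containing it; otherwise
   any piece chosen by [F] will do. *)
have [C [bC Ca FC sC]] : exists C, [/\ bvert C, C `<=` prng a, F (cylinder a C) &
    forall v, sink v -> F (cylinder a [set v]) -> C v -> C = [set v]].
  have [[v [sv Fv]]|ns] := pselect (exists v, sink v /\ F (cylinder a [set v])).
    exists [set v]; split => //; first by apply: Or33; exists v.
      have [y [c yc cv]] := good_point Fv.
      have /boundary_cat[bc _ ca] : boundary (ucat a c) by rewrite -yc; exact: (svalP y).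
      move=> _ ->; apply: ca; apply: contrapT => nv.
      have : bsrc set0 (exist _ c bc).
        by rewrite /bsrc /= => u cu; have uv := cv _ cu; rewrite uv in cu.
      by rewrite bsrc0.
    by move=> u _ _ ->.
  have [C [[bC|[v rv CE]] CB FC]] := ultra_pieces FU gB FB; last first.
    by case: (nreg v rv); rewrite -CE.
  exists C; split => //; first exact: subset_trans Ba.
  by move=> v sv Fv; case: ns; exists v.
have pa : is_path a by have [y /cylinder_path] := good_point FC.
have XC : Xfin a C by split => //; split => //; exact: bvert_gvert.
exists (exist _ (Fin a C) XC : X).
have yT : cylinder a setT (exist _ (Fin a C) XC : X).
  by exists (Fin [::] C) => //=; rewrite cats0.
apply: ultra_cvg => b D gD.
  move=> yb; have [ba|] := ltnP (size b) (size a).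
    by have [H _] := @good_agree _ b D _ ga yT ba; exact: H.
  rewrite leq_eqVlt => /orP[/eqP ab|ab].
    have [c /= cE cD] := yb; have [bE cE'] : a = b /\ c = Fin [::] C.
      have aC : ucat a (Fin [::] C) = ucat b c by rewrite -cE /= cats0.
      have [aE1 cE1] := ucat_prefix aC (eq_leq (esym ab)).
      by move: aE1 cE1; rewrite -ab drop_size cats0 => -> ->.
    by rewrite -bE; apply: filterS FC; apply: cylinder_sub; move: cD; rewrite cE'.
  have [c /= cE cD] := yb; exfalso; move: cE ab; case: c {cD} => // d D' [-> _].
  by rewrite size_cat ltnNge leq_addr.
move=> yb Fb; have [ba|] := ltnP (size b) (size a).
  by have [_ H] := @good_agree _ b D _ ga yT ba; exact: H.
rewrite leq_eqVlt => /orP[/eqP ab|/ngb]; last by apply; exact: good_sub Fb.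
have bE : b = a.
  by have := good_prefix ga (good_sub Fb) (eq_leq (esym ab)); rewrite -ab take_size.
rewrite {}bE {ab b} in yb Fb *.
have nCD : ~ C `<=` D by move=> CD; apply: yb; exists (Fin [::] C) => //=; rewrite cats0.
have FCD : F (cylinder a (C `&` D)) by rewrite cylinderI; exact: filterI.
(* [F] also chooses a piece C' of C [&] D. It is C or a sink in C, and in the latter case the choice
   of C forces C to be that sink; either way C lies in D. *)
have [C' [[bC'|[v rv C'E]] C'CD FC']] :=
  ultra_pieces FU (gvertI (bvert_gvert bC) gD) FCD; last first.
  by apply: (nreg v rv); rewrite -C'E.
have C'C : C' `<=` C by move=> v /C'CD[].
have C'D : C' `<=` D by move=> v /C'CD[].
have [C'E|[v sv C'E]] := bvert_maximal bC bC' C'C; first by apply: nCD; rewrite -C'E.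
by apply: nCD; rewrite (sC v) ?C'E//; [rewrite -C'E|rewrite -C'E|apply: C'C; rewrite C'E].
Qed.

End Limit.

Lemma cylinder_compact b B : gvert B -> compact (cylinder b B : set X).
Proof.
move=> gB; rewrite compact_ultra => F FU Fb.
have [y Fy] := ultra_limit FU gB Fb; exists y; split => //.
have [//|nyb] := pselect (cylinder b B y); exfalso.
have : nbhs y (~` cylinder b B : set X).
  by apply: open_nbhs_nbhs; split => //; exact/closed_openC/cylinder_closed.
move=> /Fy FC; have [w [wb]] := filter_ex (filterI Fb FC).
by apply.
Qed.

End Compactness.

(** * The projections of a Cuntz-Krieger family *)

Section VertexPoint.
Variable G : ultragraph.
Local Notation V := (vert G).
Local Notation X := (bspace G).

(** Follow chosen edges as long as the vertex is regular: either this goes on forever and gives an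
    infinite path, or it stops at a non-regular vertex u, where ({u}, {u}) is itself a boundary
    path. *)
Lemma vertex_point (v : V) : exists y : X, usrc (sval y) = [set v].
Proof.
have base u : ~ regular u -> exists y : X, usrc (sval y) = [set u].
  move=> nu; have Xu : Xfin [::] [set u].
    split; first by split => //; exact: gvert1.
    by have [//|[w rw /seteqP[/(_ u erefl) uw _]]] := piece_set1 u; rewrite uw in nu.
  by exists (exist _ (Fin [::] [set u]) Xu).
have [rv|/base//] := pselect (regular v).
have [[e0 _] _] := rv.
have /choice[f fP] : forall u : V, exists e, regular u -> src e = u.
  move=> u; have [[[e eu] _]|nu] := pselect (regular u); last by exists e0.
  by exists e.
have /choice[g gP] : forall e : edge G, exists u, rng e u by exact: rng_neq0.
pose nxt u := g (f u).
have [allr|] := pselect (forall n, regular (iter n nxt v)).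
  have px : infinite_path (fun n => f (iter n nxt v)).
    by move=> n; rewrite fP//; exact: gP.
  by exists (exist _ (Inf _) px); rewrite /= fP.
move=> /existsNP[n]; elim: n v {rv} => [|n IH] v nr; first exact: base.
have [rv|/base//] := pselect (regular v).
rewrite iterSr in nr; have [y yv] := IH _ nr.
have yr : usrc (sval y) `<=` rng (f v) by rewrite yv => _ ->; exact: gP.
by exists (bact (fglet (f v, true)) y); rewrite lact_pos// usrc_ucat fP.
Qed.

End VertexPoint.

Section CuntzKrieger.
Variables (R : realType) (G : ultragraph) (A : cstarAlgType R).
Variables (s : edge G -> A) (p : set (vert G) -> A).
Hypothesis ck : ck_family s p.
Local Notation V := (vert G).
Local Notation E := (edge G).
Local Notation X := (bspace G).
Implicit Types (B C D : set V) (b : seq E) (e : E) (x z : A).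
Local Notation "x ^s" := (cstar x) (at level 2, format "x ^s").

Lemma s_pisom e : s e ** (s e)^s ** s e = s e. Proof. exact: (ck_pisom ck). Qed.

Lemma s_orth e f : e <> f -> (s e)^s ** s f = 0.
Proof.
move=> ef; have E1 : (s e)^s ** s e ** (s e)^s = (s e)^s.
  by rewrite -[in RHS](s_pisom e) !cstarM cstarK cmulA.
have := congr1 (fun z => (s e)^s ** z ** s f) (ck_orth ck ef).
by rewrite cmulx0 cmul0x !cmulA E1 -!cmulA [s f ** _]cmulA s_pisom.
Qed.

Lemma s_p e : s e ** p (rng e) = s e.
Proof. by rewrite -(ck_range ck) cmulA s_pisom. Qed.

Lemma p_sa B : gvert B -> (p B)^s = p B.
Proof. by move=> /(ck_proj ck)[]. Qed.

Lemma p_ss e : p (rng e) ** (s e)^s = (s e)^s.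
Proof. by rewrite -(p_sa (gvert_rng e)) -cstarM s_p. Qed.

Lemma p_src e : p [set src e] ** s e = s e.
Proof.
have [H _] := ck_source ck e.
by rewrite -[in LHS](s_pisom e) cmulA H s_pisom.
Qed.

Lemma p_s_in B e : gvert B -> B (src e) -> p B ** s e = s e.
Proof.
move=> gB Be; rewrite -[in LHS]p_src cmulA (ck_pI ck)//; last exact: gvert1.
by rewrite setIidr ?p_src// => _ ->.
Qed.

Lemma p_s_out B e : gvert B -> ~ B (src e) -> p B ** s e = 0.
Proof.
move=> gB Be; rewrite -[in LHS]p_src cmulA (ck_pI ck)//; last exact: gvert1.
rewrite (_ : B `&` _ = set0) ?(ck_p0 ck) ?cmul0x//.
by apply/seteqP; split=> // u [Bu uE]; rewrite uE in Bu.
Qed.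

Lemma ss_p_in B e : gvert B -> B (src e) -> (s e)^s ** p B = (s e)^s.
Proof. by move=> gB Be; rewrite -(p_sa gB) -cstarM p_s_in. Qed.

Lemma ss_p_out B e : gvert B -> ~ B (src e) -> (s e)^s ** p B = 0.
Proof. by move=> gB Be; rewrite -(p_sa gB) -cstarM p_s_out// cstar0. Qed.

Definition cyl_proj b B : A := foldr (fun e x => s e ** x ** (s e)^s) (p B) b.
Local Notation q := cyl_proj.

Lemma q_sa b B : gvert B -> (q b B)^s = q b B.
Proof.
move=> gB; elim: b => [|e b IH]; first exact: p_sa.
by rewrite /= !cstarM cstarK IH cmulA.
Qed.

Lemma q_set0 b : q b set0 = 0.
Proof. by elim: b => [|e b IH] /=; rewrite ?(ck_p0 ck)// IH cmulx0 cmul0x. Qed.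

Lemma cylinder_set0 b : cylinder b set0 = set0 :> set X.
Proof.
elim: b => [|e b IH]; first by rewrite cylinder_nil bsrc0.
by apply/seteqP; split=> // y /cylinder_cons[_]; rewrite IH.
Qed.

Lemma p_comm_q b B C : gvert B -> gvert C -> p C ** q b B = q b B ** p C.
Proof.
move=> gB gC; case: b => [|e b] /=; first by rewrite !(ck_pI ck)// setIC.
have [Ce|Ce] := pselect (C (src e)).
  by rewrite !cmulA p_s_in// -!cmulA ss_p_in.
by rewrite !cmulA p_s_out// -!cmulA ss_p_out// !cmul0x !cmulx0.
Qed.

Lemma q_mul_p b B C : gvert B -> gvert C -> exists D, [/\ gvert D,
  cylinder b B `&` bsrc C = (cylinder b D : set X) & q b B ** p C = q b D].
Proof.
move=> gB gC; case: b => [|e b].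
  exists (B `&` C); split; first exact: gvertI.
    by rewrite !cylinder_nil bsrcI.
  exact: (ck_pI ck).
have srcE (y : X) : cylinder (e :: b) B y -> usrc (sval y) = [set src e].
  by move=> [c -> _]; rewrite usrc_ucat.
have [Ce|Ce] := pselect (C (src e)).
  exists B; split => //.
    by apply/seteqP; split=> [y []//|y yB]; split => //; rewrite /bsrc /= srcE// => _ ->.
  by rewrite /= -!cmulA ss_p_in.
exists set0; split; first exact: gvert0.
  rewrite cylinder_set0; apply/seteqP; split=> // y [yB]; rewrite /bsrc /= srcE//.
  by move=> /(_ _ erefl).
by rewrite q_set0 /= -!cmulA ss_p_out// !cmulx0.
Qed.

Lemma cylinder_consI e f b c B C :
  cylinder (e :: b) B `&` cylinder (f :: c) C `<=`
  [set y : X | e = f /\ (cylinder b B `&` cylinder c C) (bact (fglet (e, false)) y)].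
Proof.
move=> y [/cylinder_cons[/ldom_pos ye yb] /cylinder_cons[/ldom_pos yf yc]].
by move: yf; rewrite ye => -[ef]; rewrite -ef in yc *.
Qed.

(** One witness (d, D) serves both for the intersection of the cylinders and for the product of the
    projections, which keeps the two sides in step in all that follows. *)
Lemma q_mulP b B c C : gvert B -> gvert C -> exists d D, [/\ gvert D,
  cylinder b B `&` cylinder c C = (cylinder d D : set X) & q b B ** q c C = q d D].
Proof.
move=> gB gC; elim: b c => [|e b IH] c.
  have [D [gD cD qD]] := q_mul_p c gC gB; exists c, D; split => //.
    by rewrite setIC cylinder_nil.
  by rewrite [LHS]p_comm_q.
case: c => [|f c].
  have [D [gD cD qD]] := q_mul_p (e :: b) gB gC; exists (e :: b), D; split => //.
  by rewrite cylinder_nil.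
have [ef|ef] := pselect (e = f).
  case: _ / ef; have [d [D [gD cD qD]]] := IH c; exists (e :: d), D; split => //.
    apply/seteqP; split=> y.
      move=> ye; have [_ yI] := cylinder_consI ye.
      apply/cylinder_cons; rewrite -cD; split => //.
      by case: ye => /cylinder_cons[].
    move=> /cylinder_cons[ye]; rewrite -cD => -[yb yc].
    by split; apply/cylinder_cons.
  rewrite /= -qD !cmulA -(cmulA _ (s e)^s) (ck_range ck).
  rewrite -(cmulA _ (p (rng e))) p_comm_q//; last exact: gvert_rng.
  by rewrite -!cmulA p_ss.
exists [::], set0; split; first exact: gvert0.
  by rewrite cylinder_set0; apply/seteqP; split=> // y /cylinder_consI[/ef].
rewrite q_set0 /= !cmulA -(cmulA _ (s e)^s) s_orth//.
by rewrite !(cmul0x, cmulx0).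
Qed.

Lemma q_comm b B c C : gvert B -> gvert C -> q b B ** q c C = q c C ** q b B.
Proof.
move=> gB gC; have [d [D [gD _ E1]]] := q_mulP b c gB gC.
by rewrite E1 -(q_sa d gD) -E1 cstarM !q_sa.
Qed.

Lemma q_idem b B : gvert B -> q b B ** q b B = q b B.
Proof.
move=> gB; elim: b => [|e b IH] /=; first by rewrite (ck_pI ck)// setIid.
rewrite !cmulA -(cmulA _ (s e)^s) (ck_range ck) -(cmulA _ (p (rng e))).
by rewrite p_comm_q//; [rewrite -!cmulA p_ss !cmulA -(cmulA (s e)) IH|exact: gvert_rng].
Qed.

Lemma nrm_q b B : gvert B -> nrm (q b B) <= 1.
Proof. by move=> gB; rewrite nrm_proj ?q_sa ?q_idem. Qed.

(* Right multiplication by the product of the [1 - q n.1 n.2]; A has no unit. *)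
Definition coproj (N : seq (seq E * set V)) x : A :=
  foldl (fun x n => x - x ** q n.1 n.2) x N.

Lemma coprojD N x y : coproj N (x + y) = coproj N x + coproj N y.
Proof.
by elim: N x y => //= n N IH x y; rewrite -IH cmulDl opprD addrACA.
Qed.

Lemma coproj0 N : coproj N 0 = 0.
Proof. by elim: N => //= n N IH; rewrite cmul0x subr0. Qed.

Lemma coprojN N x : coproj N (- x) = - coproj N x.
Proof. by apply/eqP; rewrite -addr_eq0 -coprojD addNr coproj0. Qed.

Lemma coprojZ N (c : R[i]) x : coproj N (c *: x) = c *: coproj N x.
Proof. by elim: N x => //= n N IH x; rewrite -IH cmulZl scalerBr. Qed.

Lemma coprojM N x y : coproj N (x ** y) = x ** coproj N y.
Proof. by elim: N y => //= n N IH y; rewrite -IH cmulBr cmulA. Qed.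

Lemma coproj_mulr N x b B : wf_cyls N -> gvert B -> coproj N (x ** q b B) = coproj N x ** q b B.
Proof.
elim: N x => //= n N IH x wN gB; rewrite -IH//; last first.
  by move=> m mN; apply: wN; rewrite inE mN orbT.
by rewrite cmulBl -!cmulA (q_comm b n.1)//; apply: wN; rewrite mem_head.
Qed.

Lemma coproj_in N n x : wf_cyls N -> n \in N -> x ** q n.1 n.2 = x -> coproj N x = 0.
Proof.
elim: N x => //= m N IH x wN; rewrite inE => /orP[/eqP <- ->|nN xn].
  by rewrite subrr coproj0.
have wN' : wf_cyls N by move=> k kN; apply: wN; rewrite inE kN orbT.
apply: IH => //; rewrite cmulBl xn -cmulA (q_comm m.1)//.
- by rewrite cmulA xn.
- by apply: wN; rewrite mem_head.
- exact: wN'.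
Qed.

(** For z = x - x Q one has z z^* = z x^*, since z Q = 0; hence |z|^2 <= |z| |x|, a substitute for
    |1 - Q| <= 1 that uses no unit. *)
Lemma nrm_coq N x : wf_cyls N -> nrm (coproj N x) <= nrm x.
Proof.
elim: N x => //= n N IH x wN; apply: le_trans (IH _ _) _.
  by move=> k kN; apply: wN; rewrite inE kN orbT.
have gn : gvert n.2 by apply: wN; rewrite mem_head.
set Q := q _ _; have [->|/eqP z0] := eqVneq (nrm (x - x ** Q)) 0; first exact: nrm_ge0.
have zp : 0 < nrm (x - x ** Q).
  by rewrite lt_neqAle nrm_ge0 andbT eq_sym; exact/eqP.
rewrite -(ler_pM2l zp) -expr2 -{1}(nrm_cstar (x - x ** Q)) -nrm_cstar_mul cstarK.
have -> : (x - x ** Q) ** (x - x ** Q)^s = (x - x ** Q) ** x^s.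
  have E1 : (x - x ** Q) ** Q = 0 by rewrite cmulBl -cmulA /Q q_idem// subrr.
  by rewrite [in LHS]cstarB cstarM q_sa// cmulBr [(_ ** (_ ** x^s))]cmulA E1 cmul0x subr0.
by apply: le_trans (nrmM _ _) _; rewrite nrm_cstar.
Qed.


(** Covers the paths z for which e z lies in the cylinder n; empty when n excludes e as first
    edge. *)
Definition shift_cyl e (n : seq E * set V) : seq (seq E * set V) :=
  match n with
  | ([::], B) => if `[< B (src e) >] then [:: ([::], rng e)] else [::]
  | (f :: b, B) => if f == e then [:: (b, B)] else [::]
  end.

Definition shift e N : seq (seq E * set V) := flatten [seq shift_cyl e n | n <- N].

Lemma shift_wf e N : wf_cyls N -> wf_cyls (shift e N).
Proof.
move=> wN m /flattenP[l /mapP[[[|f b] B] nN ->]] /=; have gB := wN _ nN.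
  by case: ifP => // _; rewrite mem_seq1 => /eqP ->; exact: gvert_rng.
by case: ifP => // _; rewrite mem_seq1 => /eqP ->.
Qed.

Lemma shift_size e N k : (forall n, n \in N -> (size n.1 <= k.+1)%N) ->
  forall n, n \in shift e N -> (size n.1 <= k)%N.
Proof.
move=> Nk m /flattenP[l /mapP[[[|f b] B] nN ->]] /=; have := Nk _ nN => /=.
  by case: ifP => // _ _; rewrite mem_seq1 => /eqP ->.
by case: ifP => // _; rewrite mem_seq1 => + /eqP ->.
Qed.

Lemma cyls_shift e N (y : X) : bdom (fglet (e, true)) y -> cyls N y ->
  cyls (shift e N) (bact (fglet (e, false)) y).
Proof.
move=> ye [[[|f b] B] nN yn].
  exists ([::], rng e) => /=.
    apply/flattenP; exists (shift_cyl e ([::], B)); first exact: map_f.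
    rewrite /= asboolT ?mem_head//.
    move: yn; rewrite cylinder_nil /bsrc /=.
    by move: ye => /ldom_pos/ucat1_udrop ->; rewrite usrc_ucat => /(_ _ erefl).
  by rewrite cylinder_nil; have [/ldom_neg] := lactK ye.
have [/ldom_pos yf yb] := (cylinder_cons _ _ _ _).1 yn.
have fe : f = e by move: ye => /ldom_pos; rewrite yf => -[].
exists (b, B) => //; apply/flattenP; exists (shift_cyl e (f :: b, B)); first exact: map_f.
by rewrite /= fe eqxx mem_head.
Qed.

(** The point is s_e^* q_n = q_m s_e^* with m the shifted cylinder, or 0 if there is none. *)
Lemma coproj_shift e N x : wf_cyls N ->
  coproj N (s e ** x ** (s e)^s) = s e ** coproj (shift e N) x ** (s e)^s.
Proof.
elim: N x => [//|n N IH] x wN.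
have wN' : wf_cyls N by move=> k kN; apply: wN; rewrite inE kN orbT.
have gn : gvert n.2 by apply: wN; rewrite mem_head.
have foldl1 l y : coproj (l ++ shift e N) y = coproj (shift e N) (coproj l y).
  by rewrite /coproj foldl_cat.
have sx_ss y z : s e ** y ** (s e)^s - s e ** z ** (s e)^s = s e ** (y - z) ** (s e)^s.
  by rewrite cmulBr cmulBl.
rewrite [shift e (n :: N)]/= foldl1 -IH// [LHS]/=; congr (coproj N _).
case: n gn {wN} => [[|f b] B] /= gB.
  case: asboolP => Be /=; last first.
    by rewrite -!cmulA ss_p_out// !cmulx0 subr0.
  by rewrite -!cmulA ss_p_in// subrr cmulBl -cmulA p_ss subrr cmulx0.
have [->|/eqP fe] := eqVneq f e => /=.
  rewrite -sx_ss; congr (_ - _).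
  rewrite !cmulA -(cmulA _ (s e)^s) (ck_range ck) -(cmulA _ (p (rng e))).
  rewrite p_comm_q//; last exact: gvert_rng.
  by rewrite -!cmulA p_ss.
by rewrite !cmulA -(cmulA _ (s e)^s) s_orth ?(cmul0x, cmulx0) ?subr0//; exact: nesym.
Qed.

Section Cover.
Hypothesis hG : RFUM2 G.

Lemma bact_bsrc e (y : X) : bsrc (rng e) y ->
  bdom (fglet (e, true)) (bact (fglet (e, true)) y) /\
  bact (fglet (e, false)) (bact (fglet (e, true)) y) = y.
Proof. by move=> /ldom_neg /lactK. Qed.


(** Any piece C other than a regular vertex is itself a boundary path (C, C), so one covering
    cylinder contains it and kills p_C. Regular vertices are left to the induction of
    [coproj_cover_p]. *)
Lemma coproj_cover_pieces N B : wf_cyls N ->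
  (forall v, regular v -> bsrc [set v] `<=` cyls N -> coproj N (p [set v]) = 0) ->
  gvert B -> bsrc B `<=` cyls N -> coproj N (p B) = 0.
Proof.
move=> wN Nreg /(gvert_pieces hG); elim=> [|C D pC pD IH].
  by rewrite (ck_p0 ck) coproj0.
have gC := piece_gvert pC; have gD := pieces_gvert pD.
rewrite bsrcU// subUset => -[CN /IH D0].
have C0 : coproj N (p C) = 0.
  case: pC gC CN => [bC gC CN|[v rv ->] _]; last exact: Nreg.
  have XC : Xfin [::] C by split.
  have [n nN [c /= cE cn]] := CN (exist _ (Fin [::] C) XC) (@subset_refl _ C).
  apply: (coproj_in wN nN).
  case: n nN cE cn => -[|f b] B' nN /=; last by case: c.
  rewrite ucat0 => <- CB'; rewrite (ck_pI ck)//; last exact: (wN _ nN).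
  by rewrite (setIidl CB').
rewrite (ck_pU ck)// !coprojD coprojN -(ck_pI ck)// coprojM C0 D0.
by rewrite cmulx0 subr0 addr0.
Qed.

(** Induction on a bound for the lengths of the words in N: expanding p_v over the edges of a
    regular vertex and moving s_e through [coproj] lowers this bound by one. *)
Lemma coproj_cover_p N B : wf_cyls N -> gvert B ->
  bsrc B `<=` cyls N -> coproj N (p B) = 0.
Proof.
move=> wN gB; have [k Nk] : exists k, forall n, n \in N -> (size n.1 <= k)%N.
  elim: N {wN} => [|n N [k Nk]]; first by exists 0%N.
  exists (maxn (size n.1) k) => m; rewrite inE => /orP[/eqP ->|/Nk mk].
    exact: leq_maxl.
  by rewrite leq_max mk orbT.
elim: k N wN B gB Nk => [|k IH] N wN B gB Nk; apply: coproj_cover_pieces => // v rv vN.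
  (* All words in N are empty here, so a boundary path from v is covered by some X_C, and v lies in
     C. *)
  have [y yv] := vertex_point v.
  have [|n nN [c cE cn]] := vN y; first by rewrite /bsrc /= yv.
  have n0 : n.1 = [::] by apply: size0nil; apply/eqP; rewrite -leqn0 Nk.
  apply: (coproj_in wN nN); rewrite n0 /= (ck_pI ck)//; [|exact: gvert1|exact: wN].
  rewrite (setIidl _)//; apply: subset_trans cn.
  by move: cE; rewrite n0 ucat0 => <-; rewrite yv.
rewrite (ck_regular ck rv).
have -> : \sum_(e \in emitted [set v]) s e ** (s e)^s =
          \sum_(e \in emitted [set v]) s e ** p (rng e) ** (s e)^s.
  by apply: eq_fsbigr => e _; rewrite s_p.
rewrite fsbig_finite/=; last by case: rv.
rewrite (big_morph (coproj N) (coprojD N) (coproj0 N)) big_seq big1// => e.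
rewrite in_fset_set; last by case: rv.
move=> /set_mem ve; rewrite coproj_shift// IH ?cmulx0 ?cmul0x//.
- exact: shift_wf.
- exact: gvert_rng.
- exact: shift_size.
- move=> y /bact_bsrc[ye yE]; rewrite -yE; apply: cyls_shift => //.
  apply: vN => u; move: ye => /ldom_pos/ucat1_udrop ->; rewrite usrc_ucat => ->.
  exact: ve.
Qed.

Lemma coproj_cover N b B : wf_cyls N -> gvert B ->
  cylinder b B `<=` cyls N -> coproj N (q b B) = 0.
Proof.
elim: b N B => [|e b IH] N B wN gB.
  by rewrite cylinder_nil; exact: coproj_cover_p.
move=> bN; rewrite /= coproj_shift//.
have [D [gD cD qD]] := q_mul_p b gB (gvert_rng e).
(* Inserting p_(r(e)) cuts the cylinder of (b, B) down to the paths that may follow e, to which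
   alone the covering hypothesis applies. *)
rewrite -[(s e)^s in LHS]p_ss cmulA -(cmulA (s e)).
rewrite -(@coproj_mulr _ _ [::])//; [|exact: shift_wf|exact: gvert_rng].
rewrite [q [::] _]/= qD IH ?cmulx0 ?cmul0x//; first exact: shift_wf.
rewrite -cD => y [yb /bact_bsrc[ye yE]]; rewrite -yE; apply: cyls_shift => //.
by apply: bN; apply/cylinder_cons; rewrite yE.
Qed.

(** * Norms of linear combinations of the projections *)

Local Notation cind b B := (\1_(cylinder b B) : X -> R[i]).

(** A relation and not a map: that the element depends only on the function is a consequence of the
    norm estimate. *)
Inductive span_pair : (X -> R[i]) -> A -> Prop :=
| span_pair0 : span_pair 0 0
| span_pairS (c : R[i]) b B (f : X -> R[i]) d : gvert B -> span_pair f d ->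
    span_pair (c *: cind b B + f) (c *: q b B + d).

Lemma span_pair_comm (f : X -> R[i]) d b B : span_pair f d -> gvert B -> d ** q b B = q b B ** d.
Proof.
move=> sf gB; elim: sf => [|c b' B' f' d' gB' _ IH]; first by rewrite cmul0x cmulx0.
by rewrite cmulDl cmulDr IH cmulZl cmulZr q_comm.
Qed.

(* The pieces of z below q b B and below 1 - q b B are orthogonal. *)
Lemma nrm_split z b B (M : R) : gvert B -> z ** q b B = q b B ** z ->
  nrm (z ** q b B) <= M -> nrm (z - z ** q b B) <= M -> nrm z <= M.
Proof.
move=> gB zq z1 z2; rewrite -(subrK (z ** q b B) z) addrC.
apply: nrmD_orth => //.
- by rewrite zq cstarM q_sa// -cmulA cmulBr cmulA q_idem// subrr cmulx0.
- by rewrite cstarB cstarM q_sa// -cmulA cmulBr cmulA q_idem// subrr cmulx0.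
Qed.

Lemma cind_in (S : set X) y : S y -> (\1_S : X -> R[i]) y = 1.
Proof. by move=> Sy; rewrite indicE mem_set. Qed.

Lemma cind_out (S : set X) y : ~ S y -> (\1_S : X -> R[i]) y = 0.
Proof. by move=> Sy; rewrite indicE memNset. Qed.

Lemma wf_cyls_cons b B N : gvert B -> wf_cyls N -> wf_cyls ((b, B) :: N).
Proof. by move=> gB wN n; rewrite inE => /orP[/eqP ->|/wN]. Qed.

Lemma cyls_cons b B N (y : X) : cyls ((b, B) :: N) y <-> cylinder b B y \/ cyls N y.
Proof.
split=> [[n]|[yb|[n nN yn]]].
- by rewrite inE => /orP[/eqP ->|nN yn]; [left|right; exists n].
- by exists (b, B) => //; rewrite mem_head.
- by exists n => //; rewrite inE nN orbT.
Qed.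

Lemma coproj_cons b B N x : wf_cyls N -> gvert B ->
  coproj N x - coproj N x ** q b B = coproj ((b, B) :: N) x.
Proof. by move=> wN gB; rewrite /= coprojD coprojN coproj_mulr. Qed.

Lemma coproj_comm N z b B : wf_cyls N -> gvert B -> z ** q b B = q b B ** z ->
  coproj N z ** q b B = q b B ** coproj N z.
Proof. by move=> wN gB zq; rewrite -coproj_mulr// zq coprojM. Qed.

(** Splits along the cylinder (b1, B1) of each term. The part inside adds the coefficient to [c0]
    and shrinks (b, B); the part outside puts (b1, B1) into N. So (b, B) minus N is the current
    atom, and [c0] collects the terms already known to be constant on it. *)
Lemma span_pair_nrm_on (f : X -> R[i]) d N b B (c0 : R[i]) (M : R) : span_pair f d ->
  wf_cyls N -> gvert B -> 0 <= M ->
  (forall y, cylinder b B y -> ~ cyls N y -> nrm (c0 + f y) <= M) ->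
  nrm (coproj N (c0 *: q b B + d ** q b B)) <= M.
Proof.
move=> sf; elim: sf N b B c0 => [|c b1 B1 f' d' gB1 sf IH] N b B c0 wN gB M0 H.
  rewrite cmul0x addr0 coprojZ nrmZ.
  (* On a nonempty atom [c0] is a value of the function; an empty atom is covered by N, and
     [coproj_cover] makes its projection vanish. *)
  have [[y [yb yN]]|ny] := pselect (exists y, cylinder b B y /\ ~ cyls N y).
    have := H y yb yN; rewrite addr0 => c0M.
    have := le_trans (nrm_coq (q b B) wN) (nrm_q b gB).
    have := nrm_ge0 (coproj N (q b B)); have := nrm_ge0 c0; nra.
  rewrite coproj_cover ?nrm0 ?mulr0// => y yb; apply: contrapT => yN.
  by apply: ny; exists y.
set x := c0 *: _ + _; have xq : x ** q b1 B1 = q b1 B1 ** x.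
  have dq : (c *: q b1 B1 + d') ** q b1 B1 = q b1 B1 ** (c *: q b1 B1 + d').
    by rewrite cmulDl cmulDr cmulZl cmulZr (span_pair_comm b1 sf).
  by rewrite /x cmulDl cmulDr cmulZl cmulZr q_comm// -(cmulA _ (q b B)) (q_comm b)// !cmulA dq.
apply: (@nrm_split _ b1 B1) => //; first exact: coproj_comm.
  rewrite -coproj_mulr//.
  have [b2 [B2 [gB2 cB2 qB2]]] := q_mulP b b1 gB gB1.
  have -> : x ** q b1 B1 = (c0 + c) *: q b2 B2 + d' ** q b2 B2.
    rewrite /x -qB2 !cmulDl !cmulZl scalerDl -addrA; congr (_ + _).
    by rewrite -!cmulA [q b1 B1 ** (_ ** _)]cmulA (q_comm b1 b)// -cmulA q_idem.
  apply: IH => // y; rewrite -cB2 => -[yb yb1] yN.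
  by have := H y yb yN; rewrite !fctE cind_in// [_ *: _]mulr1 addrA.
rewrite coproj_cons//.
have -> : coproj ((b1, B1) :: N) x = coproj ((b1, B1) :: N) (c0 *: q b B + d' ** q b B).
  rewrite /x cmulDl addrCA coprojD cmulZl coprojZ (_ : coproj _ _ = 0) ?scaler0 ?add0r//.
  apply: (@coproj_in _ (b1, B1)); [exact: wf_cyls_cons|exact: mem_head|].
  by rewrite /= -cmulA (q_comm b b1)// cmulA q_idem.
apply: IH => //; first exact: wf_cyls_cons.
move=> y yb /cyls_cons/not_orP[yb1 yN].
by have := H y yb yN; rewrite !fctE cind_out// scaler0 add0r.
Qed.

(** Outside all cylinders met so far there is no projection to carry a constant. This induction
    deals with that region and hands over to [span_pair_nrm_on] inside each new cylinder. *)
Lemma span_pair_nrm (f : X -> R[i]) d (M : R) : span_pair f d -> 0 <= M ->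
  (forall y, nrm (f y) <= M) -> nrm d <= M.
Proof.
move=> sf M0 H.
suff K N : wf_cyls N -> (forall y, ~ cyls N y -> nrm (f y) <= M) -> nrm (coproj N d) <= M.
  by apply: (K [::]) => // y _.
elim: sf N {H} => [|c b1 B1 f' d' gB1 sf IH] N wN H; first by rewrite coproj0 nrm0.
apply: (@nrm_split _ b1 B1) => //.
- apply: coproj_comm => //.
  by rewrite cmulDl cmulDr (span_pair_comm b1 sf)// cmulZl cmulZr.
- rewrite -coproj_mulr// cmulDl cmulZl q_idem//; apply: (span_pair_nrm_on sf) => // y yb yN.
  by have := H y yN; rewrite !fctE cind_in// [_ *: _]mulr1.
rewrite coproj_cons// coprojD coprojZ (_ : coproj _ (q _ _) = 0) ?scaler0 ?add0r; last first.
  apply: (@coproj_in _ (b1, B1)); [exact: wf_cyls_cons|exact: mem_head|exact: q_idem].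
apply: IH; first exact: wf_cyls_cons.
move=> y /cyls_cons/not_orP[yb1 yN].
by have := H y yN; rewrite !fctE cind_out// scaler0 add0r.
Qed.

End Cover.
End CuntzKrieger.

(** * Continuous functions vanishing at infinity *)

Section C0Topology.
Variables (R : realType) (T : topologicalType).
Implicit Types f g : T -> R[i].

Lemma continuous_nrmP f : continuous (f : T -> R[i]^o) <->
  forall x (e : R), 0 < e -> \forall z \near x, nrm (f x - f z) < e.
Proof.
split=> [cf x e e0|H x].
  have e0' : (0 : R[i]) < e%:C by rewrite ltcR.
  have /cvgrPdist_lt/(_ _ e0') := cf x.
  by apply: filterS => z; rewrite (nrmE (f x - f z)) ltcR.
apply/cvgrPdist_lt => e e0.
have eE : e = (complex.Re e)%:C by rewrite RRe_real// gtr0_real.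
have e1 : 0 < complex.Re e by rewrite -ltcR -eE.
by apply: filterS (H x _ e1) => z; rewrite (nrmE (f x - f z)) eE ltcR.
Qed.

Lemma C0_of_dom f (U : set T) : continuous (f : T -> R[i]^o) ->
  (forall e : R, 0 < e -> exists2 K, compact K & forall x, e <= nrm (f x) -> K x) ->
  (forall x, ~ U x -> f x = 0) -> C0 U f.
Proof.
move=> cf cK f0; split => // eps eps0.
have eE : eps = (complex.Re eps)%:C by rewrite RRe_real// gtr0_real.
have e0 : 0 < complex.Re eps by rewrite -ltcR -eE.
have [K cptK fK] := cK _ e0.
apply: (subclosed_compact _ cptK); last by move=> x; rewrite /= eE nrmE lecR; exact: fK.
rewrite -[X in closed X]setCK; apply: open_closedC; rewrite openE => x.
rewrite /= eE nrmE lecR => /negP; rewrite -ltNge => fx.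
have := (continuous_nrmP f).1 cf x (complex.Re eps - nrm (f x)).
rewrite subr_gt0 => /(_ fx); apply: filterS => z; rewrite /= nrmE lecR => H.
apply/negP; rewrite -ltNge.
by have := nrm_le_dist (f z) (f x); rewrite nrm_distC; lra.
Qed.

Lemma C0_compact f (U : set T) (e : R) : C0 U f -> 0 < e ->
  compact [set x | e <= nrm (f x)].
Proof.
move=> [_ cf _] e0; have e0' : (0 : R[i]) < e%:C by rewrite ltcR.
have := cf _ e0'; congr compact; apply/seteqP; split=> x /=;
by rewrite nrmE lecR.
Qed.

(** Local-to-global principle for an ideal of sets: if K were not in the ideal, the sets S with K
    [\] S in it would form a proper filter, and a cluster point in K contradicts the local
    hypothesis. *)
Lemma compact_ideal (K : set T) (P : set T -> Prop) : compact K -> P set0 ->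
  (forall U1 U2, P U1 -> P U2 -> P (U1 `|` U2)) ->
  (forall U1 U2, U1 `<=` U2 -> P U2 -> P U1) ->
  (forall x, K x -> exists2 W, nbhs x W & P W) -> P K.
Proof.
move=> cK P0 PU Psub PW; apply: contrapT => nPK.
pose F : set_system T := [set S | P (K `\` S)].
have FF : ProperFilter F.
  split; first by rewrite /F /= setD0.
  split; first by rewrite /F /= setDT.
    by move=> S1 S2; rewrite /F /= setDIr; exact: PU.
  by move=> S1 S2 S12; apply: Psub => x [Kx nS]; split => // /S12.
have [|x [Kx clx]] := cK F FF; first by rewrite /F /= setDv.
have [W Wx PWx] := PW x Kx.
have FW : F (~` W) by apply: Psub PWx => y [_ /contrapT].
by have [y [nWy Wy]] := clx _ _ FW Wx.
Qed.

Lemma C0_setT f (U : set T) : C0 U f <-> C0 setT f /\ forall x, ~ U x -> f x = 0.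
Proof.
split=> [[cf kf f0]|[[cf kf _] f0]]; last by split.
by split => //; split => // x; case.
Qed.

Lemma C0_setTW f (U : set T) : C0 U f -> C0 setT f.
Proof. by move=> /C0_setT[]. Qed.

Lemma C00 (U : set T) : C0 U (0 : T -> R[i]).
Proof.
apply: C0_of_dom; [by move=> x; exact: cvg_cst| |by []].
move=> e e0; exists set0; first exact: compact0.
by move=> x; rewrite nrm0 leNgt e0.
Qed.

Lemma C0D f g (U : set T) : C0 U f -> C0 U g -> C0 U (f + g).
Proof.
move=> Cf Cg; have [cf _ f0] := Cf; have [cg _ g0] := Cg.
apply: C0_of_dom; first by move=> x; apply: cvgD; [exact: cf|exact: cg].
  move=> e e0; have e2 : 0 < e / 2 by rewrite divr_gt0.
  exists ([set x | e / 2 <= nrm (f x)] `|` [set x | e / 2 <= nrm (g x)]).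
    by apply: compactU; [exact: C0_compact Cf e2|exact: C0_compact Cg e2].
  move=> x efg; apply: contrapT => /not_orP[/= /negP fx /negP gx].
  by have := nrmD (f x) (g x); move: fx gx; rewrite -!ltNge; move: efg; rewrite fctE; lra.
by move=> x Ux; rewrite fctE f0// g0// addr0.
Qed.

Lemma C0M f g (U : set T) : C0 U f -> C0 setT g -> C0 U (f * g).
Proof.
move=> Cf Cg; have [cf _ f0] := Cf; have [cg _ _] := Cg.
apply: C0_of_dom; first by move=> x; apply: cvgM; [exact: cf|exact: cg].
  move=> e e0; exists ([set x | e <= nrm (f x)] `|` [set x | 1 <= nrm (g x)]).
    by apply: compactU; [exact: C0_compact Cf e0|exact: C0_compact Cg ltr01].
  move=> x efg; apply: contrapT => /not_orP[/= /negP fx /negP gx].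
  move: efg fx gx; rewrite -!ltNge fctE nrmCM.
  by have := nrm_ge0 (f x); have := nrm_ge0 (g x); nra.
by move=> x Ux; rewrite fctE f0// mul0r.
Qed.

Lemma C0Z (k : R[i]) f (U : set T) : C0 U f -> C0 U (k *: f).
Proof.
move=> Cf; have [cf _ f0] := Cf.
apply: C0_of_dom; first by move=> x; apply: cvgM; [exact: cvg_cst|exact: cf].
  have k0 : 0 < nrm k + 1 by rewrite ltr_wpDl ?nrm_ge0.
  move=> e e0; have ek : 0 < e / (nrm k + 1) by rewrite divr_gt0.
  exists [set x | e / (nrm k + 1) <= nrm (f x)]; first exact: C0_compact Cf ek.
  move=> x; rewrite /= fctE [_ *: _]/(k * _) nrmCM ler_pdivrMr//.
  by have := nrm_ge0 (f x); nra.
by move=> x Ux; rewrite fctE f0// scaler0.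
Qed.

Definition fconj f : T -> R[i] := fun x => Num.conj (f x).

Lemma C0_conj f (U : set T) : C0 U f -> C0 U (fconj f).
Proof.
move=> Cf; have [cf _ f0] := Cf; apply: C0_of_dom.
- apply/continuous_nrmP => x e e0.
  by apply: filterS ((continuous_nrmP f).1 cf x e e0) => z; rewrite /fconj -rmorphB nrmC_conj.
- move=> e e0; exists [set x | e <= nrm (f x)]; first exact: C0_compact Cf e0.
  by move=> x; rewrite /fconj nrmC_conj.
- by move=> x /f0 fx; rewrite /fconj fx conjC0.
Qed.

Lemma C0_indic (K : set T) : open K -> closed K -> compact K ->
  C0 K (\1_K : T -> R[i]).
Proof.
move=> oK cK cptK; apply: C0_of_dom; last by move=> x Kx; rewrite indicE memNset.
  apply/continuous_nrmP => x e e0; have [Kx|Kx] := pselect (K x).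
    have : nbhs x K by exact: open_nbhs_nbhs.
    by apply: filterS => z Kz; rewrite !indicE !mem_set// subrr nrm0.
  have : nbhs x (~` K) by apply: open_nbhs_nbhs; split => //; exact: closed_openC.
  by apply: filterS => z Kz; rewrite !indicE !memNset// subrr nrm0.
move=> e e0; exists K => // x; apply: contraPP => Kx.
by rewrite indicE memNset// nrm0 leNgt e0.
Qed.

End C0Topology.

(** * Extension from cylinders to continuous functions *)

Section SpanPairs.
Variables (R : realType) (G : ultragraph) (A : cstarAlgType R).
Variables (s : edge G -> A) (p : set (vert G) -> A).
Hypothesis ck : ck_family s p.
Hypothesis hG : RFUM2 G.
Local Notation V := (vert G).
Local Notation E := (edge G).
Local Notation X := (bspace G).
Implicit Types (B C D : set V) (b : seq E) (e : E) (d : A) (l : E * bool).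
Implicit Types f g : X -> R[i].
Local Notation "x ^s" := (cstar x) (at level 2, format "x ^s").
Local Notation pact := (pact (@bdom G) (@bact G)).
Local Notation q := (cyl_proj s p).
Local Notation span_pair := (span_pair s p).
Local Notation cind b B := (\1_(cylinder b B) : X -> R[i]).

Definition lets l : A := if l.2 then s l.1 else (s l.1)^s.

Lemma lets_linv l : lets (linv l) = (lets l)^s.
Proof. by case: l => e []; rewrite /lets /= ?cstarK. Qed.

Lemma span_pair_gen b B : gvert B -> span_pair (cind b B) (q b B).
Proof.
move=> gB; have := span_pairS 1 b gB (span_pair0 s p).
by rewrite !scale1r !addr0.
Qed.

Lemma span_pairD f d g c : span_pair f d -> span_pair g c -> span_pair (f + g) (d + c).
Proof.
move=> sf sg; elim: sf => [|k b B f' d' gB _ IH]; first by rewrite !add0r.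
by rewrite -!addrA; exact: span_pairS.
Qed.

Lemma span_pairZ (k : R[i]) f d : span_pair f d -> span_pair (k *: f) (k *: d).
Proof.
elim=> [|k' b B f' d' gB _ IH]; first by rewrite !scaler0; exact: span_pair0.
by rewrite !scalerDr !scalerA; exact: span_pairS.
Qed.

Lemma span_pairB f d g c : span_pair f d -> span_pair g c -> span_pair (f - g) (d - c).
Proof.
by move=> sf sg; rewrite -(scaleN1r g) -(scaleN1r c); apply: span_pairD => //; exact: span_pairZ.
Qed.

Lemma cindI (S1 S2 : set X) : (\1_S1 : X -> R[i]) * \1_S2 = \1_(S1 `&` S2).
Proof. by apply/funext => y; rewrite fctE !indicE in_setI -natrM mulnb. Qed.

Lemma fun_mulZr (k : R[i]) f g : f * (k *: g : X -> R[i]) = k *: (f * g : X -> R[i]).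
Proof. by apply/funext => y; rewrite !fctE; exact: mulrCA. Qed.

Lemma fun_mulZl (k : R[i]) f g : (k *: f : X -> R[i]) * g = k *: (f * g : X -> R[i]).
Proof. by apply/funext => y; rewrite !fctE; exact/esym/mulrA. Qed.

Lemma span_pair_mul_gen b B f d : gvert B -> span_pair f d ->
  span_pair (cind b B * f) (q b B ** d).
Proof.
move=> gB; elim=> [|k b' B' f' d' gB' _ IH].
  by rewrite mulr0 cmulx0; exact: span_pair0.
have [b2 [B2 [gB2 c2 q2]]] := q_mulP ck b b' gB gB'.
by rewrite mulrDr cmulDr cmulZr q2 fun_mulZr cindI c2; exact: span_pairS.
Qed.

Lemma span_pairM f d g c : span_pair f d -> span_pair g c -> span_pair (f * g) (d ** c).
Proof.
move=> sf sg; elim: sf => [|k b B f' d' gB _ IH].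
  by rewrite mul0r cmul0x; exact: span_pair0.
rewrite mulrDl cmulDl cmulZl fun_mulZl; apply: span_pairD => //.
by apply: span_pairZ; exact: span_pair_mul_gen.
Qed.

Lemma span_pair_star f d : span_pair f d -> span_pair (fconj f) d^s.
Proof.
elim=> [|k b B f' d' gB _ IH].
  rewrite cstar0 (_ : fconj 0 = 0); first exact: span_pair0.
  by apply/funext => y; rewrite /fconj rmorph0.
rewrite cstarD cstarZ (q_sa ck)// (_ : fconj _ = Num.conj k *: cind b B + fconj f').
  exact: span_pairS.
apply/funext => y; rewrite /fconj !fctE rmorphD; congr (_ + _).
by rewrite [LHS]rmorphM indicE rmorph_nat.
Qed.

(** A positive letter prepends its edge to b. A negative letter removes it from b; from X_B it leads
    to X_(r(e)) if s(e) lies in B, and to the empty set otherwise. *)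
Lemma pact_cind l b B : gvert B -> exists b' B', [/\ gvert B',
  pact (fglet l) (cind b B) = cind b' B' & lets l ** q b B ** (lets l)^s = q b' B'].
Proof.
move=> gB.
have pactS (S1 S2 : set X) :
    (forall y, S2 y <-> bdom (fglet l) y /\ S1 (bact (fglet (linv l)) y)) ->
    pact (fglet l) (\1_S1 : X -> R[i]) = \1_S2.
  move=> H; apply/funext => y; have [ly|ly] := pselect (bdom (fglet l) y).
    rewrite pactE// fgletV; have [S1y|S1y] := pselect (S1 (bact (fglet (linv l)) y)).
      by rewrite !cind_in//; apply/H.
    by rewrite !cind_out// => /H[].
  by rewrite pact_out// cind_out// => /H[].
case: l pactS => e [] pactS.
  exists (e :: b), B; split => //; apply: pactS => y; exact: cylinder_cons.
rewrite /lets /= cstarK.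
case: b => [|f b].
  have [Be|Be] := pselect (B (src e)).
    exists [::], (rng e); split; first exact: gvert_rng.
      apply: pactS => y; rewrite !cylinder_nil (propext (ldom_neg _ _)).
      split=> [yr|[]//]; split => //.
      by rewrite /bsrc /= lact_pos// usrc_ucat => _ ->.
    by rewrite /= (ss_p_in ck)// (ck_range ck).
  exists [::], set0; split; first exact: gvert0.
    apply: pactS => y; rewrite !cylinder_nil bsrc0 (propext (ldom_neg _ _)).
    split=> [//|[yr]]; rewrite /bsrc /= lact_pos// usrc_ucat => H; apply: Be.
    exact: H.
  by rewrite /= (ss_p_out ck)// cmul0x (ck_p0 ck).
have [fe|/eqP fe] := eqVneq f e; last first.
  exists [::], set0; split; first exact: gvert0.
    apply: pactS => y; rewrite cylinder_nil bsrc0 (propext (ldom_neg _ _)).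
    split=> [//|[yr /cylinder_cons[/ldom_pos]]]; rewrite lact_pos// ufirst_ucat.
    by move=> [/esym].
  by rewrite /= !cmulA (s_orth ck) ?cmul0x ?(ck_p0 ck)//; exact: nesym.
rewrite {}fe; have [D [gD cD qD]] := q_mul_p ck b gB (gvert_rng e).
exists b, D; split => //.
  apply: pactS => y; rewrite -cD (propext (cylinder_cons _ _ _ _)); split.
    by move=> [yb yr]; have [y1 y2] := bact_bsrc yr; rewrite y2; split => //; exact/ldom_neg.
  by move=> [/ldom_neg yr [y1]]; have [_ y2] := bact_bsrc yr; rewrite y2.
rewrite /= !cmulA (ck_range ck) -!cmulA (ck_range ck) cmulA (p_comm_q ck)//; last exact: gvert_rng.
rewrite -cmulA (ck_pI ck) ?setIid//; exact: gvert_rng.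
Qed.

Lemma span_pair_pact l f d : span_pair f d ->
  span_pair (pact (fglet l) f) (lets l ** d ** (lets l)^s).
Proof.
elim=> [|k b B f' d' gB _ IH].
  by rewrite pact0 cmulx0 cmul0x; exact: span_pair0.
have [b' [B' [gB' E1 E2]]] := pact_cind l b gB.
rewrite pactD pactZ cmulDr cmulDl cmulZr cmulZl E1 E2.
exact: span_pairS.
Qed.

Lemma span_pair_bounded f d : span_pair f d ->
  exists2 M : R, 0 <= M & forall y, nrm (f y) <= M.
Proof.
elim=> [|k b B f' d' gB _ [M M0 H]]; first by exists 0 => // y; rewrite nrm0.
exists (nrm k + M); first by rewrite addr_ge0 ?nrm_ge0.
move=> y; rewrite !fctE; apply: le_trans (nrmD _ _) _; apply: lerD => //.
have [yb|yb] := pselect (cylinder b B y); first by rewrite cind_in// [_ *: _]mulr1.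
by rewrite cind_out// scaler0 nrm0 nrm_ge0.
Qed.

Lemma span_pair_near f d (y : X) : span_pair f d -> \forall z \near y, f z = f y.
Proof.
elim=> [|k b B f' d' gB _ IH]; first by apply: filterE.
have near1 : \forall z \near y, cind b B z = cind b B y.
  have [yb|yb] := pselect (cylinder b B y).
    have : nbhs y (cylinder b B : set X).
      by apply: open_nbhs_nbhs; split => //; exact: cylinder_open.
    by apply: filterS => z zb; rewrite !cind_in.
  have : nbhs y (~` cylinder b B : set X).
    by apply: open_nbhs_nbhs; split => //; exact/closed_openC/cylinder_closed.
  by apply: filterS => z zb; rewrite !cind_out.
by apply: filterS2 IH near1 => z E1 E2; rewrite !fctE E1 E2.
Qed.

Lemma span_pair_supp f d : span_pair f d ->
  exists2 K : set X, compact K & forall y, f y != 0 -> K y.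
Proof.
elim=> [|k b B f' d' gB _ [K cK KP]].
  by exists set0; [exact: compact0|move=> y; rewrite eqxx].
exists (cylinder b B `|` K); first by apply: compactU => //; exact: cylinder_compact.
move=> y; rewrite !fctE; have [yb _|yb] := pselect (cylinder b B y); first by left.
by rewrite cind_out// scaler0 add0r; right; exact: KP.
Qed.

Definition approx f := forall e : R, 0 < e ->
  exists g c, span_pair g c /\ forall y, nrm (f y - g y) <= e.

Lemma approx_C0 f : approx f -> C0 setT f.
Proof.
move=> af; apply: C0_of_dom; last by move=> y; case.
  apply/continuous_nrmP => y e e0.
  have e3 : 0 < e / 3 by rewrite divr_gt0.
  have [g [c [sg fg]]] := af _ e3.
  apply: filterS (span_pair_near y sg) => z gz.
  have := nrm_dist (f y) (g y) (f z); rewrite -{2}gz (nrm_distC (g z)).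
  by have := fg y; have := fg z; lra.
move=> e e0; have e2 : 0 < e / 2 by rewrite divr_gt0.
have [g [c [sg fg]]] := af _ e2; have [K cK KP] := span_pair_supp sg.
exists K => // y fy; apply: KP; apply/eqP => gy0.
by have := fg y; rewrite gy0 subr0; lra.
Qed.

(** These sets form a ring containing the cylinders, and by [simple_nbhd] they are fine enough to
    approximate continuous functions. *)
Definition simple_set (S : set X) : Prop := exists d, span_pair (\1_S) d.

Lemma simple_setI (S1 S2 : set X) : simple_set S1 -> simple_set S2 ->
  simple_set (S1 `&` S2).
Proof. by move=> [d1 s1] [d2 s2]; exists (d1 ** d2); rewrite -cindI; exact: span_pairM. Qed.

Lemma simple_setD (S1 S2 : set X) : simple_set S1 -> simple_set S2 ->
  simple_set (S1 `\` S2).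
Proof.
move=> [d1 s1] [d2 s2]; exists (d1 - d1 ** d2).
rewrite (_ : \1_(_ `\` _) = \1_S1 - \1_S1 * \1_S2 :> (X -> R[i])).
  by apply: span_pairB => //; exact: span_pairM.
apply/funext => y; rewrite !fctE.
have [y1|y1] := pselect (S1 y); last first.
  by rewrite !(cind_out _ y1) mul0r subr0 cind_out// => -[].
rewrite (cind_in _ y1) mul1r; have [y2|y2] := pselect (S2 y).
  by rewrite (cind_in _ y2) subrr cind_out// => -[].
by rewrite (cind_out _ y2) subr0 cind_in.
Qed.

Lemma simple_set_cyl b B : gvert B -> simple_set (cylinder b B).
Proof. by move=> gB; exists (q b B); exact: span_pair_gen. Qed.

Lemma simple_cyls (S : set X) N : simple_set S -> wf_cyls N -> simple_set (S `\` cyls N).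
Proof.
elim: N S => [|n N IH] S sS wN.
  by rewrite (_ : cyls [::] = set0) ?setD0//; apply/seteqP; split=> // y [].
have -> : cyls (n :: N) = cylinder n.1 n.2 `|` cyls N.
  apply/seteqP; split=> y; first by move=> [m]; rewrite inE => /orP[/eqP ->|mN ym]; [left|right; exists m].
  move=> [yn|[m mN ym]]; first by exists n => //; rewrite mem_head.
  by exists m => //; rewrite inE mN orbT.
rewrite -setDDl; apply: IH.
  by apply: simple_setD => //; apply: simple_set_cyl; apply: wN; rewrite mem_head.
by move=> m mN; apply: wN; rewrite inE mN orbT.
Qed.


Lemma simple_setU (S1 S2 : set X) : simple_set S1 -> simple_set S2 ->
  simple_set (S1 `|` S2).
Proof.
move=> sS1 sS2; have [d2 s2] := simple_setD sS2 sS1; have [d1 s1] := sS1.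
exists (d1 + d2); rewrite (_ : \1_(_ `|` _) = \1_S1 + \1_(S2 `\` S1) :> (X -> R[i])).
  exact: span_pairD.
apply/funext => y; rewrite !fctE; have [y1|y1] := pselect (S1 y).
  by rewrite (cind_in _ y1) cind_in ?cind_out ?addr0//; [case|left].
rewrite (cind_out _ y1) add0r; have [y2|y2] := pselect (S2 y).
  by rewrite !cind_in//; right.
by rewrite !cind_out// => -[].
Qed.

Lemma cyls_closed (N : seq (seq E * set V)) : wf_cyls N -> closed (cyls N : set X).
Proof.
move=> wN; rewrite (_ : cyls N = \bigcup_(n in [set` N]) cylinder n.1 n.2).
  by apply: closed_bigcup; [exact: finite_seq|move=> n /wN; exact: cylinder_closed].
by apply/seteqP; split=> y [n nN yn]; exists n.
Qed.

Lemma simple_nbhd (y : X) W : nbhs y W ->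
  exists S, [/\ simple_set S, open S, S y & S `<=` W].
Proof.
move=> /nbhs_basis[F [bF yF FW]].
suff [S [sS oS yS SF]] : exists S, [/\ simple_set S, open S, S y &
    forall U, U \in enum_fset F -> S `<=` U].
  exists S; split => //; apply: subset_trans FW => z Sz U /= UF.
  exact: (SF U UF z Sz).
have {}bF U : U \in enum_fset F -> bspace_basis U by exact: bF.
have {}yF U : U \in enum_fset F -> U y by exact: yF.
elim: (enum_fset F) bF yF => {F FW W} [|U l IH] bF yF.
  (* The empty intersection of subbasic sets is the whole space, whose indicator need not lie in the
     span; a cylinder through y replaces it. *)
  case: (ufirstP (sval y)) => [[e ye]|[C yC]].
    exists (cylinder [:: e] (rng e)); split => //.
    - by apply: simple_set_cyl; exact: gvert_rng.
    - by apply: cylinder_open; exact: gvert_rng.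
    - rewrite -[rng e]/(prng [:: e]) cylinder_prng; exists (udrop 1 (sval y)) => //.
      exact: ucat1_udrop.
  have gC : gvert C by have := svalP y; rewrite yC => -[[]].
  exists (cylinder [::] C); split => //; [exact: simple_set_cyl|exact: cylinder_open|].
  by rewrite cylinder_nil /bsrc /= yC.
have [||S [sS oS yS Sl]] := IH.
- by move=> U' U'l; apply: bF; rewrite inE U'l orbT.
- by move=> U' U'l; apply: yF; rewrite inE U'l orbT.
have [a [C [N [gC wN ya yN NU]]]] := std_nbhd (bF _ (mem_head _ _)) (yF _ (mem_head _ _)).
exists (S `&` (cylinder a C `\` cyls N)); split => //.
- by apply: simple_setI => //; apply: simple_cyls => //; exact: simple_set_cyl.
- apply: openI => //; apply: openI; first exact: cylinder_open.
  exact/closed_openC/cyls_closed.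
- by move=> U'; rewrite inE => /orP[/eqP -> z [_ /NU]|/Sl U'l z [/U'l]].
Qed.

Lemma C0_approx f : C0 setT f -> approx f.
Proof.
move=> Cf e e0; have [cf _ _] := Cf.
have /choice[S SP] : forall y, exists S, [/\ simple_set S, open S, S y &
    forall z, S z -> nrm (f z - f y) <= e].
  move=> y; have [S [sS oS yS SH]] := simple_nbhd ((continuous_nrmP f).1 cf y e e0).
  by exists S; split => // z /SH /= H; rewrite nrm_distC ltW.
(* The approximant is good on a simple set and zero off it, so that two of them can be glued. *)
pose P (U : set X) := exists g c U', [/\ span_pair g c, simple_set U', U `<=` U',
  forall z, ~ U' z -> g z = 0 & forall z, U' z -> nrm (f z - g z) <= e].
have [] : P [set y | e <= nrm (f y)].
  apply: compact_ideal (C0_compact Cf e0) _ _ _ _.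
  - exists 0, 0, set0; split => //; first exact: span_pair0.
    by exists 0; rewrite indic0; exact: span_pair0.
  - move=> U1 U2 [g1 [c1 [V1 [sg1 [d1 sV1] UV1 g10 fg1]]]].
    move=> [g2 [c2 [V2 [sg2 sV2 UV2 g20 fg2]]]].
    have [d sd] : simple_set (V2 `\` V1) by apply: simple_setD => //; exists d1.
    (* The indicator removes the second approximant from [V1], where the first is already good. *)
    exists (g1 + g2 * \1_(V2 `\` V1)), (c1 + c2 ** d), (V1 `|` V2); split.
    + by apply: span_pairD => //; exact: span_pairM.
    + by apply: simple_setU => //; exists d1.
    + exact: setUSS.
    + move=> z /not_orP[Vz1 Vz2].
      by rewrite !fctE g10// g20// mul0r addr0.
    + move=> z; rewrite !fctE; have [Uz _|Uz] := pselect (V1 z).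
        by rewrite cind_out ?mulr0 ?addr0; [exact: fg1|case].
      by case=> // Sz; rewrite g10// cind_in// mulr1 add0r; exact: fg2.
  - move=> U1 U2 U12 [g [c [U' [? ? UU' ? ?]]]]; exists g, c, U'; split => //.
    exact: subset_trans UU'.
  - move=> y _; have [sSy oSy Sy Sf] := SP y; have [d sd] := sSy.
    exists (S y); first exact: open_nbhs_nbhs.
    exists (f y *: (\1_(S y) : X -> R[i])), (f y *: d), (S y); split => //.
    + exact: span_pairZ.
    + by move=> z Sz; rewrite fctE cind_out// scaler0.
    + by move=> z Sz; rewrite fctE cind_in// [_ *: _]mulr1; exact: Sf.
move=> g [c [U [sg sU KU gU fU]]]; exists g, c; split => // z.
have [/fU//|Uz] := pselect (U z).
by rewrite gU// subr0 leNgt; apply/negP => /ltW /KU.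
Qed.

(* The closure of the graph of [1_(b, B) |-> q b B]. *)
Definition diag_rel f d := forall e : R, 0 < e -> exists g c, [/\ span_pair g c,
  forall y, nrm (f y - g y) <= e & nrm (d - c) <= e].

Lemma span_pair_diag_rel f d : span_pair f d -> diag_rel f d.
Proof.
by move=> sf e e0; exists f, d; split => // [y|]; rewrite subrr nrm0 ltW.
Qed.

Lemma diag_rel_approx f d : diag_rel f d -> approx f.
Proof. by move=> Gf e /Gf[g [c [? ? _]]]; exists g, c. Qed.

Lemma diag_rel_C0 f d : diag_rel f d -> C0 setT f.
Proof. by move=> /diag_rel_approx /approx_C0. Qed.

Lemma diag_rel_nrm f d (M : R) : diag_rel f d -> 0 <= M -> (forall y, nrm (f y) <= M) ->
  nrm d <= M.
Proof.
move=> Gf M0 fM; apply/ler_addgt0Pr => e e0.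
have e2 : 0 < e / 2 by rewrite divr_gt0.
have [g [c [sg fg dc]]] := Gf _ e2.
have : nrm c <= M + e / 2.
  apply: (span_pair_nrm ck hG sg) => [|y]; first by rewrite addr_ge0// ltW.
  by have := nrm_le_dist (g y) (f y); rewrite nrm_distC; have := fM y; have := fg y; lra.
by have := nrm_le_dist d c; lra.
Qed.

Lemma diag_relD f d g c : diag_rel f d -> diag_rel g c -> diag_rel (f + g) (d + c).
Proof.
move=> Gf Gg e e0; have e2 : 0 < e / 2 by rewrite divr_gt0.
have [f' [d' [sf ff' dd']]] := Gf _ e2; have [g' [c' [sg gg' cc']]] := Gg _ e2.
exists (f' + g'), (d' + c'); split; first exact: span_pairD.
  move=> y; rewrite !fctE opprD addrACA; apply: le_trans (nrmD _ _) _.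
  by have := ff' y; have := gg' y; lra.
by rewrite opprD addrACA; apply: le_trans (nrmD _ _) _; lra.
Qed.

Lemma diag_relZ (k : R[i]) f d : diag_rel f d -> diag_rel (k *: f) (k *: d).
Proof.
move=> Gf e e0; have k0 : 0 < nrm k + 1 by rewrite ltr_wpDl ?nrm_ge0.
have e2 : 0 < e / (nrm k + 1) by rewrite divr_gt0.
have [f' [d' [sf ff' dd']]] := Gf _ e2.
have ke (t : R) : 0 <= t -> t <= e / (nrm k + 1) -> nrm k * t <= e.
  move=> t0; rewrite ler_pdivlMr//; have := nrm_ge0 k; nra.
exists (k *: f'), (k *: d'); split; first exact: span_pairZ.
  move=> y; rewrite !fctE -scalerBr [_ *: _]/(k * _) nrmCM.
  by apply: ke (ff' y); exact: nrm_ge0.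
by rewrite -scalerBr nrmZ; apply: ke dd'; exact: nrm_ge0.
Qed.

Lemma diag_relB f d g c : diag_rel f d -> diag_rel g c -> diag_rel (f - g) (d - c).
Proof.
move=> Gf Gg; rewrite -(scaleN1r g) -(scaleN1r c).
by apply: diag_relD => //; exact: diag_relZ.
Qed.

(** The difference is related to the zero function, so contractivity makes it vanish: the closed
    graph is a function. *)
Lemma diag_rel_uniq f d c : diag_rel f d -> diag_rel f c -> d = c.
Proof.
move=> Gd Gc; apply/eqP; rewrite -subr_eq0; apply/eqP/nrm_eq0/eqP.
rewrite eq_le nrm_ge0 andbT; apply: (diag_rel_nrm (diag_relB Gd Gc)) => // y.
by rewrite subrr nrm0.
Qed.

Lemma diag_rel_star f d : diag_rel f d -> diag_rel (fconj f) d^s.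
Proof.
move=> Gf e /Gf[g [c [sg fg dc]]]; exists (fconj g), c^s; split.
- exact: span_pair_star.
- by move=> y; rewrite /fconj -rmorphB nrmC_conj.
- by rewrite -cstarB nrm_cstar.
Qed.

Lemma diag_rel_bounded f d : diag_rel f d -> exists2 M : R, 0 <= M & forall y, nrm (f y) <= M.
Proof.
move=> /(_ 1 ltr01)[g [c [sg fg _]]]; have [M M0 gM] := span_pair_bounded sg.
exists (M + 1); first by rewrite addr_ge0.
by move=> y; have := nrm_le_dist (f y) (g y); have := fg y; have := gM y; lra.
Qed.

Lemma diag_relM f d g c : diag_rel f d -> diag_rel g c -> diag_rel (f * g) (d ** c).
Proof.
move=> Gf Gg e e0; have [Mf Mf0 fM] := diag_rel_bounded Gf.
have [Mg Mg0 gM] := diag_rel_bounded Gg.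
have d0 := nrm_ge0 d; have c0 := nrm_ge0 c.
(* [K] is at least Mf + Mg + 1 and |d| + |c| + 1. With e' <= 1 the approximants stay within 1 of g
   and c, so both errors are at most K e' <= e. *)
pose K := Mf + Mg + nrm d + nrm c + 1; have K0 : 0 < K by rewrite /K; lra.
pose e' := e / (K + e); have Ke : 0 < K + e by rewrite addr_gt0.
have e'0 : 0 < e' by rewrite divr_gt0.
have e'1 : e' <= 1 by rewrite /e' ler_pdivrMr// mul1r; lra.
have e'K : K * e' <= e.
  by rewrite /e' mulrA ler_pdivrMr// mulrC ler_pM2l//; lra.
have [f' [d' [sf ff' dd']]] := Gf _ e'0; have [g' [c' [sg gg' cc']]] := Gg _ e'0.
exists (f' * g'), (d' ** c'); split; first exact: span_pairM.
  move=> y; rewrite !fctE.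
  have -> : f y * g y - f' y * g' y = f y * (g y - g' y) + (f y - f' y) * g' y.
    by rewrite mulrBr mulrBl addrA subrK.
  apply: le_trans (nrmD _ _) _; rewrite !nrmCM.
  have := nrm_le_dist (g' y) (g y); rewrite nrm_distC.
  have := ff' y; have := gg' y; have := fM y; have := gM y.
  have := nrm_ge0 (g' y); have := nrm_ge0 (f y); have := nrm_ge0 (f y - f' y).
  have := nrm_ge0 (g y - g' y); rewrite /K in e'K.
  set a := nrm (f y); set a' := nrm (f y - f' y); set b := nrm (g y - g' y).
  set b' := nrm (g' y); set b1 := nrm (g y) => ? ? ? ? ? ? ? ? ?.
  have : a * b <= Mf * e' by apply: ler_pM.
  have : a' * b' <= e' * (Mg + 1) by apply: ler_pM => //; lra.
  by nra.
have -> : d ** c - d' ** c' = d ** (c - c') + (d - d') ** c'.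
  by rewrite cmulBr cmulBl addrA subrK.
apply: le_trans (nrmD _ _) _.
have := nrmM d (c - c'); have := nrmM (d - d') c'.
have := nrm_le_dist c' c; rewrite nrm_distC.
have := nrm_ge0 c'; have := nrm_ge0 (d - d'); have := nrm_ge0 (c - c').
rewrite /K in e'K => ? ? ? ? ? ?.
have : nrm d * nrm (c - c') <= nrm d * e' by apply: ler_pM.
have : nrm (d - d') * nrm c' <= e' * (nrm c + 1) by apply: ler_pM => //; lra.
by nra.
Qed.

Lemma nrm_lets_le l : nrm (lets l) <= 1.
Proof.
have H e : nrm (s e) <= 1.
  have := nrm_cstar_mul (s e); rewrite (ck_range ck).
  have := nrm_q ck [::] (gvert_rng e); have := nrm_ge0 (s e); rewrite /=; nra.
by case: l => e []; rewrite /lets /= ?nrm_cstar.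
Qed.

Lemma diag_rel_pact l f d : diag_rel f d ->
  diag_rel (pact (fglet l) f) (lets l ** d ** (lets l)^s).
Proof.
move=> Gf e e0; have [g [c [sg fg dc]]] := Gf _ e0.
exists (pact (fglet l) g), (lets l ** c ** (lets l)^s); split.
- exact: span_pair_pact.
- move=> y; rewrite -[_ - _]/((pact (fglet l) f - pact (fglet l) g) y) -pactB.
  by apply: pact_le => //; exact: ltW.
- rewrite -cmulBl -cmulBr; have := nrmM (lets l ** (d - c)) (lets l)^s.
  have := nrmM (lets l) (d - c); rewrite nrm_cstar.
  have := nrm_lets_le l; have := nrm_ge0 (d - c); have := nrm_ge0 (lets l).
  by have := nrm_ge0 (lets l ** (d - c)); nra.
Qed.

Lemma diag_rel_comm f d b B : diag_rel f d -> gvert B -> d ** q b B = q b B ** d.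
Proof.
move=> Gf gB; apply/eqP; rewrite -subr_eq0; apply/eqP/nrm_small => e e0.
have e2 : 0 < e / 2 by rewrite divr_gt0.
have [g [c [sg _ dc]]] := Gf _ e2.
have -> : d ** q b B - q b B ** d = (d - c) ** q b B - q b B ** (d - c).
  by rewrite cmulBl cmulBr (span_pair_comm ck b sg)// opprB addrA subrK.
apply: le_trans (nrmB _ _) _; have := nrmM (d - c) (q b B); have := nrmM (q b B) (d - c).
have := nrm_q ck b gB; have := nrm_ge0 (q b B); have := nrm_ge0 (d - c); nra.
Qed.

Lemma diag_rel_ex f : C0 setT f -> exists d, diag_rel f d.
Proof.
move=> /C0_approx af.
have h0 n : (0 : R) < 2^-1 ^+ n by rewrite exprn_gt0// invr_gt0.
have /choice[g /choice[c gcP]] : forall n : nat, exists g c, span_pair g c /\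
  forall y, nrm (f y - g y) <= 2^-1 ^+ n by move=> n; exact: af.
(* Consecutive approximants differ by at most 2^-n + 2^-(n+1), hence the 2 here and the 4 below. *)
have [n|d dP] := @complete_half _ _ c 2.
  have [sg1 fg1] := gcP n; have [sg2 fg2] := gcP n.+1.
  apply: (span_pair_nrm ck hG (span_pairB sg2 sg1)) => [|y].
    by rewrite mulr_ge0// ltW.
  rewrite -[_ y]/(g n.+1 y - g n y).
  have := nrm_dist (g n.+1 y) (f y) (g n y); rewrite (nrm_distC _ (f y)).
  by have := fg1 y; have := fg2 y; have := h0 n; rewrite exprS; lra.
exists d => e e0; have [n ne] := half_exp_small 4 e0; exists (g n), (c n).
have [sg fg] := gcP n; split => // [y|].
  by apply: le_trans (fg y) _; have := h0 n; lra.
by have := dP n; lra.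
Qed.

End SpanPairs.

(** * The representation of the crossed product *)

Section FiniteSupportSums.
Variables (I : choiceType) (M : zmodType).
Implicit Types F : I -> M.

Lemma fsum1 F t : (forall u, u <> t -> F u = 0) -> \sum_(u \in [set: I]) F u = F t.
Proof.
move=> F0; rewrite -(@fsbig_widen _ _ _ _ [set t])// ?fsbig_set1//.
by move=> u [_ ut]; exact: F0.
Qed.

Lemma fsum_widen F (S : set I) : [set u | F u <> 0] `<=` S ->
  \sum_(u \in [set: I]) F u = \sum_(u \in S) F u.
Proof.
move=> FS; apply/esym/fsbig_widen => // u [_ Su]; apply: contrapT => Fu.
by apply: Su; exact: FS.
Qed.

Lemma fsumD F1 F2 : finite_set [set u | F1 u <> 0] -> finite_set [set u | F2 u <> 0] ->
  \sum_(u \in [set: I]) (F1 u + F2 u) =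
  \sum_(u \in [set: I]) F1 u + \sum_(u \in [set: I]) F2 u.
Proof.
move=> f1 f2; have fS : finite_set ([set u | F1 u <> 0] `|` [set u | F2 u <> 0]).
  by rewrite finite_setU.
set S := _ `|` _ in fS.
rewrite (fsum_widen (S := S) (F := F1)); last by move=> u; left.
rewrite (fsum_widen (S := S) (F := F2)); last by move=> u; right.
rewrite -fsbig_split//; apply: fsum_widen => u /= H; apply: contrapT => /not_orP[].
by move=> /contrapT u1 /contrapT u2; apply: H; rewrite u1 u2 addr0.
Qed.

End FiniteSupportSums.

(** * Calculus in the algebraic crossed product *)

Section AlgCrossedProduct.
Variables (R : realType) (T : topologicalType) (H : groupType).
Variables (D : H -> set T) (theta : H -> T -> T).
Implicit Types (a b : H -> T -> R[i]) (t u : H) (f g : T -> R[i]).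
Local Notation alg := (@alg_crossed_product R T H D).
Local Notation pact := (pact D theta).
Local Notation cp_mul := (cp_mul D theta).
Local Notation cp_star := (cp_star D theta).

Lemma deltaE t f : delta t f t = f.
Proof. by rewrite /delta eqxx. Qed.

Lemma delta_neq t u f : u <> t -> delta t f u = 0.
Proof. by move=> /eqP/negbTE ut; rewrite /delta ut. Qed.

Lemma deltaD t f g : delta t (f + g) = delta t f + delta t g.
Proof.
apply/funext => u; rewrite -[RHS]/(delta t f u + delta t g u) /delta.
by case: eqP; rewrite ?addr0.
Qed.

Lemma deltaZ t (c : R[i]) f : delta t (c *: f) = c *: delta t f.
Proof.
apply/funext => u; rewrite -[RHS]/(c *: delta t f u) /delta.
by case: eqP; rewrite ?scaler0.
Qed.

Lemma alg0 : alg 0.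
Proof.
split; last by move=> t; exact: C00.
by rewrite (_ : [set _ | _] = set0)//; apply/seteqP; split=> // t /(_ erefl).
Qed.

Lemma alg_delta t f : C0 (D t) f -> alg (delta t f).
Proof.
move=> Cf; split.
  apply: (@sub_finite_set _ _ [set t]); last exact: finite_set1.
  by move=> u ut; apply: contrapT => nut; apply: ut; exact: delta_neq.
move=> u; have [->|/eqP ut] := eqVneq u t; first by rewrite deltaE.
by rewrite delta_neq//; exact: C00.
Qed.

Lemma alg_ind (P : (H -> T -> R[i]) -> Prop) : P 0 ->
  (forall t f a, C0 (D t) f -> alg a -> P a -> P (delta t f + a)) ->
  forall a, alg a -> P a.
Proof.
move=> P0 PS a [/finite_setP[n an] Ca].
have : [set t | a t <> 0] `<=` [set t | a t <> 0] by [].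
move: {1 3}[set t | a t <> 0] an => S Sn; elim: n S Sn a Ca => [|n IH] S Sn a Ca aS.
  suff -> : a = 0 by [].
  move: Sn; rewrite II0 card_eq0 => /eqP S0.
  by apply/funext => t; apply: contrapT => /aS; rewrite S0.
move: Sn => /eq_cardSP[t St Stn].
pose a' u := if u == t then 0 else a u.
have -> : a = delta t (a t) + a'.
  apply/funext => u; rewrite -[RHS]/(delta t (a t) u + a' u) /delta /a'.
  by case: eqP => [->|]; rewrite ?addr0 ?add0r.
have Ca' u : C0 (D u) (a' u) by rewrite /a'; case: ifP => // _; exact: C00.
have a'S : [set u | a' u <> 0] `<=` S `\ t.
  move=> u; rewrite /a' /=; case: eqP => [//|ut /aS Su]; split => //.
apply: PS => //; last exact: (IH (S `\ t)).
split => //; apply: sub_finite_set a'S _; apply/finite_setP; by exists n.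
Qed.

Lemma cp_mul_delta s t f g :
  cp_mul (delta s f) (delta t g) = delta (s * t)%g (pact s (pact s^-1%g f * g)).
Proof.
apply/funext => u; apply/funext => x; rewrite /cp_mul (fsum1 (t := s)); last first.
  move=> r rs; rewrite delta_neq// pact0.
  rewrite (_ : (fun y => _) = 0) ?pact0//; apply/funext => y; exact: mul0r.
rewrite deltaE; have [->|/eqP ut] := eqVneq u (s * t)%g; first by rewrite mulKg !deltaE.
rewrite !delta_neq// => [|E1]; last by apply: ut; rewrite -E1 mulVKg.
rewrite (_ : (fun y => _) = 0) ?pact0//; apply/funext => y; exact: mulr0.
Qed.

Lemma cp_mul_supp a b t x : alg a -> finite_set [set s | pact s
  (fun y => pact s^-1%g (a s) y * b (s^-1 * t)%g y) x <> 0].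
Proof.
move=> [fa _]; apply: sub_finite_set fa => s /= H0 as0; apply: H0; rewrite as0 pact0.
by rewrite (_ : (fun y => _) = 0) ?pact0//; apply/funext => y; exact: mul0r.
Qed.

Lemma cp_mulDl a a' b : alg a -> alg a' -> cp_mul (a + a') b = cp_mul a b + cp_mul a' b.
Proof.
move=> Ha Ha'; apply/funext => t; apply/funext => x.
rewrite -[RHS]/(cp_mul a b t x + cp_mul a' b t x) /cp_mul -fsumD.
- apply: eq_fsbigr => s _.
  set F := fun y => pact s^-1%g (a s) y * _; set F' := fun y => pact s^-1%g (a' s) y * _.
  rewrite (_ : (fun y => _) = F + F') ?pactD//; apply/funext => y.
  exact: mulrDl.
- exact: cp_mul_supp.
- exact: cp_mul_supp.
Qed.

Lemma cp_mulDr a b b' : alg a -> cp_mul a (b + b') = cp_mul a b + cp_mul a b'.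
Proof.
move=> Ha; apply/funext => t; apply/funext => x.
rewrite -[RHS]/(cp_mul a b t x + cp_mul a b' t x) /cp_mul -fsumD.
- apply: eq_fsbigr => s _.
  set F := fun y => _ * b _ y; set F' := fun y => _ * b' _ y.
  rewrite (_ : (fun y => _) = F + F') ?pactD//; apply/funext => y; exact: mulrDr.
- exact: cp_mul_supp.
- exact: cp_mul_supp.
Qed.

Lemma cp_mul0l b : cp_mul 0 b = 0.
Proof.
have := cp_mulDl b alg0 alg0; rewrite addr0 => E1.
by apply: (addIr (cp_mul 0 b)); rewrite -E1 add0r.
Qed.

Lemma cp_mul0r a : alg a -> cp_mul a 0 = 0.
Proof.
move=> Ha; have := cp_mulDr 0 0 Ha; rewrite addr0 => E1.
by apply: (addIr (cp_mul a 0)); rewrite -E1 add0r.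
Qed.

Lemma cp_starD a b : cp_star (a + b) = cp_star a + cp_star b.
Proof.
apply/funext => t; rewrite -[RHS]/(cp_star a t + cp_star b t) /cp_star -pactD.
by congr (Defs.pact _ _ t _); apply/funext => y; exact: rmorphD.
Qed.

Lemma cp_star0 : cp_star (0 : H -> T -> R[i]) = 0.
Proof.
have := cp_starD (0 : H -> T -> R[i]) 0; rewrite addr0 => E1.
by apply: (addIr (cp_star 0)); rewrite -E1 add0r.
Qed.

Lemma cp_star_delta t f :
  cp_star (delta t f) = delta t^-1%g (pact t^-1%g (fun y => Num.conj (f y))).
Proof.
apply/funext => u; rewrite /cp_star; have [->|/eqP ut] := eqVneq u t^-1%g.
  by rewrite invgK !deltaE.
rewrite !delta_neq// => [|E1]; last by apply: ut; rewrite -E1 invgK.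
rewrite (_ : (fun y => _) = 0) ?pact0//; apply/funext => y; exact: conjC0.
Qed.

End AlgCrossedProduct.

(** * The map Psi *)

Section Representation.
Variables (R : realType) (G : ultragraph) (A : cstarAlgType R).
Variables (s : edge G -> A) (p : set (vert G) -> A).
Hypothesis ck : ck_family s p.
Hypothesis hG : RFUM2 G.
Local Notation V := (vert G).
Local Notation E := (edge G).
Local Notation X := (bspace G).
Local Notation F := (freegroup E).
Implicit Types (B C : set V) (b : seq E) (e : E) (c d x : A) (l : E * bool).
Implicit Types (f g : X -> R[i]) (u v w : seq (E * bool)) (t r : F).
Local Notation "x ^s" := (cstar x) (at level 2, format "x ^s").
Local Notation pact := (pact (@bdom G) (@bact G)).
Local Notation cp_mul := (cp_mul (@bdom G) (@bact G)).
Local Notation cp_star := (cp_star (@bdom G) (@bact G)).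
Local Notation alg := (@alg_crossed_product R X F (@bdom G)).
Local Notation q := (cyl_proj s p).
Local Notation diag_rel := (diag_rel s p).
Local Notation lets := (lets s).

(** Outside C_0(X) nothing is related to f, and [get] returns an arbitrary value. *)
Definition diag_pi f : A := get (diag_rel f).

Lemma diag_piP f : C0 setT f -> diag_rel f (diag_pi f).
Proof. by move=> Cf; have [d Gd] := diag_rel_ex ck hG Cf; exact: (getI Gd). Qed.

Lemma diag_pi_eq f d : diag_rel f d -> diag_pi f = d.
Proof.
move=> Gd; apply: (diag_rel_uniq ck hG _ Gd); apply: diag_piP.
exact: (diag_rel_C0 hG Gd).
Qed.

Lemma diag_rel0 : diag_rel 0 0.
Proof. exact/span_pair_diag_rel/span_pair0. Qed.

Lemma lets_proj l :
  lets l ** (lets l)^s = q (if l.2 then [:: l.1] else [::]) (rng l.1).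
Proof. by case: l => e []; rewrite /lets /= ?(s_p ck)// cstarK (ck_range ck). Qed.

Lemma lets_pisom l : lets l ** (lets l)^s ** lets l = lets l.
Proof.
case: l => e []; rewrite /lets /= ?(s_pisom ck)// cstarK (ck_range ck).
exact: (p_ss ck).
Qed.

Lemma diag_rel_let_supp f d l : diag_rel f d -> (forall y, ~ bdom (fglet l) y -> f y = 0) ->
  lets l ** (lets l)^s ** d = d /\ d ** (lets l ** (lets l)^s) = d.
Proof.
move=> Gf f0; rewrite lets_proj; set b := if _ then _ else _.
have gB := gvert_rng l.1; have E1 : d ** q b (rng l.1) = d.
  apply: (diag_rel_uniq ck hG _ Gf).
  rewrite (_ : f = f * \1_(cylinder b (rng l.1))).
    by apply: (diag_relM ck) => //; exact/span_pair_diag_rel/span_pair_gen.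
  apply/funext => y; rewrite fctE -bdom_let.
  have [yb|yb] := pselect (bdom (fglet l) y); first by rewrite cind_in// mulr1.
  by rewrite f0// mul0r.
by rewrite -(diag_rel_comm ck b Gf).
Qed.

(** The second part is covariance, s_l c = pi(alpha_l g) s_l; it holds because c commutes with the
    projection s_l^* s_l. *)
Lemma diag_rel_let_cov g c l : diag_rel g c ->
  diag_rel (pact (fglet l) g) (lets l ** c ** (lets l)^s) /\
  lets l ** c = lets l ** c ** (lets l)^s ** lets l.
Proof.
move=> Gg; split; first exact: (diag_rel_pact ck).
have := lets_proj (linv l); rewrite lets_linv cstarK => qE.
rewrite -(cmulA _ (lets l)^s) qE -cmulA (diag_rel_comm ck _ Gg); last exact: gvert_rng.
by rewrite cmulA -qE cmulA lets_pisom.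
Qed.

(* [x s_w]; the unit that [s_w] would be for [w = [::]] is missing from A. *)
Definition rmulw x w : A := foldl (fun x l => x ** lets l) x w.

Lemma rmulwM d x w : rmulw (d ** x) w = d ** rmulw x w.
Proof. by elim: w x => //= l w IH x; rewrite -IH cmulA. Qed.

Lemma rmulwD d x w : rmulw (d + x) w = rmulw d w + rmulw x w.
Proof. by elim: w d x => //= l w IH d x; rewrite -IH cmulDl. Qed.

Lemma rmulwZ (k : R[i]) x w : rmulw (k *: x) w = k *: rmulw x w.
Proof. by elim: w x => //= l w IH x; rewrite -IH cmulZl. Qed.

Lemma rmulw0 w : rmulw 0 w = 0.
Proof. by elim: w => //= l w IH; rewrite cmul0x. Qed.

Lemma rmulw_cat x u v : rmulw x (u ++ v) = rmulw (rmulw x u) v.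
Proof. exact: foldl_cat. Qed.

(** As s_l s_l^* is a projection and not 1, a cancellation between u and v affects s_u s_v. But f
    lives on X_u, inside X_l for the first letter l of u, so d absorbs s_l s_l^*. In the induction d
    s_l becomes s_l times s_l^* d s_l, an element belonging to alpha_(l^-1) f, which is supported in
    the domain of the rest of u. *)
Lemma rmulw_wmul f d u v : diag_rel f d -> (forall y, ~ wdom u y -> f y = 0) ->
  rmulw d (u ++ v) = rmulw d (wmul u v).
Proof.
elim: u f d => [//|l u IH] f d Gf f0 /=.
have fl y : ~ bdom (fglet l) y -> f y = 0 by move=> yl; apply: f0 => -[].
have [ed de] := diag_rel_let_supp Gf fl.
have := (diag_rel_let_cov (linv l) Gf).1; rewrite lets_linv cstarK => Gf'.
have dS : d ** lets l = lets l ** ((lets l)^s ** d ** lets l).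
  by rewrite !cmulA ed.
rewrite dS rmulwM (IH _ _ Gf'); last first.
  move=> y yu; have [ly|ly] := pselect (bdom (fglet (linv l)) y); last by rewrite pact_out.
  rewrite pactE// fgletV; apply: f0 => -[ly' wy]; apply: yu.
  by have [_ yK] := lactK ly; rewrite yK in wy.
rewrite -rmulwM -dS; case: (wmul u v) => [//|m w] /=.
case: eqP => [->|//]; rewrite /= lets_linv -cmulA de//.
Qed.

(** Covariance s_u pi(g) = pi(alpha_u g) s_u; the factor [d] on the left stands in for the missing
    unit when u is empty. *)
Lemma rmulw_cov g c u : diag_rel g c -> exists2 c', diag_rel (pactw u g) c' &
  forall d, rmulw d u ** c = rmulw (d ** c') u.
Proof.
move=> Gg; elim: u => [|l u [c' Gc' IH]]; first by exists c.
have [Gc'' cE] := diag_rel_let_cov l Gc'.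
by exists (lets l ** c' ** (lets l)^s) => // d; rewrite /= IH -cmulA {1}cE !cmulA.
Qed.

Lemma rmulw_star g c w : diag_rel g c -> exists2 c', diag_rel (pactw (winv w) g) c' &
  (rmulw c^s w)^s = rmulw c' (winv w).
Proof.
move=> Gg; elim/last_ind: w => [|w l [c' Gc' IH]]; first by exists c; rewrite //= cstarK.
have [Gc'' cE] := diag_rel_let_cov (linv l) Gc'.
exists (lets (linv l) ** c' ** (lets (linv l))^s).
  by rewrite /winv map_rcons rev_rcons.
rewrite -cats1 rmulw_cat /= cstarM IH -lets_linv -rmulwM {1}cE.
by rewrite /winv map_cat rev_cat.
Qed.

Lemma wdom_rcancel l w (y : X) : wdom (l :: w) y -> wdom (rcancel l w) y.
Proof.
case: w => [//|m w] /=; case: eqP => [-> [ly]|//].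
by move=> [l'y]; rewrite linvK; have [_ ->] := lactK ly.
Qed.

Lemma wdom_wmul u v (y : X) : wdom u y -> wdom v (wact u y) -> wdom (wmul u v) y.
Proof.
elim: u y => [//|l u IH] y [ly uy] vy.
by apply: wdom_rcancel; split => //; exact: IH.
Qed.

(** Continuity of alpha_t f is not read off from theta_t: f is a uniform limit of combinations of
    cylinders, and each letter preserves such limits. *)
Lemma C0_pact t f : C0 setT f -> C0 (bdom t) (pact t f).
Proof.
move=> Cf; apply/C0_setT; split; last by move=> y; exact: pact_out.
have [c' Gc' _] := rmulw_cov (fgword t) (diag_piP Cf).
by rewrite pact_word; exact: (diag_rel_C0 hG Gc').
Qed.

Lemma pact_conv r f g : C0 (bdom r) f -> pact r (pact r^-1%g f * g) = f * pact r g.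
Proof. by move=> /C0_setT[_ f0]; rewrite pactM pactK. Qed.

Lemma C0_conv r t f g : C0 (bdom r) f -> C0 (bdom t) g ->
  C0 (bdom (r * t)%g) (f * pact r g).
Proof.
move=> Cf /C0_setT[Cg g0]; have := C0M Cf (C0_setTW (C0_pact r Cg)).
move=> /C0_setT[Cfg fg0]; apply/C0_setT; split => // y yrt.
have [ry|/fg0//] := pselect (bdom r y); rewrite fctE pactE//.
rewrite g0 ?mulr0// => /bdom_word; rewrite bact_word// => ty; apply: yrt.
by apply/bdom_word; apply: wdom_wmul => //; exact/bdom_word.
Qed.


Lemma algD (a1 a2 : F -> X -> R[i]) : alg a1 -> alg a2 -> alg (a1 + a2).
Proof.
move=> [f1 C1] [f2 C2]; split; last by move=> t; exact: C0D.
apply: (@sub_finite_set _ _ ([set t | a1 t <> 0] `|` [set t | a2 t <> 0])).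
  move=> t /= a12; apply: contrapT => /not_orP[/contrapT t1 /contrapT t2].
  by apply: a12; rewrite -[LHS]/(a1 t + a2 t) t1 t2 addr0.
by rewrite finite_setU.
Qed.

Lemma algZ (k : R[i]) (a : F -> X -> R[i]) : alg a -> alg (k *: a).
Proof.
move=> [fa Ca]; split; last by move=> t; exact: C0Z.
apply: sub_finite_set fa => t /= ka at0; apply: ka.
by rewrite -[LHS]/(k *: a t) at0 scaler0.
Qed.

Lemma alg_mul (a1 a2 : F -> X -> R[i]) : alg a1 -> alg a2 -> alg (cp_mul a1 a2).
Proof.
move=> Ha1 Ha2; move: a1 Ha1; apply: alg_ind => [|t f a Cf Ha IH].
  by rewrite cp_mul0l; exact: alg0.
have Hd := alg_delta Cf; rewrite cp_mulDl//; apply: algD => //.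
move: a2 Ha2 {IH}; apply: alg_ind => [|r g a2 Cg Ha2 IH].
  by rewrite cp_mul0r//; exact: alg0.
rewrite cp_mulDr//; apply: algD => //; rewrite cp_mul_delta pact_conv//.
by apply: alg_delta; exact: C0_conv.
Qed.

Lemma alg_star (a : F -> X -> R[i]) : alg a -> alg (cp_star a).
Proof.
move: a; apply: alg_ind => [|t f a Cf Ha IH]; first by rewrite cp_star0; exact: alg0.
rewrite cp_starD; apply: algD => //; rewrite cp_star_delta; apply: alg_delta.
by apply: C0_pact; apply: C0_setTW (C0_conj Cf).
Qed.

Definition Psi (a : F -> X -> R[i]) : A :=
  \sum_(t \in [set: F]) rmulw (diag_pi (a t)) (fgword t).

Lemma diag_pi0 : diag_pi 0 = 0. Proof. exact: diag_pi_eq diag_rel0. Qed.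

Lemma Psi_delta t f : Psi (delta t f) = rmulw (diag_pi f) (fgword t).
Proof.
rewrite /Psi (fsum1 (t := t)) ?deltaE// => r rt.
by rewrite delta_neq// diag_pi0 rmulw0.
Qed.

Lemma PsiD (a1 a2 : F -> X -> R[i]) : alg a1 -> alg a2 -> Psi (a1 + a2) = Psi a1 + Psi a2.
Proof.
have fin (a : F -> X -> R[i]) : alg a ->
    finite_set [set t | rmulw (diag_pi (a t)) (fgword t) <> 0].
  move=> [fa _]; apply: sub_finite_set fa => t /= H at0; apply: H.
  by rewrite at0 diag_pi0 rmulw0.
move=> Ha1 Ha2; rewrite /Psi -fsumD; [|exact: fin|exact: fin].
apply: eq_fsbigr => t _; rewrite -rmulwD; congr rmulw.
apply: diag_pi_eq; apply: diag_relD; apply: diag_piP.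
  by case: Ha1 => _ /(_ t)/C0_setTW.
by case: Ha2 => _ /(_ t)/C0_setTW.
Qed.

Lemma Psi0 : Psi 0 = 0.
Proof. by rewrite /Psi fsbig1// => t _; rewrite diag_pi0 rmulw0. Qed.

Lemma PsiZ (k : R[i]) (a : F -> X -> R[i]) : alg a -> Psi (k *: a) = k *: Psi a.
Proof.
move: a; apply: alg_ind => [|t f a Cf Ha IH]; first by rewrite scaler0 Psi0 scaler0.
have Hd := alg_delta Cf; rewrite scalerDr -deltaZ !PsiD//.
- rewrite IH scalerDr; congr (_ + _); rewrite !Psi_delta -rmulwZ; congr rmulw.
  by apply: diag_pi_eq; apply: diag_relZ; apply: diag_piP; apply: C0_setTW Cf.
- by rewrite deltaZ; exact: algZ.
- exact: algZ.
Qed.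

(** By covariance pi(f) s_r pi(g) s_t = pi(f alpha_r(g)) s_r s_t, and s_r s_t may be replaced by
    s_(rt) since f alpha_r(g) is supported in X_r. *)
Lemma Psi_delta_mul r t f g : C0 (bdom r) f -> C0 (bdom t) g ->
  Psi (cp_mul (delta r f) (delta t g)) = Psi (delta r f) ** Psi (delta t g).
Proof.
move=> Cf Cg; rewrite cp_mul_delta pact_conv// !Psi_delta.
have Gf := diag_piP (C0_setTW Cf); have Gg := diag_piP (C0_setTW Cg).
have [c' Gc' covc'] := rmulw_cov (fgword r) Gg.
have Gfg : diag_rel (f * pact r g) (diag_pi f ** c').
  by apply: (diag_relM ck) => //; rewrite pact_word.
rewrite (diag_pi_eq Gfg) -[fgword (r * t)%g]/(wmul r t) -(rmulw_wmul _ Gfg).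
  by rewrite rmulw_cat -covc' rmulwM.
move=> y yr; have [_ f0] := (C0_setT _ _).1 Cf.
by rewrite fctE f0 ?mul0r// => /bdom_word.
Qed.

Lemma PsiM (a1 a2 : F -> X -> R[i]) : alg a1 -> alg a2 ->
  Psi (cp_mul a1 a2) = Psi a1 ** Psi a2.
Proof.
move=> Ha1 Ha2; move: a1 Ha1; apply: alg_ind => [|t f a Cf Ha IH].
  by rewrite cp_mul0l Psi0 cmul0x.
have Hd := alg_delta Cf; rewrite cp_mulDl// !PsiD//; [|exact: alg_mul|exact: alg_mul].
rewrite IH cmulDl; congr (_ + _).
move: a2 Ha2 {IH}; apply: alg_ind => [|r g a2 Cg Ha2 IH].
  by rewrite cp_mul0r// Psi0 cmulx0.
have Hd2 := alg_delta Cg.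
rewrite cp_mulDr// !PsiD//; [|exact: alg_mul|exact: alg_mul].
by rewrite IH cmulDr Psi_delta_mul.
Qed.

Lemma Psi_star (a : F -> X -> R[i]) : alg a -> Psi (cp_star a) = (Psi a)^s.
Proof.
move: a; apply: alg_ind => [|t f a Cf Ha IH]; first by rewrite cp_star0 Psi0 cstar0.
have Hd := alg_delta Cf.
rewrite cp_starD !PsiD//; [|exact: alg_star|exact: alg_star].
rewrite IH cstarD; congr (_ + _); rewrite cp_star_delta !Psi_delta.
have [c' Gc' E1] := rmulw_star (fgword t) (diag_rel_star ck (diag_piP (C0_setTW Cf))).
rewrite cstarK in E1; rewrite E1; congr rmulw.
by apply: diag_pi_eq; rewrite pact_word.
Qed.

Lemma Psi_seminorm : cp_cstar_seminorm (@bdom G) (@bact G) (fun a => nrm (Psi a)).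
Proof.
split=> [a _|a1 a2 H1 H2|k a Ha|a1 a2 H1 H2|a Ha|a Ha].
- exact: nrm_ge0.
- by rewrite PsiD// nrmD.
- by rewrite PsiZ// nrmZ rmorphM/= -nrmE.
- by rewrite PsiM// nrmM.
- by rewrite Psi_star// nrm_cstar.
- by rewrite PsiM ?Psi_star ?nrm_cstar_mul//; exact: alg_star.
Qed.

Lemma Psi_p B : gvert B -> Psi (delta 1%g (\1_(bsrc B))) = p B.
Proof.
move=> gB; rewrite Psi_delta /= -cylinder_nil; apply: (diag_pi_eq (f := \1_(cylinder [::] B))).
exact: (span_pair_diag_rel (span_pair_gen s p [::] gB)).
Qed.

Lemma Psi_s e : Psi (delta (fggen e) (\1_(bdom (fggen e)))) = s e.
Proof.
have H : diag_rel (\1_(bdom (fggen e))) (s e ** (s e)^s).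
  rewrite -[fggen e]/(fglet (e, true)) bdom_let.
  rewrite -[s e ** _]/(lets (e, true) ** (lets (e, true))^s) lets_proj.
  exact: (span_pair_diag_rel (span_pair_gen s p _ (gvert_rng e))).
by rewrite Psi_delta (diag_pi_eq H) /= (s_pisom ck).
Qed.

End Representation.

(** * The Cuntz-Krieger family of the crossed product *)

Section CrossedProductFamily.
Variables (R : realType) (G : ultragraph).
Hypothesis hG : RFUM2 G.
Local Notation V := (vert G).
Local Notation E := (edge G).
Local Notation X := (bspace G).
Local Notation F := (freegroup E).
Variables (A' : cstarAlgType R) (iota : (F -> X -> R[i]) -> A').
Hypothesis hB : is_crossed_product (@bdom G) (@bact G) iota.
Implicit Types (B C : set V) (b : seq E) (e : E) (l : E * bool).
Implicit Types (f g : X -> R[i]) (w : seq (E * bool)) (t r : F).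
Local Notation "x ^s" := (cstar x) (at level 2, format "x ^s").
Local Notation pact := (pact (@bdom G) (@bact G)).
Local Notation cp_mul := (cp_mul (@bdom G) (@bact G)).
Local Notation cp_star := (cp_star (@bdom G) (@bact G)).
Local Notation alg := (@alg_crossed_product R X F (@bdom G)).

Definition ilet l : X -> R[i] := \1_(bdom (fglet l)).
Definition ulet l : F -> X -> R[i] := delta (fglet l) (ilet l).

Lemma C0_cylinder b B : gvert B -> C0 setT (\1_(cylinder b B) : X -> R[i]).
Proof.
move=> gB; apply: C0_setTW; apply: C0_indic; first exact: cylinder_open.
  exact: cylinder_closed.
exact: cylinder_compact.
Qed.

Lemma C0_bsrc B : gvert B -> C0 setT (\1_(bsrc B) : X -> R[i]).
Proof. by rewrite -cylinder_nil; exact: C0_cylinder. Qed.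

Lemma C0_ilet l : C0 (bdom (fglet l)) (ilet l).
Proof.
apply/C0_setT; split; last by move=> y; exact: cind_out.
by rewrite /ilet bdom_let; apply: C0_cylinder; exact: gvert_rng.
Qed.

Lemma bdom1 (y : X) : bdom 1%g y.
Proof. by apply/bdom_word. Qed.

Lemma C0_1 f : C0 setT f -> C0 (bdom (1%g : F)) f.
Proof. by move=> Cf; apply/C0_setT; split => // y; have := bdom1 y. Qed.

Lemma alg1 f : C0 setT f -> alg (delta 1%g f).
Proof. by move=> /C0_1; exact: alg_delta. Qed.

Lemma alg_ulet l : alg (ulet l).
Proof. exact/alg_delta/C0_ilet. Qed.

Lemma pact1 f : pact 1%g f = f.
Proof. by rewrite pact_word. Qed.

Lemma ilet_mul l f : (forall y, ~ bdom (fglet l) y -> f y = 0) -> ilet l * f = f.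
Proof.
move=> f0; apply/funext => y; rewrite fctE /ilet.
have [yl|yl] := pselect (bdom (fglet l) y); first by rewrite cind_in// mul1r.
by rewrite f0// mulr0.
Qed.

Lemma ilet_pact l f : ilet l * pact (fglet l) f = pact (fglet l) f.
Proof. by apply: ilet_mul => y; exact: pact_out. Qed.

Lemma pact_ilet l : pact (fglet l) (ilet (linv l)) = ilet l.
Proof.
apply/funext => y; rewrite /ilet; have [yl|yl] := pselect (bdom (fglet l) y).
  by rewrite pactE// fgletV !cind_in//; have [] := lactK yl.
by rewrite pact_out// cind_out.
Qed.

Lemma fgletM l : (fglet l * fglet (linv l))%g = 1%g.
Proof. by rewrite -fgletV mulgV. Qed.

Lemma delta_mul r t f g : C0 (bdom r) f ->
  cp_mul (delta r f) (delta t g) = delta (r * t)%g (f * pact r g).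
Proof. by move=> Cf; rewrite cp_mul_delta pact_conv. Qed.

Lemma ulet_mul l t g : cp_mul (ulet l) (delta t g) = delta (fglet l * t)%g (pact (fglet l) g).
Proof. by rewrite delta_mul ?ilet_pact//; exact: C0_ilet. Qed.

Lemma ulet_star l : cp_star (ulet l) = ulet (linv l).
Proof.
rewrite cp_star_delta fgletV /ulet; congr delta.
rewrite -[RHS]pact_ilet linvK; congr (Defs.pact _ _ _ _).
by apply/funext => y; rewrite /ilet indicE; exact: conjC_nat.
Qed.

Lemma delta1_star f : cp_star (delta 1%g f) = delta 1%g (fconj f).
Proof. by rewrite cp_star_delta invg1 pact1. Qed.

Definition iotaC0 f : A' := iota (delta 1%g f).
Definition iota_s e : A' := iota (ulet (e, true)).
Definition iota_p B : A' := iotaC0 (\1_(bsrc B)).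

Lemma iotaC0D f g : C0 setT f -> C0 setT g -> iotaC0 (f + g) = iotaC0 f + iotaC0 g.
Proof. by move=> Cf Cg; rewrite /iotaC0 deltaD (cp_iotaD hB)//; exact: alg1. Qed.

Lemma iotaC0Z (k : R[i]) f : C0 setT f -> iotaC0 (k *: f) = k *: iotaC0 f.
Proof. by move=> Cf; rewrite /iotaC0 deltaZ (cp_iotaZ hB)//; exact: alg1. Qed.

Lemma iotaC0B f g : C0 setT f -> C0 setT g -> iotaC0 (f - g) = iotaC0 f - iotaC0 g.
Proof.
move=> Cf Cg; rewrite -(scaleN1r g) -(scaleN1r (iotaC0 g)) iotaC0D ?iotaC0Z//.
exact: C0Z.
Qed.

Lemma iotaC0M f g : C0 setT f -> C0 setT g -> iotaC0 (f * g) = iotaC0 f ** iotaC0 g.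
Proof.
move=> Cf Cg; rewrite /iotaC0 -(cp_iotaM hB) ?delta_mul ?mulg1 ?pact1//.
- exact: C0_1.
- exact: alg1.
- exact: alg1.
Qed.

Lemma iotaC0_star f : C0 setT f -> iotaC0 (fconj f) = (iotaC0 f)^s.
Proof. by move=> Cf; rewrite /iotaC0 -(cp_iota_star hB) ?delta1_star//; exact: alg1. Qed.

Lemma iotaC00 : iotaC0 0 = 0.
Proof.
have C := @C00 R X setT.
by have := iotaC0B C C; rewrite !subrr.
Qed.

Lemma lets_iota_s l : lets iota_s l = iota (ulet l).
Proof.
case: l => e [] //; rewrite /lets /= /iota_s -(cp_iota_star hB) ?ulet_star//.
exact: alg_ulet.
Qed.

Lemma iota_ulet_mul l t g : C0 (bdom t) g ->
  iota (ulet l) ** iota (delta t g) = iota (delta (fglet l * t)%g (pact (fglet l) g)).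
Proof.
by move=> Cg; rewrite -(cp_iotaM hB) ?ulet_mul//; [exact: alg_ulet|exact: alg_delta].
Qed.

Lemma lets_iota_s_proj l : lets iota_s l ** (lets iota_s l)^s = iotaC0 (ilet l).
Proof.
by rewrite -lets_linv !lets_iota_s iota_ulet_mul ?fgletM ?pact_ilet//; exact: C0_ilet.
Qed.

Lemma iotaC0_lets f l : C0 setT f -> iotaC0 f ** lets iota_s l = iota (delta (fglet l) (f * ilet l)).
Proof.
move=> Cf; rewrite lets_iota_s -(cp_iotaM hB); [|exact: alg1|exact: alg_ulet].
by rewrite delta_mul ?mul1g ?pact1//; exact: C0_1.
Qed.

Lemma iotaC0_sum (l : seq E) (f : E -> X -> R[i]) : (forall e, C0 setT (f e)) ->
  iotaC0 (\sum_(e <- l) f e) = \sum_(e <- l) iotaC0 (f e) /\ C0 setT (\sum_(e <- l) f e).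
Proof.
move=> Cf; elim: l => [|e l [IH1 IH2]]; first by rewrite !big_nil iotaC00; split => //; exact: C00.
by rewrite !big_cons iotaC0D// IH1; split => //; exact: C0D.
Qed.

Lemma ilet_neg e : ilet (e, false) = \1_(bsrc (rng e)).
Proof. by rewrite /ilet; congr (\1_ _); apply/seteqP; split=> y /ldom_neg. Qed.

(** No boundary path of length 0 ends at a regular vertex, so every path in X_v has a first edge. *)
Lemma bsrc_regular v : regular v ->
  \1_(bsrc [set v]) = \sum_(e \in emitted [set v]) ilet (e, true).
Proof.
move=> rv; have [_ fv] := rv; apply/funext => y.
rewrite fsbig_finite//= fct_sumE -(fsbig_finite _ (fun e => ilet (e, true) y))//.
have [[e [ve ye]]|ny] := pselect (exists e, emitted [set v] e /\ ufirst (sval y) = Some e).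
  rewrite cind_in; last by rewrite /bsrc /= (ucat1_udrop ye) usrc_ucat => _ ->.
  rewrite -(@fsbig_widen _ _ _ _ [set e]) ?fsbig_set1 /ilet.
  - by rewrite cind_in//; exact/ldom_pos.
  - by move=> _ ->.
  - by move=> e' [_ e'e] /=; rewrite cind_out// => /ldom_pos; rewrite ye => -[/esym].
rewrite cind_out.
  rewrite fsbig1// => e ve; rewrite /ilet cind_out// => /ldom_pos ye; apply: ny.
  by exists e.
rewrite /bsrc /= => yv; case: (ufirstP (sval y)) => [[e ye]|[C yC]].
  apply: ny; exists e; split => //; apply: yv.
  by rewrite (ucat1_udrop ye) usrc_ucat.
have bC : bvert C by have := svalP y; rewrite yC => /Xfin_bvert.
by apply: (bvert_regular bC _ rv); move: yv; rewrite yC.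
Qed.

Lemma ck_family_iota : ck_family iota_s iota_p.
Proof.
have projE e : iota_s e ** (iota_s e)^s = iotaC0 (ilet (e, true)) by exact: (lets_iota_s_proj (e, true)).
have Cl l : C0 setT (ilet l) by exact: C0_setTW (C0_ilet l).
split.
- move=> e; rewrite /partial_isometry projE -[iota_s e in LHS]/(lets iota_s (e, true)).
  by rewrite iotaC0_lets// ilet_mul// => y; exact: cind_out.
- move=> e f ef; rewrite !projE -iotaC0M// (_ : _ * _ = 0) ?iotaC00//.
  apply/funext => y; rewrite fctE /ilet.
  have [ye|ye] := pselect (bdom (fglet (e, true)) y); last by rewrite cind_out// mul0r.
  rewrite [X in _ * X]cind_out ?mulr0// => /ldom_pos; move: ye => /ldom_pos -> -[].
  exact: ef.
- move=> B gB; have CB := C0_bsrc gB; split.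
    rewrite -iotaC0_star//; congr iotaC0; apply/funext => y.
    by rewrite /fconj indicE conjC_nat.
  by rewrite -iotaC0M// cindI setIid.
- by rewrite /iota_p bsrc0 indic0; exact: iotaC00.
- by move=> B C gB gC; rewrite /iota_p -iotaC0M ?cindI ?bsrcI//; exact: C0_bsrc.
- move=> B C gB gC; have gI := gvertI gB gC.
  have [C1 C2 C3] := And3 (C0_bsrc gB) (C0_bsrc gC) (C0_bsrc gI).
  rewrite /iota_p -iotaC0D// -iotaC0B//; last exact: C0D.
  congr iotaC0; rewrite bsrcU// bsrcI; apply/funext => y; rewrite !fctE.
  have [yB|yB] := pselect (bsrc B y).
    rewrite (cind_in _ yB) cind_in; last by left.
    have [yC|yC] := pselect (bsrc C y).
      by rewrite (cind_in _ yC) cind_in// addrK.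
    by rewrite (cind_out _ yC) cind_out ?addr0 ?subr0// => -[].
  rewrite (cind_out _ yB) [X in _ - X]cind_out ?subr0 ?add0r; last by case.
  have [yC|yC] := pselect (bsrc C y).
    by rewrite !cind_in//; right.
  by rewrite !cind_out// => -[].
- move=> e; have := lets_iota_s_proj (e, false).
  by rewrite /lets /= cstarK ilet_neg.
- move=> e; rewrite projE; have C1 := C0_bsrc (gvert1 (src e)).
  have se (y : X) : bdom (fglet (e, true)) y -> bsrc [set src e] y.
    by move=> /ldom_pos/ucat1_udrop yE; rewrite /bsrc /= yE usrc_ucat => _ ->.
  have cI : bsrc [set src e] `&` bdom (fglet (e, true)) = bdom (fglet (e, true)) :> set X.
    by apply/seteqP; split=> y; [case|move=> ye; split => //; exact: se].
  split; rewrite /iota_p -iotaC0M// /ilet cindI; first by rewrite cI.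
  by rewrite setIC cI.
- move=> v rv; have [_ fv] := rv; rewrite /iota_p bsrc_regular//.
  rewrite fsbig_finite//= (iotaC0_sum _ (fun e => Cl (e, true))).1 fsbig_finite//=.
  by apply: eq_bigr => e _; rewrite projE.
Qed.

End CrossedProductFamily.

(** * Square roots of real functions *)

Section RealShift.
Variables (R : realType) (T : topologicalType).
Implicit Types f : T -> R[i].

(** Take g = 1 - sqrt (1 - f^2) pointwise; it vanishes at infinity together with f because 1 - sqrt
    (1 - r^2) <= |r|. *)
Lemma sqrt_shift_fun f : C0 setT f -> (forall x, Num.conj (f x) = f x) ->
  (forall x, nrm (f x) <= 1) -> exists g, [/\ C0 setT g,
    forall x, Num.conj (g x) = g x & g + g - g * g = f * f].
Proof.
move=> Cf fr f1; pose phi (r : R) := 1 - Num.sqrt (1 - r ^+ 2).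
have fE x : f x = (complex.Re (f x))%:C by rewrite RRe_real//; exact/CrealP.
have nf x : nrm (f x) = `|complex.Re (f x)| by rewrite {1}fE nrmC_real.
have re1 x : complex.Re (f x) ^+ 2 <= 1.
  by have := f1 x; rewrite nf ler_norml => /andP[]; nra.
have cphi : continuous phi.
  move=> r; apply: cvgB; first exact: cvg_cst.
  apply: (@continuous_comp _ _ _ (fun r : R => 1 - r ^+ 2) Num.sqrt); last exact: sqrt_continuous.
  by apply: cvgB; [exact: cvg_cst|exact: exprn_continuous].
exists (fun x => (phi (complex.Re (f x)))%:C); split.
- have [cf _ _] := Cf; apply: C0_of_dom; last by move=> x; case.
    apply/continuous_nrmP => x e e0.
    have /cvgrPdist_lt/(_ _ e0) := cphi (complex.Re (f x)).
    move=> /nbhs_ballP[d /= d0 Hd].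
    apply: filterS ((continuous_nrmP f).1 cf x d d0) => z fxz.
    rewrite -rmorphB nrmC_real; apply: Hd; rewrite /ball /=.
    apply: le_lt_trans fxz; rewrite -lecR -nrmE.
    have -> : complex.Re (f x) - complex.Re (f z) = complex.Re (f x - f z) by case: (f x) (f z) => ? ? [].
    exact: normc_ge_Re.
  move=> e e0; exists [set x | e <= nrm (f x)]; first exact: C0_compact Cf e0.
  move=> x /= /le_trans; apply; rewrite nrmC_real nf /phi.
  set r := complex.Re (f x); have r1 : r ^+ 2 <= 1 := re1 x.
  have s0 := sqrtr_ge0 (1 - r ^+ 2).
  have s2 : Num.sqrt (1 - r ^+ 2) ^+ 2 = 1 - r ^+ 2 by rewrite sqr_sqrtr// subr_ge0.
  have r2 : `|r| ^+ 2 = r ^+ 2 by rewrite real_normK ?num_real.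
  have r0 := normr_ge0 r.
  move: s0 s2 r2 r0; set t := Num.sqrt _; set a := `|r| => s0 s2 r2 r0.
  have t1 : t <= 1 by rewrite -(@ler_pXn2r _ 2) ?nnegrE// expr1n s2 -r2; have := sqr_ge0 a; lra.
  (* From (a + t)^2 >= a^2 + t^2 = 1. *)
  have at1 : 1 <= a + t.
    rewrite -(@ler_pXn2r _ 2) ?nnegrE ?addr_ge0// expr1n sqrrD s2 r2.
    by have := mulr_ge0 r0 s0; rewrite mulr2n; lra.
  by rewrite ger0_norm; lra.
- by move=> x; exact: conj_real.
- apply/funext => x; rewrite !fctE (fE x) -!rmorphM -rmorphD -rmorphB; congr (_%:C).
  set r := complex.Re (f x); have r1 : r ^+ 2 <= 1 := re1 x.
  have s2 : Num.sqrt (1 - r ^+ 2) ^+ 2 = 1 - r ^+ 2 by rewrite sqr_sqrtr// subr_ge0.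
  rewrite /phi; move: s2; set t := Num.sqrt _ => s2.
  have -> : r * r = 1 - t ^+ 2 by rewrite s2 expr2; ring.
  ring.
Qed.

End RealShift.

(** * The isomorphism *)

Section Isomorphism.
Variables (R : realType) (G : ultragraph) (A : cstarAlgType R).
Variables (s : edge G -> A) (p : set (vert G) -> A).
Hypothesis ck : ck_family s p.
Hypothesis hG : RFUM2 G.
Local Notation V := (vert G).
Local Notation E := (edge G).
Local Notation X := (bspace G).
Local Notation F := (freegroup E).
Variables (A' : cstarAlgType R) (iota : (F -> X -> R[i]) -> A').
Hypothesis hB : is_crossed_product (@bdom G) (@bact G) iota.
Implicit Types (B C : set V) (b : seq E) (e : E) (l : E * bool).
Implicit Types (f g : X -> R[i]) (w : seq (E * bool)) (t r : F).
Local Notation "x ^s" := (cstar x) (at level 2, format "x ^s").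
Local Notation pact := (pact (@bdom G) (@bact G)).
Local Notation alg := (@alg_crossed_product R X F (@bdom G)).
Local Notation iotaC0 := (iotaC0 iota).
Local Notation iota_s := (iota_s iota).
Local Notation iota_p := (iota_p iota).
Local Notation diag_pi := (diag_pi s p).
Local Notation Psi := (Psi s p).

Lemma nrm_iotaC0_real f : C0 setT f -> (forall y, Num.conj (f y) = f y) ->
  (forall y, nrm (f y) <= 1) -> nrm (iotaC0 f) <= 2.
Proof.
move=> Cf fr f1; have [g [Cg gr gE]] := sqrt_shift_fun Cf fr f1.
have ConjE h : (forall y, Num.conj (h y) = h y) -> fconj h = h.
  by move=> hr; apply/funext.
have Jf : (iotaC0 f)^s = iotaC0 f by rewrite -(iotaC0_star hB)// ConjE.
have Jg : (iotaC0 g)^s = iotaC0 g by rewrite -(iotaC0_star hB)// ConjE.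
have Jfg : iotaC0 f ** iotaC0 g = iotaC0 g ** iotaC0 f.
  by rewrite -!(iotaC0M hB)// mulrC.
have JE : iotaC0 g + iotaC0 g - iotaC0 g ** iotaC0 g = iotaC0 f ** iotaC0 f.
  rewrite -!(iotaC0M hB)// -gE -(iotaC0D hB)// -(iotaC0B hB)//.
    exact: C0D.
  exact: C0M.
exact: nrm_of_sqrt_shift Jf Jg Jfg JE.
Qed.


(** [is_crossed_product] bounds |iota a| only from below, and C_0(X) is not packaged as a
    [cstarAlgType] to which [star_hom_bounded] could apply, so the unitary argument is repeated with
    functions. The constant is 2 + 2, for the real and the imaginary part. *)
Lemma nrm_iotaC0_le f (M : R) : 0 < M -> C0 setT f -> (forall y, nrm (f y) <= M) ->
  nrm (iotaC0 f) <= 4 * M.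
Proof.
move=> M0 Cf fM.
(* [f1] and [f2] are the real and imaginary parts of f, divided by M. *)
pose f1 := (2 * M)^-1%:C *: (f + fconj f : X -> R[i]).
pose f2 := ((2 * M)^-1%:C * - 'i%C) *: (f - fconj f : X -> R[i]).
have Ccf := C0_conj Cf.
have C1 : C0 setT f1 by apply: C0Z; exact: C0D.
have C2 : C0 setT f2.
  by apply: C0Z; rewrite -(scaleN1r (fconj f)); apply: C0D => //; exact: C0Z.
have M2 : 0 < (2 * M)^-1 by rewrite invr_gt0 mulr_gt0.
have nM : nrm ((2 * M)^-1%:C : R[i]) = (2 * M)^-1 by rewrite nrmC_real ger0_norm// ltW.
have bound (z : R[i]) : nrm z <= M + M -> (2 * M)^-1 * nrm z <= 1.
  by move=> zM; rewrite -ler_pdivlMl// invrK mulr1; lra.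
have conjM (x z : R[i]) : Num.conj (x * z) = Num.conj x * Num.conj z by exact: rmorphM.
have conjD (x z : R[i]) : Num.conj (x + z) = Num.conj x + Num.conj z by exact: rmorphD.
have conjB (x z : R[i]) : Num.conj (x - z) = Num.conj x - Num.conj z by exact: rmorphB.
have f1E y : f1 y = (2 * M)^-1%:C * (f y + Num.conj (f y)) by [].
have f2E y : f2 y = (2 * M)^-1%:C * - 'i%C * (f y - Num.conj (f y)) by [].
have conj_Ni : Num.conj (- 'i%C : R[i]) = 'i%C.
  by rewrite -[in LHS](add0r (- _)) conjB conj_i opprK conjC0 add0r.
have J1 : nrm (iotaC0 f1) <= 2.
  apply: nrm_iotaC0_real => // y; rewrite f1E.
    by rewrite conjM conjD conjCK conj_real addrC.
  rewrite nrmCM nM; apply: bound; apply: le_trans (nrmD _ _) _.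
  by rewrite nrmC_conj; apply: lerD.
have J2 : nrm (iotaC0 f2) <= 2.
  apply: nrm_iotaC0_real => // y; rewrite f2E.
    by rewrite !conjM conjB conjCK conj_real conj_Ni -!mulrA mulNr -mulrN opprB.
  rewrite !nrmCM nrmN nrmCi mulr1 nM; apply: bound; apply: le_trans (nrmB _ _) _.
  by rewrite nrmC_conj; apply: lerD.
have -> : f = M%:C *: f1 + (M%:C * 'i%C) *: f2.
  apply/funext => y; rewrite -[RHS]/(M%:C * f1 y + (M%:C * 'i%C) * f2 y) f1E f2E.
  have E1 : M%:C * (2 * M)^-1%:C = 2^-1 :> R[i].
    rewrite -rmorphM (_ : M * _ = 2^-1); last by field; rewrite gt_eqF.
    by rewrite fmorphV rmorph_nat.
  have E2 : M%:C * 'i%C * ((2 * M)^-1%:C * - 'i%C) = 2^-1 :> R[i].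
    by rewrite mulrACA E1 mulrN -expr2 sqr_i opprK mulr1.
  rewrite !mulrA E1 -(mulrA _ (2 * M)^-1%:C) E2 -mulrDr addrACA subrr addr0.
  by rewrite -mulr2n -[f y *+ 2]mulr_natl mulrA mulVf ?mul1r// pnatr_eq0.
have nM' : nrm (M%:C : R[i]) = M by rewrite nrmC_real gtr0_norm.
rewrite (iotaC0D hB); [|exact: C0Z|exact: C0Z].
rewrite (iotaC0Z hB _ C1) (iotaC0Z hB _ C2); apply: le_trans (nrmD _ _) _.
by rewrite !nrmZ nrmCM nrmCi mulr1 nM'; nra.
Qed.

(** * Comparison of Phi and Psi *)

Section Comparison.
Variable Phi : A -> A'.
Hypothesis Phi_hom : star_hom Phi.
Hypothesis Phi_s : forall e, Phi (s e) = iota_s e.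
Hypothesis Phi_p : forall B, gvert B -> Phi (p B) = iota_p B.

Lemma Phi_lets l : Phi (lets s l) = lets iota_s l.
Proof. by case: l => e []; rewrite /lets /= ?(star_hom_star Phi_hom) Phi_s. Qed.

Lemma Phi0 : Phi 0 = 0.
Proof. by rewrite -[X in Phi X](scale0r 0) (star_homZ Phi_hom) scale0r. Qed.

Lemma PhiB x z : Phi (x - z) = Phi x - Phi z.
Proof. by rewrite (star_homD Phi_hom) -[in LHS]scaleN1r (star_homZ Phi_hom) scaleN1r. Qed.

Lemma Phi_q b B : gvert B -> Phi (cyl_proj s p b B) = iotaC0 (\1_(cylinder b B)).
Proof.
move=> gB; elim: b => [|e b IH] /=; first by rewrite cylinder_nil Phi_p.
have Cb := C0_cylinder R hG b gB.
have pE : pact (fglet (e, true)) (\1_(cylinder b B) : X -> R[i]) = \1_(cylinder (e :: b) B).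
  apply/funext => y; have [ye|ye] := pselect (bdom (fglet (e, true)) y).
    rewrite pactE// fgletV.
    have [yb|yb] := pselect (cylinder (e :: b) B y).
      by rewrite !cind_in//; have [_] := (cylinder_cons _ _ _ _).1 yb.
    by rewrite !cind_out// => yb'; apply: yb; apply/cylinder_cons.
  by rewrite pact_out// cind_out// => /cylinder_cons[].
rewrite !(star_homM Phi_hom) (star_hom_star Phi_hom) IH !Phi_s.
rewrite -[iota_s e]/(iota (ulet R (e, true))) (iota_ulet_mul hG hB _ (C0_1 Cb)) mulg1 pE.
rewrite -(lets_iota_s hG hB (e, true)) -lets_linv (lets_iota_s hG hB).
rewrite -(cp_iotaM hB); last 2 first.
- by apply: alg_delta; rewrite -pE; exact: (C0_pact ck hG).
- exact: (alg_ulet R hG).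
rewrite delta_mul ?fgletM; last by rewrite -pE; exact: (C0_pact ck hG).
rewrite pact_ilet mulrC ilet_mul// => y ye.
by rewrite cind_out// => /cylinder_cons[].
Qed.

Lemma Phi_span f d : span_pair s p f d -> Phi d = iotaC0 f.
Proof.
elim=> [|k b B f' d' gB sf IH]; first by rewrite Phi0 (iotaC00 hB).
have Cb := C0_cylinder R hG b gB.
have Cf' := diag_rel_C0 hG (span_pair_diag_rel sf).
rewrite (star_homD Phi_hom) (star_homZ Phi_hom) Phi_q// IH.
by rewrite (iotaC0D hB) ?(iotaC0Z hB)//; exact: C0Z.
Qed.

Lemma Phi_diag_pi f : C0 setT f -> Phi (diag_pi f) = iotaC0 f.
Proof.
move=> Cf; have Gf := diag_piP ck hG Cf.
have [C C_ge0 PhiC] := star_hom_bounded Phi_hom.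
apply/eqP; rewrite -subr_eq0; apply/eqP/nrm_small => e e0.
have C4 : 0 < C + 4 by rewrite ltr_wpDl.
(* [C] is the share of Phi on the error in A, and 4 that of [iotaC0] on the error of functions. *)
have e1 : 0 < e / (C + 4) by rewrite divr_gt0.
have [g [c [sg fg dc]]] := Gf _ e1.
have Cg := diag_rel_C0 hG (span_pair_diag_rel sg).
have Cfg : C0 setT (f - g).
  by rewrite -(scaleN1r g); apply: C0D => //; exact: C0Z.
have := nrm_dist (Phi (diag_pi f)) (Phi c) (iotaC0 f).
rewrite -PhiB (Phi_span sg) (nrm_distC (iotaC0 g)) -(iotaC0B hB)//.
have := PhiC (diag_pi f - c); have := nrm_iotaC0_le e1 Cfg fg.
have : C * nrm (diag_pi f - c) <= C * (e / (C + 4)) by rewrite ler_wpM2l.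
have : C * (e / (C + 4)) + 4 * (e / (C + 4)) = e by field; rewrite gt_eqF.
lra.
Qed.

Lemma Phi_rmulw x w : Phi (rmulw s x w) = rmulw iota_s (Phi x) w.
Proof.
by elim: w x => //= l w IH x; rewrite IH (star_homM Phi_hom) Phi_lets.
Qed.

Lemma rcancel_reduced l w : reduced (l :: w) -> rcancel l w = l :: w.
Proof. by case: w => //= m w /andP[/negbTE ->]. Qed.

(** Peel off the first letter: f delta_(lw) is the product of 1_l delta_l and alpha_(l^-1)(f)
    delta_w, whose coefficient is supported in X_w; reducedness makes the word l w the product in
    the group. *)
Lemma rmulw_iotaC0 w (rw : reduced w) f : C0 (bdom (FreeGroup rw)) f ->
  rmulw iota_s (iotaC0 f) w = iota (delta (FreeGroup rw) f).
Proof.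
elim: w rw f => [|l w IH] rw f Cf; first by rewrite (_ : FreeGroup rw = 1%g)//; exact: val_inj.
have rw' := reduced_cons rw.
have [Cf' f0] := (C0_setT _ _).1 Cf.
have lE : (fglet l * FreeGroup rw')%g = FreeGroup rw.
  by apply: val_inj; rewrite -[LHS]/(rcancel l w) rcancel_reduced.
have fl y : ~ bdom (fglet l) y -> f y = 0.
  by move=> yl; apply: f0 => /bdom_word[].
pose f' := pact (fglet (linv l)) f.
have Cf1 : C0 setT f' := C0_setTW (C0_pact ck hG _ Cf').
have Cf2 : C0 (bdom (FreeGroup rw')) f'.
  apply/C0_setT; split => // y yw.
  have [ly|ly] := pselect (bdom (fglet (linv l)) y); last by rewrite /f' pact_out.
  rewrite /f' pactE// fgletV f0// => /bdom_word[_]; have [_ ->] := lactK ly.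
  by move=> wy; apply: yw; exact/bdom_word.
have f'f : pact (fglet l) f' = f by rewrite /f' -fgletV pactK.
rewrite /= (iotaC0_lets hG hB)// mulrC ilet_mul//.
have -> : iota (delta (fglet l) f) = iota (ulet R l) ** iotaC0 f'.
  by rewrite (iota_ulet_mul hG hB _ (C0_1 Cf1)) mulg1 f'f.
by rewrite rmulwM (IH rw')// (iota_ulet_mul hG hB)// lE f'f.
Qed.

Lemma Phi_Psi a : alg a -> Phi (Psi a) = iota a.
Proof.
move: a; apply: alg_ind => [|t f a Cf Ha IH].
  by rewrite (Psi0 ck hG) Phi0 -[X in iota X](scale0r 0) (cp_iotaZ hB) ?scale0r//; exact: alg0.
have Hd := alg_delta Cf.
rewrite (PsiD ck hG)// (star_homD Phi_hom) IH (cp_iotaD hB)//; congr (_ + _).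
rewrite (Psi_delta ck hG) Phi_rmulw Phi_diag_pi; last exact: C0_setTW Cf.
by case: t Cf {Hd} => w rw Cf; exact: rmulw_iotaC0.
Qed.

Lemma nrm_Psi_le a : alg a -> nrm (Psi a) <= nrm (iota a).
Proof.
by move=> Ha; have := cp_iota_max hB (Psi_seminorm ck hG) Ha; rewrite nrmE lecR.
Qed.

Hypothesis generated : forall U : set A, closed U -> star_subalg U ->
  (forall e, U (s e)) -> (forall B, gvert B -> U (p B)) -> U = setT.

(** The closure of the range of Psi is a closed *-subalgebra containing the generators. *)
Lemma Psi_dense x (e : R) : 0 < e -> exists2 a, alg a & nrm (x - Psi a) <= e.
Proof.
pose U := [set x : A | forall e : R, 0 < e -> exists2 a, alg a & nrm (x - Psi a) <= e].
suff Ux : U x by exact: Ux.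
have Psi_U a : alg a -> U (Psi a) by move=> Ha d d0; exists a; rewrite // subrr nrm0 ltW.
suff UT : U = setT by rewrite UT.
apply: generated.
- apply/closed_nrmP => z H d d0; have d2 : 0 < d / 2 by rewrite divr_gt0.
  have [z' Uz' zz'] := H _ d2; have [a Ha az'] := Uz' _ d2.
  by exists a => //; have := nrm_dist z z' (Psi a); lra.
- split.
  + by rewrite -(Psi0 ck hG); apply: Psi_U; exact: alg0.
  + move=> z1 z2 U1 U2 d d0; have d2 : 0 < d / 2 by rewrite divr_gt0.
    have [a1 Ha1 az1] := U1 _ d2; have [a2 Ha2 az2] := U2 _ d2.
    exists (a1 + a2); first exact: algD.
    by rewrite (PsiD ck hG)// opprD addrACA; apply: le_trans (nrmD _ _) _; lra.
  + move=> k z Uz d d0; have k0 : 0 < nrm k + 1 by rewrite ltr_wpDl ?nrm_ge0.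
    have d2 : 0 < d / (nrm k + 1) by rewrite divr_gt0.
    have [a Ha az] := Uz _ d2; exists (k *: a); first exact: algZ.
    rewrite (PsiZ ck hG)// -scalerBr nrmZ.
    move: az; rewrite ler_pdivlMr//; have := nrm_ge0 k; have := nrm_ge0 (z - Psi a).
    by nra.
  + move=> z1 z2 U1 U2 d d0.
    pose K := nrm z1 + nrm z2 + 1.
    have n1 := nrm_ge0 z1; have n2 := nrm_ge0 z2; have K0 : 0 < K by rewrite /K; lra.
    have Kd : 0 < K + d by rewrite addr_gt0.
    pose d' := d / (K + d); have d'0 : 0 < d' by rewrite divr_gt0.
    have d'1 : d' <= 1 by rewrite /d' ler_pdivrMr// mul1r; lra.
    have d'K : K * d' <= d by rewrite /d' mulrA ler_pdivrMr// mulrC ler_pM2l//; lra.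
    have [a1 Ha1 az1] := U1 _ d'0; have [a2 Ha2 az2] := U2 _ d'0.
    exists (Defs.cp_mul (@bdom G) (@bact G) a1 a2); first exact: (alg_mul ck hG).
    rewrite (PsiM ck hG)//.
    have -> : z1 ** z2 - Psi a1 ** Psi a2 =
        z1 ** (z2 - Psi a2) + (z1 - Psi a1) ** Psi a2.
      by rewrite cmulBr cmulBl addrA subrK.
    apply: le_trans (nrmD _ _) _.
    have := nrmM z1 (z2 - Psi a2); have := nrmM (z1 - Psi a1) (Psi a2).
    have := nrm_le_dist (Psi a2) z2; rewrite nrm_distC.
    have := nrm_ge0 (Psi a2); have := nrm_ge0 (z1 - Psi a1).
    have := nrm_ge0 (z2 - Psi a2); rewrite /K in d'K => ? ? ? ? ? ?.
    have : nrm z1 * nrm (z2 - Psi a2) <= nrm z1 * d' by apply: ler_pM.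
    have : nrm (z1 - Psi a1) * nrm (Psi a2) <= d' * (nrm z2 + 1) by apply: ler_pM => //; lra.
    by nra.
  + move=> z Uz d d0; have [a Ha az] := Uz _ d0.
    exists (Defs.cp_star (@bdom G) (@bact G) a); first exact: (alg_star ck hG).
    by rewrite (Psi_star ck hG)// -cstarB nrm_cstar.
- move=> f; rewrite -(Psi_s ck hG f); apply: Psi_U; apply: alg_delta.
  exact: (C0_ilet R hG (f, true)).
- by move=> B gB; rewrite -(Psi_p ck hG gB); apply: Psi_U; apply: alg1; exact: (C0_bsrc R hG).
Qed.

Lemma Phi_expands x : nrm x <= nrm (Phi x).
Proof.
have [C C_ge0 PhiC] := star_hom_bounded Phi_hom.
apply/ler_addgt0Pr => e e0; have C1 : 0 < C + 1 by rewrite ltr_wpDl.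
(* Replacing x by Psi a costs e / (C + 1) on the left and C times as much on the right. *)
have e1 : 0 < e / (C + 1) by rewrite divr_gt0.
have [a Ha xa] := Psi_dense x e1.
have := nrm_Psi_le Ha; rewrite -Phi_Psi//.
have := nrm_le_dist x (Psi a); have := nrm_le_dist (Phi (Psi a)) (Phi x).
rewrite -PhiB; have := PhiC (Psi a - x); rewrite (nrm_distC (Psi a)).
have : C * nrm (x - Psi a) <= C * (e / (C + 1)) by rewrite ler_wpM2l.
have : C * (e / (C + 1)) + (e / (C + 1)) = e by field; rewrite gt_eqF.
lra.
Qed.

Lemma Phi_bijective : bijective Phi.
Proof.
have inj : injective Phi.
  move=> x z xz; apply/eqP; rewrite -subr_eq0; apply/eqP/nrm_eq0/eqP.
  rewrite eq_le nrm_ge0 andbT; apply: le_trans (Phi_expands _) _.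
  by rewrite PhiB xz subrr nrm0.
have [C C_ge0 PhiC] := star_hom_bounded Phi_hom.
have surj (b : A') : exists x, Phi x = b.
  have /closure_nrmP bcl : closure (iota @` alg) b by rewrite (cp_iota_dense hB).
  have h0 n : (0 : R) < 2^-1 ^+ n by rewrite exprn_gt0// invr_gt0.
  have /choice[a aP] : forall n : nat, exists a, alg a /\ nrm (b - iota a) < 2^-1 ^+ n.
    by move=> n; have [_ [a Ha <-] ba] := bcl _ (h0 n); exists a.
  (* The elements Psi (a n) form a Cauchy sequence because their images do and Phi does not shrink
     distances. *)
  have [n|x xP] := @complete_half _ _ (fun n => Psi (a n)) 2.
    have [Ha ba] := aP n; have [Ha' ba'] := aP n.+1.
    apply: le_trans (Phi_expands _) _; rewrite PhiB !Phi_Psi//.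
    have := nrm_dist (iota (a n.+1)) b (iota (a n)); rewrite (nrm_distC _ b).
    by have := h0 n; move: ba'; rewrite exprS; lra.
  (* 4 C bounds the image of x - Psi (a n), and 1 the distance from iota (a n) to b. *)
  exists x; apply/eqP; rewrite -subr_eq0; apply/eqP; apply: (@half_small _ _ _ (4 * C + 1)) => n.
  have [Ha ba] := aP n.
  have xn : nrm (x - Psi (a n)) <= 4 * 2^-1 ^+ n by have := xP n; lra.
  have := ler_wpM2l C_ge0 xn; have := PhiC (x - Psi (a n)); rewrite PhiB Phi_Psi//.
  have := nrm_dist (Phi x) (iota (a n)) b; rewrite (nrm_distC (iota (a n))).
  by lra.
have /choice[g gP] := surj.
by exists g => [x|b]; [apply: inj; rewrite gP|rewrite gP].
Qed.

End Comparison.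
End Isomorphism.

Theorem theorem4p15 (R : realType) (G : ultragraph) (hG : RFUM2 G)
  (A : cstarAlgType R) (s : edge G -> A) (p : set (vert G) -> A)
  (hA : is_ultragraph_cstar s p)
  (B : cstarAlgType R)
  (iota : (freegroup (edge G) -> bspace G -> R[i]) -> B)
  (hB : is_crossed_product (@bdom G) (@bact G) iota) :
  exists Phi : A -> B,
    [/\ star_iso Phi,
        forall e : edge G,
          Phi (s e) = iota (delta (fggen e) (\1_(bdom (fggen e))))
      & forall C : set (vert G), gvert C ->
          Phi (p C) = iota (delta 1%g (\1_(bsrc C)))].
Proof.
have ck := ugc_family hA.
have [Phi [Phi_hom Phi_s Phi_p]] := ugc_universal hA (ck_family_iota hG hB).
exists Phi; split => //; split => //.
exact: (Phi_bijective ck hG hB Phi_hom Phi_s Phi_p (ugc_generated hA)).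
Qed.
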